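(* If the field $\mathbb F$ is either $\mathbb R$ or $\mathbb C$, then the moduli space $\mathbb M_3(\mathbb F)=\mathfrak C_3^{\mathsf{fs}}(\mathbb F)/\mathbf G(\mathbb F)$ can be identified with the quotient of the punctured $(a,b)$-plane $\mathbb F^2\smallsetminus\{(0,0)\}$ by the equivalence relation $$(a,b)\sim(t^4a,\,t^6b)\qquad\text{for any } t\in\mathbb F,\ t\ne0,$$ where $(a,b)$ corresponds to the projective equivalence class of the cubic curve $y^2=x^3+ax+b$. In the real case this moduli space is homeomorphic to the unit circle; while in the complex case it is homeomorphic to the topological 2-sphere consisting of all ratios $(a^3:b^2)\in\mathbb P^1(\mathbb C)$.
   Context: An irreducible curve of degree $n$ over $\mathbb F$ in $\mathbb P^2(\mathbb F)$ is an irreducible homogeneous polynomial $\Phi(x,y,z)$ of degree $n$ over $\mathbb F$, up to multiplication by nonzero constants. An effective 1-cycle of degree $n$ is a formal sum $\sum m_j\mathcal C_j$ with distinct irreducible curves $\mathcal C_j$ over $\mathbb F$, integers $m_j\ge1$, and $\sum m_j\deg\mathcal C_j=n$; it is a curve if all $m_j=1$. The space $\widehat{\mathfrak C}_n(\mathbb F)$ of 1-cycles of degree $n$ is the projective space of nonzero homogeneous polynomials of degree $n$ in three variables up to constants. $\mathbf G(\mathbb F)=\mathrm{PGL}_3(\mathbb F)$ acts on it (if $\mathcal C$ is $\Phi=0$, then $g(\mathcal C)$ is $\Phi\circ g^{-1}=0$). The moduli space $\mathbb M_n(\mathbb F)$ is the quotient, with the quotient topology, of the open set of degree $n$ cycles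 with finite stabilizer by $\mathbf G$. For $n=3$ every 1-cycle with finite stabilizer is an irreducible curve, and $\mathfrak C_3^{\mathsf{fs}}(\mathbb F)$ is the set of cubic curves with finite stabilizer. The equation $y^2=x^3+ax+b$ is written in affine coordinates $(x:y:1)$. *)

(* Defs.v *)
From HB Require Import structures.
From mathcomp Require Import all_boot all_order all_algebra.
From mathcomp Require Import all_classical all_reals all_analysis.
(* The notations of mpoly clash with those of MathComp-Analysis; its constants
   are used directly: mpoly n F is {mpoly F[n]}, mpolyX F (mnm1 i) is 'X_i,
   comp_mpoly t p is p \mPo t, ishomog1 d mdeg is d.-homog. *)
From mathcomp Require Import -(notations) mpoly.
From mathcomp Require Import complex.

Set Implicit Arguments.
Unset Strict Implicit.
Unset Printing Implicit Defensive.

Import Order.TTheory GRing.Theory Num.Theory.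
Import numFieldNormedType.Exports.

Local Open Scope classical_set_scope.
Local Open Scope ring_scope.
Local Open Scope quotient_scope.

Definition homeomorphism (X Y : topologicalType) (f : X -> Y) : Prop :=
  continuous f /\
  exists g : Y -> X, [/\ continuous g, cancel f g & cancel g f].

Definition homeomorphic (X Y : topologicalType) : Prop :=
  exists f : X -> Y, homeomorphism f.

Section ScalarQuotient.
Context {F : fieldType}.

Definition proportional (V : lmodType F) (u v : V) : Prop :=
  exists2 c : F, c != 0 & v = c *: u.

Lemma proportional_refl (V : lmodType F) (u : V) : proportional u u.
Proof. by exists 1; rewrite ?oner_neq0 ?scale1r. Qed.

Lemma proportional_sym (V : lmodType F) (u v : V) :
  proportional u v -> proportional v u.
Proof.
by move=> [c c0 ->]; exists c^-1; rewrite ?invr_eq0// scalerA mulVf// scale1r.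
Qed.

Lemma proportional_trans (V : lmodType F) (u v w : V) :
  proportional u v -> proportional v w -> proportional u w.
Proof.
by move=> [c c0 ->] [d d0 ->]; exists (d * c); rewrite ?mulf_neq0// scalerA.
Qed.

Context {V : lmodType F} (A : set V).

Definition scalar_rel (u v : A) : bool := `[< proportional (\val u) (\val v) >].

Lemma scalar_rel_refl : reflexive scalar_rel.
Proof. by move=> u; apply/asboolP; exact: proportional_refl. Qed.

Lemma scalar_rel_sym : ssrbool.symmetric scalar_rel.
Proof. by move=> u v; apply/asboolP/asboolP; exact: proportional_sym. Qed.

Lemma scalar_rel_trans : transitive scalar_rel.
Proof.
move=> v u w /asboolP uv /asboolP vw.
by apply/asboolP; exact: proportional_trans uv vw.
Qed.

Canonical scalar_equiv : equiv_rel A :=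
  EquivRel scalar_rel scalar_rel_refl scalar_rel_sym scalar_rel_trans.

Definition mod_scalars := {eq_quot scalar_equiv}.

Lemma mod_scalarsP (u v : A) :
  \pi_mod_scalars u = \pi_mod_scalars v <-> proportional (\val u) (\val v).
Proof.
split=> [/eqP|uv]; first by rewrite eqmodE => /asboolP.
by apply/eqP; rewrite eqmodE; apply/asboolP.
Qed.

End ScalarQuotient.

Section ProjectiveSpace.
Context {F : numFieldType} (V : preTopologicalLmodType F).

Definition nonzero : set V := [set v | v != 0].

Definition proj_space := quotient_topology (mod_scalars nonzero).

Lemma proj_spaceP (u v : nonzero) :
  \pi_proj_space u = \pi_proj_space v <-> proportional (\val u) (\val v).
Proof. exact: mod_scalarsP. Qed.

End ProjectiveSpace.

Arguments nonzero {F} V.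

(* Homogeneous polynomials of degree d in n variables carry the topology of
   coefficientwise convergence. *)
Section HomogeneousTopology.
Context (n : nat) (F : numFieldType) (d : nat).

Definition dhomog_coeffs (p : dhomog n F d) : {ptws multinom n -> F} :=
  fun m => mcoeff m (p : mpoly n F).

HB.instance Definition _ :=
  Topological.copy (dhomog n F d) (initial_topology dhomog_coeffs).

End HomogeneousTopology.

Section LinearSubstitution.
Context {F : fieldType}.
Implicit Types (p : mpoly 3 F) (A B : 'M[F]_3).

Definition mvar (i : 'I_3) : mpoly 3 F := mpolyX F (mnm1 i).

(* mlin A p is the polynomial v |-> p (A v), with v a column vector. *)
Definition mlin A p : mpoly 3 F :=
  comp_mpoly [tuple \sum_(j < 3) A i j *: mvar j | i < 3] p.

Lemma mlin1 p : mlin 1%:M p = p.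
Proof.
rewrite -[RHS]comp_mpoly_id /mlin; congr comp_mpoly.
apply: eq_from_tnth => i; rewrite !tnth_mktuple (bigD1 i)//= mxE eqxx scale1r.
rewrite big1 ?addr0// => j ji.
by rewrite mxE eq_sym (negbTE ji) scale0r.
Qed.

Lemma mlinM A B p : mlin (A *m B) p = mlin B (mlin A p).
Proof.
rewrite [mlin A p]/mlin comp_mpolyEX /mlin raddf_sum/= comp_mpolyEX.
apply: eq_bigr => m _; rewrite comp_mpolyZ; congr (_ *: _).
rewrite !comp_mpolyX rmorph_prod/=; apply: eq_bigr => i _.
rewrite rmorphXn/= !tnth_mktuple; congr (_ ^+ _).
transitivity (\sum_(j < 3) A i j *: \sum_(k < 3) B j k *: mvar k); last first.
  rewrite raddf_sum/=; apply: eq_bigr => j _.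
  by rewrite comp_mpolyZ /mvar comp_mpolyXU -tnth_nth tnth_mktuple.
under [RHS]eq_bigr do rewrite scaler_sumr.
rewrite exchange_big/=; apply: eq_bigr => k _.
rewrite mxE scaler_suml; apply: eq_bigr => j _.
by rewrite scalerA.
Qed.

Lemma mlinZ A c p : mlin A (c *: p) = c *: mlin A p.
Proof. exact: comp_mpolyZ. Qed.

Lemma mlin0 A : mlin A 0 = 0.
Proof. exact: comp_mpoly0. Qed.

Lemma mlin_scale d c A p : p \is ishomog1 d mdeg ->
  mlin (c *: A) p = c ^+ d *: mlin A p.
Proof.
move=> /dhomogP hp; rewrite /mlin !comp_mpolyEX scaler_sumr big_seq.
rewrite [RHS]big_seq; apply: eq_bigr => m /hp md.
have {}md : (\sum_i m i)%N = d by rewrite -mdegE.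
rewrite scalerA mulrC -scalerA; congr (_ *: _); rewrite !comp_mpolyX.
rewrite -md -prodrXr -scaler_prod; apply: eq_bigr => i _.
rewrite !tnth_mktuple -exprZn; congr (_ ^+ _); rewrite scaler_sumr.
by apply: eq_bigr => j _; rewrite mxE scalerA.
Qed.

Lemma mlin_homog d A p : p \is ishomog1 d mdeg -> mlin A p \is ishomog1 d mdeg.
Proof.
move=> /dhomogP hp; rewrite /mlin comp_mpolyEX big_seq.
apply: rpred_sum => m /hp md; apply: rpredZ; rewrite comp_mpolyX.
have {md}<- : (\sum_i m i)%N = d by rewrite -mdegE.
elim/big_ind2 : _ => [|e p1 f p2 h1 h2|i _]; first exact: dhomog1.
- exact: dhomogM.
- have h : tnth [tuple \sum_(j < 3) A i0 j *: mvar j | i0 < 3] i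
      \is ishomog1 1 mdeg.
    rewrite tnth_mktuple; apply: rpred_sum => j _; apply: rpredZ.
    by rewrite dhomogX; apply/eqP; exact: mdeg1.
  by have := dhomogMn (m i) h; rewrite mul1n.
Qed.

End LinearSubstitution.

Section ProjectiveAction.
Context {F : numFieldType}.

Definition GL3 : set 'M[F]_3 := [set g | g \in unitmx].

Lemma GL3_unit (g : GL3) : \val g \in unitmx.
Proof. exact: (set_valP g). Qed.

Definition GL3_one : GL3 := exist _ 1%:M (mem_set (unitmx1 F 3)).

Lemma GL3_mul_subproof (g h : GL3) : GL3 (\val g *m \val h).
Proof. by rewrite /GL3/= unitmx_mul !GL3_unit. Qed.

Definition GL3_mul (g h : GL3) : GL3 :=
  exist _ (\val g *m \val h) (mem_set (GL3_mul_subproof g h)).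

Lemma GL3_inv_subproof (g : GL3) : GL3 (invmx (\val g)).
Proof. by rewrite /GL3/= unitmx_inv GL3_unit. Qed.

Definition GL3_inv (g : GL3) : GL3 :=
  exist _ (invmx (\val g)) (mem_set (GL3_inv_subproof g)).

Definition PGL3 := mod_scalars GL3.

Definition form_space (n : nat) : preTopologicalLmodType F := dhomog 3 F n.

Local Notation form n := (nonzero (form_space n)).

Definition form_poly n (p : form n) : mpoly 3 F := \val (\val p).

Lemma form_homog n (p : form n) : form_poly p \is ishomog1 n mdeg.
Proof. exact: dhomog_is_dhomog. Qed.

Lemma form_neq0 n (p : form n) : form_poly p != 0.
Proof. exact: (set_valP p). Qed.

Section MkForm.
Context (n : nat) (p : mpoly 3 F).
Hypotheses (hp : p \is ishomog1 n mdeg) (p0 : p != 0).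

Lemma mkform_subproof : nonzero (form_space n) (DHomog hp).
Proof. exact: p0. Qed.

Definition mkform : form n := exist _ (DHomog hp) (mem_set mkform_subproof).

End MkForm.

Lemma form_inj n : injective (@form_poly n).
Proof. by move=> p q pq; do 2!apply: val_inj. Qed.

Lemma mlin_neq0 (g : GL3) (p : mpoly 3 F) : p != 0 -> mlin (\val g) p != 0.
Proof.
apply: contraNneq => gp0; rewrite -[p]mlin1 -(mulmxV (GL3_unit g)) mlinM gp0.
by rewrite mlin0.
Qed.

(* g maps the curve Phi = 0 to the curve Phi \o g^-1 = 0. *)
Definition form_act n (g : GL3) (p : form n) : form n :=
  mkform (mlin_homog (\val (GL3_inv g)) (form_homog p))
         (mlin_neq0 (GL3_inv g) (form_neq0 p)).

Lemma form_act1 n (p : form n) : form_act GL3_one p = p.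
Proof. by apply: form_inj; rewrite /form_poly/= invmx1 mlin1. Qed.

Lemma form_actM n (g h : GL3) (p : form n) :
  form_act (GL3_mul g h) p = form_act g (form_act h p).
Proof.
apply: form_inj; rewrite /form_poly/= -mlinM; congr mlin.
exact: (@invrM 'M[F]_3 _ _ (GL3_unit g) (GL3_unit h)).
Qed.

Lemma form_actV n (g : GL3) (p : form n) :
  form_act (GL3_inv g) (form_act g p) = p.
Proof.
rewrite -form_actM -[RHS]form_act1; congr form_act.
by apply: val_inj; rewrite /= mulVmx ?GL3_unit.
Qed.

Variable n : nat.

Definition one_cycle := proj_space (form_space n).

(* The action of PGL_3(F) on one_cycle; by pgl_act_pi it does not depend on the
   representatives. *)
Definition pgl_act (g : PGL3) (C : one_cycle) : one_cycle :=
  \pi_one_cycle (form_act (repr g) (repr C)).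

Lemma one_cycleP (p q : form n) :
  \pi_one_cycle p = \pi_one_cycle q <-> proportional (form_poly p) (form_poly q).
Proof.
split=> [/proj_spaceP|] [c c0 pq].
  by exists c => //; rewrite /form_poly pq.
by apply/proj_spaceP; exists c => //; exact: val_inj.
Qed.

Lemma pgl_act_pi (g : GL3) (p : form n) :
  pgl_act (\pi_PGL3 g) (\pi_one_cycle p) = \pi_one_cycle (form_act g p).
Proof.
have /mod_scalarsP[c c0 hg] := esym (reprK (\pi_PGL3 g)).
have /one_cycleP[e e0 hp] := esym (reprK (\pi_one_cycle p)).
apply/esym/one_cycleP; exists (e * c^-1 ^+ n).
  by rewrite mulf_neq0 ?expf_neq0 ?invr_eq0.
rewrite {1}/form_poly/= hg hp.
rewrite invmxZ; last by rewrite -hg GL3_unit.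
by rewrite mlinZ (mlin_scale _ _ (form_homog p)) scalerA.
Qed.

Lemma pgl_act_repr (g : PGL3) (p : form n) :
  pgl_act g (\pi_one_cycle p) = \pi_one_cycle (form_act (repr g) p).
Proof. by rewrite -{1}(reprK g) pgl_act_pi. Qed.

Definition PGL3_one : PGL3 := \pi_PGL3 GL3_one.
Definition PGL3_mul (g h : PGL3) : PGL3 := \pi_PGL3 (GL3_mul (repr g) (repr h)).
Definition PGL3_inv (g : PGL3) : PGL3 := \pi_PGL3 (GL3_inv (repr g)).

Lemma pgl_act1 (C : one_cycle) : pgl_act PGL3_one C = C.
Proof. by elim/quotW: C => p; rewrite pgl_act_pi form_act1. Qed.

Lemma pgl_actM (g h : PGL3) (C : one_cycle) :
  pgl_act (PGL3_mul g h) C = pgl_act g (pgl_act h C).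
Proof.
elim/quotW: C => p; rewrite pgl_act_pi form_actM.
by rewrite [pgl_act h _]pgl_act_repr pgl_act_repr.
Qed.

Lemma pgl_actV (g : PGL3) (C : one_cycle) :
  pgl_act (PGL3_inv g) (pgl_act g C) = C.
Proof.
elim/quotW: C => p.
by rewrite [pgl_act g _]pgl_act_repr pgl_act_pi form_actV.
Qed.

Definition stabilizer (C : one_cycle) : set PGL3 := [set g | pgl_act g C = C].

Definition fs_cycles : set one_cycle := [set C | finite_set (stabilizer C)].

Definition orbit_rel (C D : fs_cycles) : bool :=
  `[< exists g : PGL3, pgl_act g (\val C) = \val D >].

Lemma orbit_rel_refl : reflexive orbit_rel.
Proof.
by move=> C; apply/asboolP; exists PGL3_one; rewrite pgl_act1.
Qed.

Lemma orbit_rel_sym : ssrbool.symmetric orbit_rel.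
Proof.
suff H C D : orbit_rel C D -> orbit_rel D C.
  by move=> C D; apply/idP/idP; exact: H.
move=> /asboolP[g gCD]; apply/asboolP; exists (PGL3_inv g).
by rewrite -gCD pgl_actV.
Qed.

Lemma orbit_rel_trans : transitive orbit_rel.
Proof.
move=> D C E /asboolP[g gCD] /asboolP[h hDE]; apply/asboolP.
by exists (PGL3_mul h g); rewrite pgl_actM gCD.
Qed.

Canonical orbit_equiv : equiv_rel fs_cycles :=
  EquivRel orbit_rel orbit_rel_refl orbit_rel_sym orbit_rel_trans.

(* The moduli space M_n(F). *)
Definition moduli := quotient_topology {eq_quot orbit_equiv}.

Definition irreducible_form (q : mpoly 3 F) : Prop :=
  [/\ exists d, q \is ishomog1 d mdeg, q != 0, q \isn't a GRing.unit &
      forall u v, q = u * v -> u \is a GRing.unit \/ v \is a GRing.unit].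

(* All multiplicities are 1: the polynomial of C is, up to a constant, the
   product of pairwise non-proportional irreducible forms. *)
Definition is_curve (C : one_cycle) : Prop :=
  exists s : seq (mpoly 3 F),
    [/\ {in s, forall q, irreducible_form q},
        forall i j : nat, (i < size s)%N -> (j < size s)%N ->
          proportional s`_i s`_j -> i = j
      & proportional (\prod_(q <- s) q) (form_poly (repr C))].

Definition fs_curves : set one_cycle := [set C | is_curve C /\ fs_cycles C].

End ProjectiveAction.

Arguments one_cycle : clear implicits.
Arguments fs_cycles : clear implicits.
Arguments fs_curves : clear implicits.
Arguments moduli : clear implicits.

Section Weierstrass.
Context (F : numFieldType).

Definition plane : preTopologicalLmodType F :=
  ((F^o * F^o)%type : topologicalLmodType F).

Definition punctured_plane : set plane := nonzero plane.

Definition weighted_scale (t : F) (p : F * F) : F * F :=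
  (t ^+ 4 * p.1, t ^+ 6 * p.2).

Lemma weighted_scale1 p : weighted_scale 1 p = p.
Proof. by case: p => a b; rewrite /weighted_scale/= !expr1n !mul1r. Qed.

Lemma weighted_scaleM s t p :
  weighted_scale s (weighted_scale t p) = weighted_scale (s * t) p.
Proof. by rewrite /weighted_scale/= !exprMn !mulrA. Qed.

Definition weighted_rel (p q : punctured_plane) : bool :=
  `[< exists2 t : F, t != 0 & \val q = weighted_scale t (\val p) >].

Lemma weighted_rel_refl : reflexive weighted_rel.
Proof.
move=> p; apply/asboolP; exists 1; first exact: oner_neq0.
by rewrite weighted_scale1.
Qed.

Lemma weighted_rel_sym : ssrbool.symmetric weighted_rel.
Proof.
suff H p q : weighted_rel p q -> weighted_rel q p.
  by move=> p q; apply/idP/idP; exact: H.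
move=> /asboolP[t t0 qE]; apply/asboolP; exists t^-1; first by rewrite invr_eq0.
by rewrite qE weighted_scaleM mulVf// weighted_scale1.
Qed.

Lemma weighted_rel_trans : transitive weighted_rel.
Proof.
move=> q p r /asboolP[t t0 qE] /asboolP[s s0 rE].
apply/asboolP; exists (s * t); first by rewrite mulf_neq0.
by rewrite rE qE weighted_scaleM.
Qed.

Canonical weighted_equiv : equiv_rel punctured_plane :=
  EquivRel weighted_rel weighted_rel_refl weighted_rel_sym weighted_rel_trans.

Definition weighted_quotient := quotient_topology {eq_quot weighted_equiv}.

(* The homogenization of y^2 - (x^3 + a x + b). *)
Definition weierstrass_poly (a b : F) : mpoly 3 F :=
  let x := mvar 0 in let y := mvar 1 in let z := mvar 2 in
  y ^+ 2 * z - (x ^+ 3 + a *: (x * z ^+ 2) + b *: z ^+ 3).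

Lemma weierstrass_homog a b : weierstrass_poly a b \is ishomog1 3 mdeg.
Proof.
have hv (i : 'I_3) : (mvar i : mpoly 3 F) \is ishomog1 1 mdeg.
  by rewrite dhomogX; apply/eqP; exact: mdeg1.
have hX k i := dhomogMn k (hv i).
rewrite /weierstrass_poly; apply: rpredB.
  exact: (dhomogM (hX 2 1) (hv 2)).
apply: rpredD; last by apply: rpredZ; exact: (hX 3 2).
apply: rpredD; first exact: (hX 3 0).
by apply: rpredZ; exact: (dhomogM (hv 0) (hX 2 2)).
Qed.

Lemma weierstrass_neq0 a b : weierstrass_poly a b != 0.
Proof.
have h : meval (fun i => (i == 0)%:R) (weierstrass_poly a b) = -1.
  rewrite /weierstrass_poly !(mevalB, mevalD, mevalZ, mevalM, rmorphXn, mevalXU)/=.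
  by rewrite !(mulr0, mulr1, mul0r, expr0n, expr1n, addr0, sub0r).
by apply: contra_eq_neq h => ->; rewrite meval0 eq_sym oppr_eq0 oner_neq0.
Qed.

Definition weierstrass_cycle (a b : F) : one_cycle F 3 :=
  \pi_(one_cycle F 3) (mkform (weierstrass_homog a b) (weierstrass_neq0 a b)).

(* m is the projective equivalence class of the curve y^2 = x^3 + a x + b; this
   includes the assertion that the curve has finite stabilizer. *)
Definition is_weierstrass_class (a b : F) (m : moduli F 3) : Prop :=
  exists2 C : fs_cycles F 3,
    \val C = weierstrass_cycle a b & m = \pi_(moduli F 3) C.

Definition proj_line := proj_space plane.

Lemma cube_square_subproof (p : punctured_plane) :
  punctured_plane ((\val p).1 ^+ 3, (\val p).2 ^+ 2).
Proof.
have := set_valP p; apply: contraNneq => -[/eqP + /eqP].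
rewrite !expf_eq0/= => /eqP a0 /eqP b0.
by rewrite [\val p]surjective_pairing a0 b0.
Qed.

Definition cube_square (p : punctured_plane) : punctured_plane :=
  exist _ ((\val p).1 ^+ 3, (\val p).2 ^+ 2) (mem_set (cube_square_subproof p)).

Definition cube_square_ratio (p : punctured_plane) : proj_line :=
  \pi_proj_line (cube_square p).

End Weierstrass.

Arguments punctured_plane : clear implicits.

Section Spheres.
Context (R : realType).

Definition unit_circle : set (R * R) := [set p | p.1 ^+ 2 + p.2 ^+ 2 = 1].

Definition unit_sphere : set (R * R * R) :=
  [set p | p.1.1 ^+ 2 + p.1.2 ^+ 2 + p.2 ^+ 2 = 1].

End Spheres.

Arguments unit_circle : clear implicits.
Arguments unit_sphere : clear implicits.

(* Main.v *)
Require Import Defs.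
From HB Require Import structures.
From mathcomp Require Import all_boot all_order all_fingroup all_algebra.
From mathcomp Require Import all_classical all_reals all_analysis.
From mathcomp Require Import zify ring lra.
From mathcomp Require Import -(notations) mpoly.
From mathcomp Require Import complex.

Set Implicit Arguments.
Unset Strict Implicit.
Unset Printing Implicit Defensive.

Import Order.TTheory GRing.Theory Num.Theory.
Import numFieldNormedType.Exports.
Local Open Scope ring_scope.

(** Why the theorem holds.

    Normal form. A cubic with a smooth flex and without linear factor is, in
    coordinates that put the flex at infinity, a Weierstrass cubic
    y^2 z = x^3 + a x z^2 + b z^3 ([weierstrass_form]). A flex exists as soon as
    there is no linear factor. Over an algebraically closed field the curve meets
    its Hessian; the common point is a flex if it is smooth, and if it is singular
    the cubic is nodal or cuspidal and has a flex that can be written down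
    ([closed_flex]). A real cubic without real lines has no complex ones either
    ([real_line]), and its complex flexes are odd in number, because y |-> - y pairs
    those of a Weierstrass cubic with the exception of the point at infinity.
    Complex conjugation must then fix one of them ([real_flex]).

    Finite stabilizers. A cubic with a linear factor has a one-parameter group of
    symmetries, built from an infinitesimal symmetry of a line and a conic
    ([line_large_stabilizer]), and so has the cusp a = b = 0. All other Weierstrass
    cubics have a finite stabilizer: it permutes the finitely many flexes, and the
    elements that fix the one at infinity are the maps (t^2 x : t^3 y : z) with
    t^4 a = a and t^6 b = b ([wcubic_stabilizer]). So the cycles with finite
    stabilizer are the curves equivalent to a Weierstrass cubic with (a, b)
    different from (0, 0), and they are irreducible ([irreducible_noline]).

    The moduli space. The Aronhold invariants of a form are multiplied by the fourth
    and sixth powers of the determinant under a substitution ([covariant_unit]), and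
    they take the values a and b on the Weierstrass cubic. Therefore they invert
    the map that sends the class of (a, b) to that of the curve, up to the weighted
    action of t. Being polynomials in the coefficients, they show that the
    inverse is continuous ([invariant_map_continuous]).

    Topology. Over the reals the class of (a, b) is determined by the direction of
    (a^3, b |b|), since t^12 is an arbitrary positive number ([quotient_circle]).
    Over the complex numbers it is determined by the ratio of a^3 and b^2; the
    bijection obtained is a homeomorphism because powers are open maps
    ([ratio_homeomorphism]). The complex projective line is a sphere by stereographic
    projection ([proj_line_sphere]). *)

(** * Ternary cubics and linear substitutions *)

Lemma sum3 (V : nmodType) (f : 'I_3 -> V) : \sum_i f i = f 0 + f 1 + f 2.
Proof.
rewrite !big_ord_recr big_ord0 /= add0r.
by congr (f _ + f _ + f _); apply: val_inj.
Qed.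

Lemma forall3 (P : 'I_3 -> Prop) : P 0 -> P 1 -> P 2 -> forall i, P i.
Proof.
move=> P0 P1 P2 [[|[|[|//]]] lt]; [move: P0|move: P1|move: P2];
  by congr P; apply: val_inj.
Qed.

(** The coefficient a_ijk belongs to x^i y^j z^k. With ten named coefficients the
    identities of the theory become polynomial identities that [ring] settles. *)
Record cubic (F : Type) := Cubic {
  a300 : F; a210 : F; a201 : F; a120 : F; a111 : F;
  a102 : F; a030 : F; a021 : F; a012 : F; a003 : F }.

Definition map_cubic (F G : Type) (f : F -> G) (c : cubic F) : cubic G :=
  let: Cubic a300 a210 a201 a120 a111 a102 a030 a021 a012 a003 := c in
  Cubic (f a300) (f a210) (f a201) (f a120) (f a111)
        (f a102) (f a030) (f a021) (f a012) (f a003).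

Section Cubics.
Context {F : numFieldType}.
Implicit Types (c : cubic F) (A B : 'M[F]_3) (u v w : 'cV[F]_3) (k s : F).

Definition ev3 c x y z : F :=
  let: Cubic a300 a210 a201 a120 a111 a102 a030 a021 a012 a003 := c in
  a300 * x ^+ 3 + a210 * x ^+ 2 * y + a201 * x ^+ 2 * z + a120 * x * y ^+ 2
  + a111 * x * y * z + a102 * x * z ^+ 2 + a030 * y ^+ 3 + a021 * y ^+ 2 * z
  + a012 * y * z ^+ 2 + a003 * z ^+ 3.

Definition dx c x y z : F :=
  let: Cubic a300 a210 a201 a120 a111 a102 a030 a021 a012 a003 := c in
  3 * a300 * x ^+ 2 + 2 * a210 * x * y + 2 * a201 * x * z + a120 * y ^+ 2
  + a111 * y * z + a102 * z ^+ 2.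

Definition dy c x y z : F :=
  let: Cubic a300 a210 a201 a120 a111 a102 a030 a021 a012 a003 := c in
  a210 * x ^+ 2 + 2 * a120 * x * y + a111 * x * z + 3 * a030 * y ^+ 2
  + 2 * a021 * y * z + a012 * z ^+ 2.

Definition dz c x y z : F :=
  let: Cubic a300 a210 a201 a120 a111 a102 a030 a021 a012 a003 := c in
  a201 * x ^+ 2 + a111 * x * y + 2 * a102 * x * z + a021 * y ^+ 2
  + 2 * a012 * y * z + 3 * a003 * z ^+ 2.

Definition dxx c x y z := 6 * a300 c * x + 2 * a210 c * y + 2 * a201 c * z.
Definition dxy c x y z := 2 * a210 c * x + 2 * a120 c * y + a111 c * z.
Definition dxz c x y z := 2 * a201 c * x + a111 c * y + 2 * a102 c * z.
Definition dyy c x y z := 2 * a120 c * x + 6 * a030 c * y + 2 * a021 c * z.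
Definition dyz c x y z := a111 c * x + 2 * a021 c * y + 2 * a012 c * z.
Definition dzz c x y z := 2 * a102 c * x + 2 * a012 c * y + 6 * a003 c * z.

Definition ev c v := ev3 c (v 0 0) (v 1 0) (v 2 0).

Definition vec3 (x y z : F) : 'cV[F]_3 := \col_i nth 0 [:: x; y; z] i.

Definition mx3 (a b c d e f g h i : F) : 'M[F]_3 :=
  \matrix_(r, s) nth 0 (nth [::] [:: [:: a; b; c]; [:: d; e; f]; [:: g; h; i]] r) s.

(** The coefficients of v |-> c (A v). By Taylor's formula that of x^2 y is the
    derivative of c at the first column of A in the direction of the second, and
    that of x y z is the third derivative of c along the three columns. *)
Definition csub A c : cubic F :=
  let d (j l : 'I_3) := A 0 l * dx c (A 0 j) (A 1 j) (A 2 j)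
    + A 1 l * dy c (A 0 j) (A 1 j) (A 2 j)
    + A 2 l * dz c (A 0 j) (A 1 j) (A 2 j) in
  let h x y z := A 0 0 * x + A 1 0 * y + A 2 0 * z in
  let D p := p c (A 0 1) (A 1 1) (A 2 1) in
  let t := A 0 2 * h (D dxx) (D dxy) (D dxz)
    + A 1 2 * h (D dxy) (D dyy) (D dyz) + A 2 2 * h (D dxz) (D dyz) (D dzz) in
  Cubic (ev3 c (A 0 0) (A 1 0) (A 2 0)) (d 0 1) (d 0 2) (d 1 0) t (d 2 0)
        (ev3 c (A 0 1) (A 1 1) (A 2 1)) (d 1 2) (d 2 1)
        (ev3 c (A 0 2) (A 1 2) (A 2 2)).

Definition cscale k c := map_cubic ( *%R k) c.

Lemma vec3E v : v = vec3 (v 0 0) (v 1 0) (v 2 0).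
Proof. by apply/colP=> i; rewrite /vec3 !mxE; elim/forall3: i. Qed.

Lemma mx3E A : A = mx3 (A 0 0) (A 0 1) (A 0 2) (A 1 0) (A 1 1) (A 1 2)
                       (A 2 0) (A 2 1) (A 2 2).
Proof. by apply/matrixP=> i j; rewrite /mx3 !mxE; elim/forall3: i; elim/forall3: j. Qed.

Lemma vec3_entry x y z :
  (vec3 x y z 0 0 = x) * (vec3 x y z 1 0 = y) * (vec3 x y z 2 0 = z).
Proof. by rewrite /vec3 !mxE. Qed.

Lemma mx3_entry a b l d e f g h i (A := mx3 a b l d e f g h i) :
  (A 0 0 = a) * (A 0 1 = b) * (A 0 2 = l) * (A 1 0 = d) * (A 1 1 = e) *
  (A 1 2 = f) * (A 2 0 = g) * (A 2 1 = h) * (A 2 2 = i).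
Proof. by rewrite /A /mx3 !mxE. Qed.

Lemma mulmx3_vec3 a b l d e f g h i x y z :
  mx3 a b l d e f g h i *m vec3 x y z =
  vec3 (a * x + b * y + l * z) (d * x + e * y + f * z) (g * x + h * y + i * z).
Proof.
by apply/colP=> r; rewrite [LHS]mxE sum3 !vec3_entry; elim/forall3: r;
  rewrite !mx3_entry vec3_entry.
Qed.

Lemma ev_vec3 c x y z : ev c (vec3 x y z) = ev3 c x y z.
Proof. by rewrite /ev !vec3_entry. Qed.

(** The way in which hypotheses are fed to [ring]: once k (x - y) and a - b are the
    same polynomial, the equation a = b yields x = y. *)
Lemma lin_eq k (x y a b : F) : a = b -> k != 0 -> k * (x - y) = a - b -> x = y.
Proof.
move=> -> k0; rewrite subrr => /eqP; rewrite mulf_eq0 (negbTE k0) subr_eq0.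
by move/eqP.
Qed.

(** Values at ten points with coordinates 0, 1 and -1 determine the coefficients,
    as 2 is invertible. *)
Lemma ev_inj c d : ev c =1 ev d -> c = d.
Proof.
case: c => c0 c1 c2 c3 c4 c5 c6 c7 c8 c9.
case: d => d0 d1 d2 d3 d4 d5 d6 d7 d8 d9 E.
pose e x y z := E (vec3 x y z).
have nz2 : (2 : F) != 0 by rewrite pnatr_eq0.
move: (e 1 0 0) (e 0 1 0) (e 0 0 1) (e 1 1 0) (e 1 (-1) 0) (e 1 0 1) (e 1 0 (-1)).
move: (e 0 1 1) (e 0 1 (-1)) (e 1 1 1); rewrite {e E} !ev_vec3 /ev3.
move=> yz yz' xyz x y z xy xy' xz xz'.
have E0 : c0 = d0 by apply: (lin_eq x (oner_neq0 F)); ring.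
have E6 : c6 = d6 by apply: (lin_eq y (oner_neq0 F)); ring.
have E9 : c9 = d9 by apply: (lin_eq z (oner_neq0 F)); ring.
subst d0 d6 d9.
have E3 : c3 = d3 by apply: (lin_eq (congr2 +%R xy xy') nz2); ring.
have E1 : c1 = d1 by apply: (lin_eq (congr2 (fun a b => a - b) xy xy') nz2); ring.
have E5 : c5 = d5 by apply: (lin_eq (congr2 +%R xz xz') nz2); ring.
have E2 : c2 = d2 by apply: (lin_eq (congr2 (fun a b => a - b) xz xz') nz2); ring.
have E8 : c8 = d8 by apply: (lin_eq (congr2 +%R yz yz') nz2); ring.
have E7 : c7 = d7 by apply: (lin_eq (congr2 (fun a b => a - b) yz yz') nz2); ring.
subst; congr Cubic; apply: (lin_eq xyz (oner_neq0 F)); ring.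
Qed.

Lemma ev_csub A c v : ev (csub A c) v = ev c (A *m v).
Proof.
rewrite [v]vec3E [A]mx3E mulmx3_vec3 !ev_vec3.
move: (v 0 0) (v 1 0) (v 2 0) => x y z.
move: (A 0 0) (A 0 1) (A 0 2) (A 1 0) (A 1 1) (A 1 2) (A 2 0) (A 2 1) (A 2 2).
move=> a b d e f g h i j; rewrite /csub !mx3_entry.
case: c => c0 c1 c2 c3 c4 c5 c6 c7 c8 c9 /=.
rewrite /dxx /dxy /dxz /dyy /dyz /dzz /=.
ring.
Qed.

Lemma csubM A B c : csub (A *m B) c = csub B (csub A c).
Proof. by apply: ev_inj => v; rewrite !ev_csub mulmxA. Qed.

Lemma csub1 c : csub 1%:M c = c.
Proof. by apply: ev_inj => v; rewrite ev_csub mul1mx. Qed.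

Lemma ev_cscale k c v : ev (cscale k c) v = k * ev c v.
Proof. by case: c => *; rewrite /ev /ev3 /=; ring. Qed.

Lemma csub_cscale A k c : csub A (cscale k c) = cscale k (csub A c).
Proof. by apply: ev_inj => v; rewrite !(ev_csub, ev_cscale). Qed.

Lemma cscaleM k l c : cscale k (cscale l c) = cscale (k * l) c.
Proof. by apply: ev_inj => v; rewrite !ev_cscale mulrA. Qed.

Lemma cscale1 c : cscale 1 c = c.
Proof. by apply: ev_inj => v; rewrite ev_cscale mul1r. Qed.

Lemma csubK A c : A \in unitmx -> csub (invmx A) (csub A c) = c.
Proof. by move=> Au; rewrite -csubM mulmxV // csub1. Qed.

Lemma csubVK A c : A \in unitmx -> csub A (csub (invmx A) c) = c.
Proof. by move=> Au; rewrite -csubM mulVmx // csub1. Qed.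

Lemma csubV_eq A k c : A \in unitmx -> k != 0 -> csub A c = cscale k c ->
  csub (invmx A) c = cscale k^-1 c.
Proof.
move=> Au k0 e; rewrite -{2}(csubK c Au) e csub_cscale cscaleM mulVf //.
by rewrite cscale1.
Qed.

Lemma mulmx3 a b l d e f g h i a' b' l' d' e' f' g' h' i' :
  mx3 a b l d e f g h i *m mx3 a' b' l' d' e' f' g' h' i' =
  mx3 (a * a' + b * d' + l * g') (a * b' + b * e' + l * h') (a * l' + b * f' + l * i')
      (d * a' + e * d' + f * g') (d * b' + e * e' + f * h') (d * l' + e * f' + f * i')
      (g * a' + h * d' + i * g') (g * b' + h * e' + i * h') (g * l' + h * f' + i * i').
Proof.
apply/matrixP=> r s; rewrite [LHS]mxE sum3.
by elim/forall3: r; elim/forall3: s; rewrite !mx3_entry.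
Qed.

Lemma det_mx3 a b l d e f g h i :
  \det (mx3 a b l d e f g h i) =
  a * (e * i - f * h) - b * (d * i - f * g) + l * (d * h - e * g).
Proof.
rewrite (expand_det_row _ 0) sum3 !mx3_entry /cofactor !(expand_det_row _ 0).
rewrite !big_ord_recl !big_ord0 /cofactor !det_mx11 !mxE /=.
rewrite /bump /= !(expr0, expr1, mulr0, addr0, mul1r, mulN1r) /=.
have -> : (0 + (1 %% 3 + 1 %% 3) %% 3)%N = 2 by [].
ring.
Qed.

End Cubics.

(** * The Aronhold invariants *)

Section Invariants.
Context {F : numFieldType}.
Implicit Types (c : cubic F) (A B : 'M[F]_3) (k s t : F).

(** The Aronhold invariants S and T of degrees four and six, scaled so that their
    values on y^2 z = x^3 + a x z^2 + b z^3 are a and b. *)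
Definition inv4 c : F :=
  let: Cubic a300 a210 a201 a120 a111 a102 a030 a021 a012 a003 := c in
  (144 * a300 * a120 * a021 * a003 - 48 * a300 * a120 * a012 ^+ 2 - 216 *
    a300 * a111 * a030 * a003 + 24 * a300 * a111 * a021 * a012 + 144 * a300
    * a102 * a030 * a012 - 48 * a300 * a102 * a021 ^+ 2 - 48 * a210 ^+ 2 *
    a021 * a003 + 16 * a210 ^+ 2 * a012 ^+ 2 + 144 * a210 * a201 * a030 *
    a003 - 16 * a210 * a201 * a021 * a012 + 24 * a210 * a120 * a111 * a003 -
    16 * a210 * a120 * a102 * a012 - 8 * a210 * a111 ^+ 2 * a012 + 24 * a210
    * a111 * a102 * a021 - 48 * a210 * a102 ^+ 2 * a030 - 48 * a201 ^+ 2 *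
    a030 * a012 + 16 * a201 ^+ 2 * a021 ^+ 2 - 48 * a201 * a120 ^+ 2 * a003
    + 24 * a201 * a120 * a111 * a012 - 16 * a201 * a120 * a102 * a021 - 8 *
    a201 * a111 ^+ 2 * a021 + 24 * a201 * a111 * a102 * a030 + 16 *
    a120 ^+ 2 * a102 ^+ 2 - 8 * a120 * a111 ^+ 2 * a102 + a111 ^+ 4) / - 48.

Definition inv6 c : F :=
  let: Cubic a300 a210 a201 a120 a111 a102 a030 a021 a012 a003 := c in
  (- 5832 * a300 ^+ 2 * a030 ^+ 2 * a003 ^+ 2 + 3888 * a300 ^+ 2 * a030 *
    a021 * a012 * a003 - 864 * a300 ^+ 2 * a030 * a012 ^+ 3 - 864 *
    a300 ^+ 2 * a021 ^+ 3 * a003 + 216 * a300 ^+ 2 * a021 ^+ 2 * a012 ^+ 2 +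
    3888 * a300 * a210 * a120 * a030 * a003 ^+ 2 - 1296 * a300 * a210 * a120
    * a021 * a012 * a003 + 288 * a300 * a210 * a120 * a012 ^+ 3 - 1296 *
    a300 * a210 * a111 * a030 * a012 * a003 + 864 * a300 * a210 * a111 *
    a021 ^+ 2 * a003 - 144 * a300 * a210 * a111 * a021 * a012 ^+ 2 - 1296 *
    a300 * a210 * a102 * a030 * a021 * a003 + 864 * a300 * a210 * a102 *
    a030 * a012 ^+ 2 - 144 * a300 * a210 * a102 * a021 ^+ 2 * a012 - 1296 *
    a300 * a201 * a120 * a030 * a012 * a003 + 864 * a300 * a201 * a120 *
    a021 ^+ 2 * a003 - 144 * a300 * a201 * a120 * a021 * a012 ^+ 2 - 1296 *
    a300 * a201 * a111 * a030 * a021 * a003 + 864 * a300 * a201 * a111 *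
    a030 * a012 ^+ 2 - 144 * a300 * a201 * a111 * a021 ^+ 2 * a012 + 3888 *
    a300 * a201 * a102 * a030 ^+ 2 * a003 - 1296 * a300 * a201 * a102 * a030
    * a021 * a012 + 288 * a300 * a201 * a102 * a021 ^+ 3 - 864 * a300 *
    a120 ^+ 3 * a003 ^+ 2 + 864 * a300 * a120 ^+ 2 * a111 * a012 * a003 +
    864 * a300 * a120 ^+ 2 * a102 * a021 * a003 - 576 * a300 * a120 ^+ 2 *
    a102 * a012 ^+ 2 - 648 * a300 * a120 * a111 ^+ 2 * a021 * a003 - 72 *
    a300 * a120 * a111 ^+ 2 * a012 ^+ 2 - 1296 * a300 * a120 * a111 * a102 *
    a030 * a003 + 720 * a300 * a120 * a111 * a102 * a021 * a012 + 864 * a300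
    * a120 * a102 ^+ 2 * a030 * a012 - 576 * a300 * a120 * a102 ^+ 2 *
    a021 ^+ 2 + 540 * a300 * a111 ^+ 3 * a030 * a003 + 36 * a300 * a111 ^+ 3
    * a021 * a012 - 648 * a300 * a111 ^+ 2 * a102 * a030 * a012 - 72 * a300
    * a111 ^+ 2 * a102 * a021 ^+ 2 + 864 * a300 * a111 * a102 ^+ 2 * a030 *
    a021 - 864 * a300 * a102 ^+ 3 * a030 ^+ 2 - 864 * a210 ^+ 3 * a030 *
    a003 ^+ 2 + 288 * a210 ^+ 3 * a021 * a012 * a003 - 64 * a210 ^+ 3 *
    a012 ^+ 3 + 864 * a210 ^+ 2 * a201 * a030 * a012 * a003 - 576 *
    a210 ^+ 2 * a201 * a021 ^+ 2 * a003 + 96 * a210 ^+ 2 * a201 * a021 *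
    a012 ^+ 2 + 216 * a210 ^+ 2 * a120 ^+ 2 * a003 ^+ 2 - 144 * a210 ^+ 2 *
    a120 * a111 * a012 * a003 - 144 * a210 ^+ 2 * a120 * a102 * a021 * a003
    + 96 * a210 ^+ 2 * a120 * a102 * a012 ^+ 2 - 72 * a210 ^+ 2 * a111 ^+ 2
    * a021 * a003 + 48 * a210 ^+ 2 * a111 ^+ 2 * a012 ^+ 2 + 864 * a210 ^+ 2
    * a111 * a102 * a030 * a003 - 144 * a210 ^+ 2 * a111 * a102 * a021 *
    a012 - 576 * a210 ^+ 2 * a102 ^+ 2 * a030 * a012 + 216 * a210 ^+ 2 *
    a102 ^+ 2 * a021 ^+ 2 + 864 * a210 * a201 ^+ 2 * a030 * a021 * a003 -
    576 * a210 * a201 ^+ 2 * a030 * a012 ^+ 2 + 96 * a210 * a201 ^+ 2 *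
    a021 ^+ 2 * a012 - 144 * a210 * a201 * a120 ^+ 2 * a012 * a003 + 720 *
    a210 * a201 * a120 * a111 * a021 * a003 - 144 * a210 * a201 * a120 *
    a111 * a012 ^+ 2 - 1296 * a210 * a201 * a120 * a102 * a030 * a003 + 48 *
    a210 * a201 * a120 * a102 * a021 * a012 - 648 * a210 * a201 * a111 ^+ 2
    * a030 * a003 + 24 * a210 * a201 * a111 ^+ 2 * a021 * a012 + 720 * a210
    * a201 * a111 * a102 * a030 * a012 - 144 * a210 * a201 * a111 * a102 *
    a021 ^+ 2 - 144 * a210 * a201 * a102 ^+ 2 * a030 * a021 - 144 * a210 *
    a120 ^+ 2 * a111 * a102 * a003 + 96 * a210 * a120 ^+ 2 * a102 ^+ 2 *
    a012 + 36 * a210 * a120 * a111 ^+ 3 * a003 + 24 * a210 * a120 *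
    a111 ^+ 2 * a102 * a012 - 144 * a210 * a120 * a111 * a102 ^+ 2 * a021 +
    288 * a210 * a120 * a102 ^+ 3 * a030 - 12 * a210 * a111 ^+ 4 * a012 + 36
    * a210 * a111 ^+ 3 * a102 * a021 - 72 * a210 * a111 ^+ 2 * a102 ^+ 2 *
    a030 - 864 * a201 ^+ 3 * a030 ^+ 2 * a003 + 288 * a201 ^+ 3 * a030 *
    a021 * a012 - 64 * a201 ^+ 3 * a021 ^+ 3 - 576 * a201 ^+ 2 * a120 ^+ 2 *
    a021 * a003 + 216 * a201 ^+ 2 * a120 ^+ 2 * a012 ^+ 2 + 864 * a201 ^+ 2
    * a120 * a111 * a030 * a003 - 144 * a201 ^+ 2 * a120 * a111 * a021 *
    a012 - 144 * a201 ^+ 2 * a120 * a102 * a030 * a012 + 96 * a201 ^+ 2 *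
    a120 * a102 * a021 ^+ 2 - 72 * a201 ^+ 2 * a111 ^+ 2 * a030 * a012 + 48
    * a201 ^+ 2 * a111 ^+ 2 * a021 ^+ 2 - 144 * a201 ^+ 2 * a111 * a102 *
    a030 * a021 + 216 * a201 ^+ 2 * a102 ^+ 2 * a030 ^+ 2 + 288 * a201 *
    a120 ^+ 3 * a102 * a003 - 72 * a201 * a120 ^+ 2 * a111 ^+ 2 * a003 - 144
    * a201 * a120 ^+ 2 * a111 * a102 * a012 + 96 * a201 * a120 ^+ 2 *
    a102 ^+ 2 * a021 + 36 * a201 * a120 * a111 ^+ 3 * a012 + 24 * a201 *
    a120 * a111 ^+ 2 * a102 * a021 - 144 * a201 * a120 * a111 * a102 ^+ 2 *
    a030 - 12 * a201 * a111 ^+ 4 * a021 + 36 * a201 * a111 ^+ 3 * a102 *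
    a030 - 64 * a120 ^+ 3 * a102 ^+ 3 + 48 * a120 ^+ 2 * a111 ^+ 2 *
    a102 ^+ 2 - 12 * a120 * a111 ^+ 4 * a102 + a111 ^+ 6) / 864.

Lemma csub_shear a300 a210 a201 a120 a111 a102 a030 a021 a012 a003 s :
  csub (mx3 1 s 0 0 1 0 0 0 1)
    (Cubic a300 a210 a201 a120 a111 a102 a030 a021 a012 a003) =
  Cubic a300 (a210 + 3 * s * a300) a201 (a120 + 2 * s * a210 + 3 * s ^+ 2 * a300)
    (a111 + 2 * s * a201) a102 (a030 + s * a120 + s ^+ 2 * a210 + s ^+ 3 * a300)
    (a021 + s * a111 + s ^+ 2 * a201) (a012 + s * a102) a003.
Proof.
rewrite /csub /= !mx3_entry /dxx /dxy /dxz /dyy /dyz /dzz /=.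
congr Cubic; ring.
Qed.

Lemma inv_shear s c : let c' := csub (mx3 1 s 0 0 1 0 0 0 1) c in
  inv4 c' = inv4 c /\ inv6 c' = inv6 c.
Proof.
case: c => c0 c1 c2 c3 c4 c5 c6 c7 c8 c9 c'; rewrite {}/c' csub_shear /=.
split.
  congr (_ / _); ring.
congr (_ / _); ring.
Qed.

Lemma inv_stretch t c : let c' := csub (mx3 t 0 0 0 1 0 0 0 1) c in
  inv4 c' = t ^+ 4 * inv4 c /\ inv6 c' = t ^+ 6 * inv6 c.
Proof.
have -> : csub (mx3 t 0 0 0 1 0 0 0 1) c =
    Cubic (t ^+ 3 * a300 c) (t ^+ 2 * a210 c) (t ^+ 2 * a201 c) (t * a120 c)
      (t * a111 c) (t * a102 c) (a030 c) (a021 c) (a012 c) (a003 c).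
  case: c => *; rewrite /csub /= !mx3_entry /dxx /dxy /dxz /dyy /dyz /dzz /=.
  congr Cubic; ring.
by case: c => * /=; split; rewrite [RHS]mulrA; congr (_ / _); ring.
Qed.

Lemma inv_swapxy c : let c' := csub (mx3 0 1 0 1 0 0 0 0 1) c in
  inv4 c' = inv4 c /\ inv6 c' = inv6 c.
Proof.
have -> : csub (mx3 0 1 0 1 0 0 0 0 1) c =
    Cubic (a030 c) (a120 c) (a021 c) (a210 c) (a111 c) (a012 c) (a300 c)
      (a201 c) (a102 c) (a003 c).
  case: c => *; rewrite /csub /= !mx3_entry /dxx /dxy /dxz /dyy /dyz /dzz /=.
  congr Cubic; ring.
by case: c => * /=; split; congr (_ / _); ring.
Qed.

Lemma inv_swapyz c : let c' := csub (mx3 1 0 0 0 0 1 0 1 0) c in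
  inv4 c' = inv4 c /\ inv6 c' = inv6 c.
Proof.
have -> : csub (mx3 1 0 0 0 0 1 0 1 0) c =
    Cubic (a300 c) (a201 c) (a210 c) (a102 c) (a111 c) (a120 c) (a003 c)
      (a012 c) (a021 c) (a030 c).
  case: c => *; rewrite /csub /= !mx3_entry /dxx /dxy /dxz /dyy /dyz /dzz /=.
  congr Cubic; ring.
by case: c => * /=; split; congr (_ / _); ring.
Qed.

Definition covariant A := forall c,
  inv4 (csub A c) = \det A ^+ 4 * inv4 c /\
  inv6 (csub A c) = \det A ^+ 6 * inv6 c.

Lemma covariantM A B : covariant A -> covariant B -> covariant (A *m B).
Proof.
move=> hA hB c; rewrite csubM !det_mulmx.
by have [-> ->] := hB (csub A c); have [-> ->] := hA c; split; ring.
Qed.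

Lemma covariant_shear s : covariant (mx3 1 s 0 0 1 0 0 0 1).
Proof.
move=> c; have [-> ->] := inv_shear s c; rewrite det_mx3.
by split; ring.
Qed.

Lemma covariant_stretch t : covariant (mx3 t 0 0 0 1 0 0 0 1).
Proof.
move=> c; have [-> ->] := inv_stretch t c; rewrite det_mx3.
by split; ring.
Qed.

Lemma covariant_swapxy : covariant (mx3 0 1 0 1 0 0 0 0 1).
Proof.
move=> c; have [-> ->] := inv_swapxy c; rewrite det_mx3.
by split; ring.
Qed.

Lemma covariant_swapyz : covariant (mx3 1 0 0 0 0 1 0 1 0).
Proof.
move=> c; have [-> ->] := inv_swapyz c; rewrite det_mx3.
by split; ring.
Qed.

(** Conjugation by transpositions carries the shear and the stretching to all other
    positions. *)
Lemma covariant_upper a b l e f i : covariant (mx3 a b l 0 e f 0 0 i).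
Proof.
pose X : 'M[F]_3 := mx3 0 1 0 1 0 0 0 0 1; pose Y : 'M[F]_3 := mx3 1 0 0 0 0 1 0 1 0.
have cX : covariant X := covariant_swapxy.
have cY : covariant Y := covariant_swapyz.
have conj A B C : A *m B *m A = C -> covariant A -> covariant B -> covariant C.
  by move=> <- hA hB; exact: covariantM (covariantM hA hB) hA.
have cXZ s : covariant (mx3 1 0 s 0 1 0 0 0 1).
  apply: (conj Y _ _ _ cY (covariant_shear s)).
  by rewrite !mulmx3; congr mx3; ring.
have cYZ s : covariant (mx3 1 0 0 0 1 s 0 0 1).
  by apply: (conj X _ _ _ cX (cXZ s)); rewrite !mulmx3; congr mx3; ring.
have cYY s : covariant (mx3 1 0 0 0 s 0 0 0 1).
  apply: (conj X _ _ _ cX (covariant_stretch s)).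
  by rewrite !mulmx3; congr mx3; ring.
have cZZ s : covariant (mx3 1 0 0 0 1 0 0 0 s).
  by apply: (conj Y _ _ _ cY (cYY s)); rewrite !mulmx3; congr mx3; ring.
have -> : mx3 a b l 0 e f 0 0 i =
    mx3 1 0 0 0 1 0 0 0 i *m (mx3 1 0 0 0 1 f 0 0 1 *m (mx3 1 0 l 0 1 0 0 0 1 *m
    (mx3 1 0 0 0 e 0 0 0 1 *m
    (mx3 1 b 0 0 1 0 0 0 1 *m mx3 a 0 0 0 1 0 0 0 1)))).
  by rewrite !mulmx3; congr mx3; ring.
apply: covariantM (cZZ _) _; apply: covariantM (cYZ _) _.
apply: covariantM (cXZ _) _; apply: covariantM (cYY _) _.
exact: covariantM (covariant_shear _) (covariant_stretch _).
Qed.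

Lemma covariant1 : covariant 1%:M.
Proof. by move=> c; rewrite csub1 det1 !expr1n !mul1r. Qed.

Lemma covariantV A B : A *m B = 1%:M -> covariant A -> covariant B.
Proof.
move=> AB hA c; have BA := mulmx1C AB.
have [] := hA (csub B c); rewrite -csubM BA csub1 => -> ->.
have dBA : \det B * \det A = 1 by rewrite -det_mulmx BA det1.
have cancel n x : \det B ^+ n * (\det A ^+ n * x) = x.
  by rewrite mulrA -exprMn dBA expr1n mul1r.
by rewrite !cancel.
Qed.

Lemma covariant_swap (i j : 'I_3) : covariant (tperm_mx i j).
Proof.
pose X : 'M[F]_3 := mx3 0 1 0 1 0 0 0 0 1; pose Y : 'M[F]_3 := mx3 1 0 0 0 0 1 0 1 0.
have cX : covariant X := covariant_swapxy.
have cY : covariant Y := covariant_swapyz.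
have cZ : covariant (X *m Y *m X) := covariantM (covariantM cX cY) cX.
have E01 : tperm_mx 0 1 = X :> 'M[F]_3.
  by rewrite [LHS]mx3E !mxE /= !permE /=.
have E12 : tperm_mx 1 2 = Y :> 'M[F]_3.
  by rewrite [LHS]mx3E !mxE /= !permE /=.
have E02 : tperm_mx 0 2 = X *m Y *m X :> 'M[F]_3.
  rewrite [LHS]mx3E !mxE /= !permE /= /X /Y !mulmx3; congr mx3; ring.
elim/forall3: i; elim/forall3: j; rewrite /tperm_mx ?tperm1 ?perm_mx1;
  try exact: covariant1; rewrite ?(tpermC 1 0) ?(tpermC 2 _).
all: by rewrite -/(tperm_mx _ _) ?(E01, E12, E02).
Qed.

(** By the LUP decomposition, elementary matrices generate the general linear group;
    the transformation law has been checked on them by expansion. *)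
Lemma covariant_unit A : A \in unitmx -> covariant A.
Proof.
move=> Au; have [P [L [U [PALU Uup Llo /is_perm_mxP[s Ps]]]]] : exists P L U,
    [/\ P *m A = L *m U, forall i j : 'I_3, (j < i)%N -> U i j = 0,
        forall i j : 'I_3, (i <= j)%N -> L i j = (i == j)%:R & is_perm_mx P].
  exists (@cormen_lup F 2 A).1.1, (@cormen_lup F 2 A).1.2, (@cormen_lup F 2 A).2.
  split; [|exact: cormen_lup_upper|exact: cormen_lup_lower|exact: cormen_lup_perm].
  by move: (@cormen_lup_correct F 2 A); case: (@cormen_lup F 2 A) => [[]].
have cU : covariant U.
  rewrite [U]mx3E (Uup 1 0) // (Uup 2 0) // (Uup 2 1) //; exact: covariant_upper.
have cL : covariant L.
  pose J : 'M[F]_3 := mx3 0 0 1 0 1 0 1 0 0; pose L' := mx3 1 (L 2 1) (L 2 0) 0 1 (L 1 0) 0 0 1.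
  have cJ : covariant J.
    have -> : J = mx3 1 0 0 0 0 1 0 1 0 *m mx3 0 1 0 1 0 0 0 0 1 *m mx3 1 0 0 0 0 1 0 1 0.
      by rewrite !mulmx3; congr mx3; ring.
    have cY := covariant_swapyz.
    exact: covariantM (covariantM cY covariant_swapxy) cY.
  have -> : L = J *m L' *m J.
    rewrite [LHS]mx3E (Llo 0 0) // (Llo 0 1) // (Llo 0 2) // (Llo 1 1) // (Llo 1 2) //.
    by rewrite (Llo 2 2) // !mulmx3 /=; congr mx3; ring.
  exact: covariantM (covariantM cJ (covariant_upper _ _ _ _ _ _)) cJ.
have cP : covariant P.
  have [ts sE _] := prod_tpermP s; rewrite Ps {}sE.
  elim: ts => [|[i j] ts IH]; first by rewrite big_nil perm_mx1; exact: covariant1.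
  by rewrite big_cons perm_mxM; apply: covariantM (covariant_swap i j) IH.
have Pu : P \in unitmx by rewrite Ps unitmx_perm.
have -> : A = invmx P *m (L *m U).
  by rewrite -PALU mulmxA mulVmx // mul1mx.
apply: covariantM; last exact: covariantM.
exact: covariantV (mulmxV Pu) cP.
Qed.

End Invariants.

(** * Flexes and the Weierstrass form *)

Section Flexes.
Context {F : numFieldType}.
Implicit Types (c : cubic F) (A B : 'M[F]_3) (u v w : 'cV[F]_3) (k s : F).

Lemma inv_cscale k c :
  inv4 (cscale k c) = k ^+ 4 * inv4 c /\ inv6 (cscale k c) = k ^+ 6 * inv6 c.
Proof.
by case: c => * /=; split; rewrite [RHS]mulrA; congr (_ / _); ring.
Qed.

Lemma ev_eq0 c : (forall v, ev c v = 0) -> c = Cubic 0 0 0 0 0 0 0 0 0 0.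
Proof.
by move=> c0; apply: ev_inj => v; rewrite c0 [v]vec3E ev_vec3 /= !mul0r !addr0.
Qed.

(** The cubic y^2 z - x^3 - a x z^2 - b z^3. *)
Definition wcubic (a b : F) := Cubic (-1) 0 0 0 0 (- a) 0 1 0 (- b).

Lemma inv4_wcubic a b : inv4 (wcubic a b) = a.
Proof. by rewrite /inv4 /=; field. Qed.

Lemma inv6_wcubic a b : inv6 (wcubic a b) = b.
Proof. by rewrite /inv6 /=; field. Qed.

Definition hess c v : 'M[F]_3 :=
  let D p := p c (v 0 0) (v 1 0) (v 2 0) in
  mx3 (D dxx) (D dxy) (D dxz) (D dxy) (D dyy) (D dyz) (D dxz) (D dyz) (D dzz).

Lemma trmx3 (a b l d e f g h i : F) :
  (mx3 a b l d e f g h i)^T = mx3 a d g b e h l f i.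
Proof. by rewrite [LHS]mx3E !mxE; congr mx3; rewrite mx3_entry. Qed.

Lemma hess_csub A c v : hess (csub A c) v = A^T *m hess c (A *m v) *m A.
Proof.
rewrite [v]vec3E [A]mx3E mulmx3_vec3 trmx3 /hess !vec3_entry !mulmx3.
move: (v 0 0) (v 1 0) (v 2 0) => x y z.
move: (A 0 0) (A 0 1) (A 0 2) (A 1 0) (A 1 1) (A 1 2) (A 2 0) (A 2 1) (A 2 2).
move=> a b d e f g h i j; rewrite /csub !mx3_entry.
case: c => c0 c1 c2 c3 c4 c5 c6 c7 c8 c9 /=.
rewrite /dxx /dxy /dxz /dyy /dyz /dzz /=.
congr mx3; ring.
Qed.

(** A smooth flex: by Euler's formula v^T H v is 6 c (v) and H v is twice the
    gradient of c at v, so v is a nonsingular zero of c at which the Hessian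
    determinant vanishes. *)
Definition sflex c v :=
  [/\ v^T *m hess c v *m v = 0, \det (hess c v) = 0 & hess c v *m v != 0].

Lemma sflex_csub A c v : A \in unitmx -> sflex (csub A c) v <-> sflex c (A *m v).
Proof.
move=> Au; rewrite /sflex hess_csub trmx_mul !det_mulmx det_tr !mulmxA.
have dA0 : \det A != 0 by rewrite -unitfE -unitmxE.
split=> -[-> hd hn]; split=> //.
- by move/eqP: hd; rewrite !mulf_eq0 (negbTE dA0) orbF /= => /eqP.
- apply: contraNneq hn => hv.
  by rewrite -!mulmxA (mulmxA _ A v) hv mulmx0.
- by rewrite hd mulr0 mul0r.
- apply: contraNneq hn; rewrite -!mulmxA => /(congr1 (mulmx (invmx A^T))).
  by rewrite mulKmx ?unitmx_tr // mulmx0 mulmxA => ->.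
Qed.

Definition linfactor c (n : 'rV[F]_3) (Q : 'M[F]_3) :=
  forall v, ev c v = (n *m v) 0 0 * (v^T *m Q *m v) 0 0.

Definition has_line c := exists n Q, [/\ n != 0, Q^T = Q & linfactor c n Q].

Lemma has_line_csub A c : A \in unitmx -> has_line (csub A c) -> has_line c.
Proof.
move=> Au [n [Q [n0 Qs nQ]]].
exists (n *m invmx A), ((invmx A)^T *m Q *m invmx A); split.
- apply: contraNneq n0 => /(congr1 (mulmx^~ A)).
  by rewrite mulmxKV // mul0mx => ->.
- by rewrite !trmx_mul trmxK Qs mulmxA.
- move=> v; have := nQ (invmx A *m v).
  by rewrite ev_csub mulKVmx // trmx_mul !mulmxA.
Qed.

Definition ey : 'cV[F]_3 := vec3 0 1 0.

Lemma ey_neq0 : ey != 0.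
Proof.
apply/eqP=> /colP/(_ 1); rewrite /ey vec3_entry mxE => /eqP.
by rewrite oner_eq0.
Qed.

Lemma unit_col v : v != 0 -> exists2 A, A \in unitmx & A *m ey = v.
Proof.
move=> v0; have rk1 (w : 'cV[F]_3) : w != 0 -> \rank w^T = 1%N.
  by move=> w0; rewrite rank_rV trmx_eq0 w0.
pose f : 'M[F]_3 := \matrix_(i, j) (v j 0 *+ (i == 1)).
have fE : ey^T *m f = v^T.
  apply/rowP=> j; rewrite !mxE sum3 !mxE /=.
  by rewrite !mulr0n !mulr1n mul1r !mul0r addr0 add0r.
have [|g gu gE] := @complete_unitmx _ 1 3 ey^T f.
  by rewrite fE !rk1 ?ey_neq0.
exists g^T; first by rewrite unitmx_tr.
by apply: trmx_inj; rewrite trmx_mul trmxK -gE fE.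
Qed.

Lemma mx3_unit (a b l d e f g h i : F) :
  (mx3 a b l d e f g h i \in unitmx) =
  (a * (e * i - f * h) - b * (d * i - f * g) + l * (d * h - e * g) != 0).
Proof. by rewrite unitmxE unitfE det_mx3. Qed.

Lemma dot3 (a b l x y z : F) :
  ((vec3 a b l)^T *m vec3 x y z) 0 0 = a * x + b * y + l * z.
Proof. by rewrite mxE sum3 ![_^T _ _]mxE !vec3_entry. Qed.

Lemma has_line_z a b l d e f :
  has_line (Cubic 0 0 a 0 b l 0 d e f).
Proof.
pose q := mx3 a (b / 2) (l / 2) (b / 2) d (e / 2) (l / 2) (e / 2) f.
exists (vec3 0 0 1)^T, q; split.
- rewrite trmx_eq0; apply/eqP=> /colP/(_ 2).
  by rewrite vec3_entry mxE => /eqP; rewrite oner_eq0.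
- by rewrite /q trmx3.
move=> v; rewrite [v]vec3E; move: (v 0 0) (v 1 0) (v 2 0) => x y z.
rewrite dot3 ev_vec3 -mulmxA mulmx3_vec3 dot3 /=.
by field.
Qed.

(** Coordinates in which the flex is (0 : 1 : 0) and its tangent is z = 0. The
    coefficient e of y^2 z is nonzero because the flex is a smooth point. *)
Lemma flex_form c v : sflex c v -> exists A a b l d e f g,
  [/\ A \in unitmx, e != 0 & csub A c = Cubic a 0 b 0 l d 0 e f g].
Proof.
move=> cv; have v0 : v != 0.
  by case: cv => _ _; apply: contra_neq => ->; rewrite mulmx0.
have [A Au AE] := unit_col v0; move: cv; rewrite -AE -sflex_csub //.
suff main d : sflex d ey -> exists A a b l d' e f g,
  [/\ A \in unitmx, e != 0 & csub A d = Cubic a 0 b 0 l d' 0 e f g].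
  case/main=> B [a [b [l [d' [e [f [g [Bu e0 BE]]]]]]]].
  exists (A *m B), a, b, l, d', e, f, g; split=> //; first by rewrite unitmx_mul Au.
  by rewrite csubM.
move=> {A Au AE v0 v c}.
have [two six] : (2 : F) != 0 /\ (6 : F) != 0 by rewrite !pnatr_eq0.
have flexE c : sflex c ey -> [/\ a030 c = 0,
    (a120 c != 0) || (a021 c != 0) &
    \det (mx3 (2 * a210 c) (2 * a120 c) (a111 c) (2 * a120 c) 0 (2 * a021 c)
              (a111 c) (2 * a021 c) (2 * a012 c)) = 0].
  rewrite /sflex; have -> : hess c ey = mx3 (2 * a210 c) (2 * a120 c) (a111 c) (2 * a120 c)
      (6 * a030 c) (2 * a021 c) (a111 c) (2 * a021 c) (2 * a012 c).
    rewrite /hess !vec3_entry /dxx /dxy /dxz /dyy /dyz /dzz.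
    by congr mx3; ring.
  rewrite /ey -mulmxA !mulmx3_vec3 => -[/matrixP/(_ 0 0)].
  rewrite dot3 mxE !(mul0r, mulr0, addr0, add0r, mulr1, mul1r) => /eqP.
  rewrite mulf_eq0 (negbTE six) /= => /eqP ->.
  rewrite mulr0 => hd hn; split=> //.
  apply: contraNT hn; rewrite negb_or !negbK => /andP[/eqP-> /eqP->].
  by rewrite !mulr0; apply/eqP/colP; elim/forall3; rewrite vec3_entry mxE.
(* Once the tangent line is z = 0, the Hessian condition reads a210 = 0. *)
have aligned c : sflex c ey -> a120 c = 0 -> exists a b l d' e f g,
    e != 0 /\ c = Cubic a 0 b 0 l d' 0 e f g.
  case: c => a p b q l d' r e f g /flexE /= [-> + hd q0].
  rewrite q0 eqxx /= => e0; exists a, b, l, d', e, f, g; split=> //.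
  rewrite q0 det_mx3 in hd.
  have pe : p * e ^+ 2 = 0.
    have eight : (8 : F) != 0 by rewrite pnatr_eq0.
    by apply: (lin_eq (esym hd) eight); ring.
  by move/eqP: pe; rewrite mulf_eq0 expf_eq0 (negbTE e0) orbF => /eqP->.
case: (eqVneq (a120 d) 0) => [q0 /aligned/(_ q0)[a [b [l [d' [e [f [g [e0 dE]]]]]]]]|q0 dflex].
  by exists 1%:M, a, b, l, d', e, f, g; rewrite unitmx1 csub1.
pose A := mx3 (- a021 d / a120 d) 0 1 0 1 0 1 0 0.
have Au : A \in unitmx.
  rewrite mx3_unit (_ : _ - _ + _ = - 1%R); last by ring.
  by rewrite oppr_eq0 oner_neq0.
have Aey : A *m ey = ey.
  by rewrite /A /ey mulmx3_vec3; congr vec3; ring.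
have [||a [b [l [d' [e [f [g [e0 dE]]]]]]]] := aligned (csub A d).
- by rewrite sflex_csub // Aey.
- by move: q0; rewrite /A /csub !mx3_entry; case: (d) => * /=; field.
by exists A, a, b, l, d', e, f, g.
Qed.

(** Complete the square in y and then the cube in x. The coefficient of x^3 is
    nonzero, since otherwise z would divide the cubic. *)
Lemma weierstrass_form c v : sflex c v -> ~ has_line c ->
  exists A k a b, [/\ A \in unitmx, k != 0 & csub A c = cscale k (wcubic a b)].
Proof.
case/flex_form=> A [a [b [l [d [e [f [g [Au e0 AE]]]]]]]] noline.
have a0 : a != 0.
  apply/eqP=> a0; apply/noline/(has_line_csub Au).
  by rewrite AE a0; exact: has_line_z.
have [two three] : (2 : F) != 0 /\ (3 : F) != 0 by rewrite !pnatr_eq0.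
pose r := - l / (2 * e); pose s := - f / (2 * e).
pose b' := b + e * r ^+ 2 + l * r.
pose d' := d + 2 * e * r * s + l * s + f * r.
pose g' := g + e * s ^+ 2 + f * s.
pose t := - b' / (3 * a).
pose d'' := d' + 2 * b' * t + 3 * a * t ^+ 2.
pose g'' := g' + d' * t + b' * t ^+ 2 + a * t ^+ 3.
pose A1 := mx3 1 0 0 r 1 s 0 0 1; pose A2 := mx3 1 0 t 0 1 0 0 0 1.
pose A3 := mx3 (-1) 0 0 0 1 0 0 0 (a / e).
exists (A *m A1 *m A2 *m A3), a, (d'' * (a / e) ^+ 2 / a), (- g'' * (a / e) ^+ 3 / a).
split=> //.
  rewrite !unitmx_mul Au !mx3_unit !(mul0r, mulr0, subr0, addr0, mulr1, mul1r).
  by rewrite oner_neq0 /= mulN1r oppr_eq0 mulf_neq0 ?invr_eq0.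
rewrite !csubM AE.
have -> : csub A1 (Cubic a 0 b 0 l d 0 e f g) = Cubic a 0 b' 0 0 d' 0 e 0 g'.
  rewrite /csub /= !mx3_entry /dxx /dxy /dxz /dyy /dyz /dzz /= /g' /d' /b' /s /r.
  by congr Cubic; field; rewrite ?e0 ?a0.
have -> : csub A2 (Cubic a 0 b' 0 0 d' 0 e 0 g') = Cubic a 0 0 0 0 d'' 0 e 0 g''.
  rewrite /csub /= !mx3_entry /dxx /dxy /dxz /dyy /dyz /dzz /= /g'' /d'' /t.
  by congr Cubic; field; rewrite ?e0 ?a0.
rewrite /csub /cscale /= !mx3_entry /dxx /dxy /dxz /dyy /dyz /dzz /=.
by congr Cubic; field; rewrite ?e0 ?a0.
Qed.

End Flexes.

(** * The flexes and the stabilizer of a Weierstrass cubic *)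

(** The points that move come in pairs. *)
Lemma odd_involution (T : eqType) (f : T -> T) (s : seq T) : uniq s ->
  {in s, forall x, f x \in s /\ f (f x) = x} ->
  odd (size s) = odd (count (fun x => f x == x) s).
Proof.
have [n] := ubnP (size s); elim: n s => // n IH [|x s] //= /ltnSE sn /andP[xs us] fs.
have [fx|fx] := eqVneq (f x) x.
  rewrite /= -(IH s) // => y ys; have [] := fs y; first by rewrite inE ys orbT.
  rewrite inE => /predU1P[fy ffy|//]; have yx : y = x by rewrite -ffy fy fx.
  by move: xs; rewrite -yx ys.
have fxs : f x \in s by have [] := fs x (mem_head _ _); rewrite inE (negbTE fx).
have ffx : f (f x) = x by have [] := fs x (mem_head _ _).
rewrite /= (perm_size (perm_to_rem fxs)) (seq.permP (perm_to_rem fxs)) /=.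
rewrite ffx eq_sym (negbTE fx) /= negbK add0n.
apply: IH => [||y].
- by rewrite size_rem //; case: (s) sn => //= _ ? /ltnW.
- exact: rem_uniq.
rewrite mem_rem_uniq // inE => /andP[/= yfx ys].
have [] := fs y; first by rewrite inE ys orbT.
rewrite inE => /predU1P[fy ffy|fys ffy].
  by move: yfx; rewrite -fy ffy eqxx.
split=> //; rewrite mem_rem_uniq // inE fys andbT /=.
apply/eqP => e; move: xs; rewrite -ffx -e ffy.
by rewrite ys.
Qed.

Section Weierstrass.
Context {F : numFieldType}.
Implicit Types (c : cubic F) (A B g h : 'M[F]_3) (u v w : 'cV[F]_3) (k s : F).
Implicit Types (a b x y z : F).

Lemma roots_seq (p : {poly F}) : p != 0 -> exists s : seq F, forall x, root p x -> x \in s.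
Proof.
have [n] := ubnP (size p); elim: n p => // n IH p /ltnSE pn p0.
have [[x /factor_theorem[q pq]]|nr] := pselect (exists x, root p x); last first.
  by exists [::] => x px; case: nr; exists x.
have q0 : q != 0 by apply: contraNneq p0 => q0; rewrite pq q0 mul0r.
have [|s sP] := IH q _ q0.
  by rewrite (leq_trans _ pn) // pq size_Mmonic ?monicXsubC // size_XsubC addn2.
exists (x :: s) => y; rewrite pq rootM root_XsubC inE orbC => /orP[->//|/sP->].
by rewrite orbT.
Qed.

Lemma scale_mx3 k (a b l d e f g h i : F) :
  k *: mx3 a b l d e f g h i =
  mx3 (k * a) (k * b) (k * l) (k * d) (k * e) (k * f) (k * g) (k * h) (k * i).
Proof.
apply/matrixP=> r t; rewrite mxE.
by elim/forall3: r; elim/forall3: t; rewrite !mx3_entry.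
Qed.

Lemma hess_cscale k c v : hess (cscale k c) v = k *: hess c v.
Proof.
rewrite /hess scale_mx3.
by case: c => * /=; rewrite /dxx /dxy /dxz /dyy /dyz /dzz /=; congr mx3; ring.
Qed.

Lemma hess_scale k c v : hess c (k *: v) = k *: hess c v.
Proof.
rewrite /hess scale_mx3 !mxE.
by case: c => * /=; rewrite /dxx /dxy /dxz /dyy /dyz /dzz /=; congr mx3; ring.
Qed.

Lemma sflex_cscale k c v : k != 0 -> sflex (cscale k c) v <-> sflex c v.
Proof.
move=> k0; rewrite /sflex hess_cscale detZ -scalemxAl -scalemxAr -scalemxAl.
rewrite scaler_eq0 (negbTE k0) /=.
split=> -[e d n]; split=> //.
- by move/eqP: e; rewrite scaler_eq0 (negbTE k0) => /eqP.
- by move/eqP: d; rewrite mulf_eq0 expf_eq0 (negbTE k0) => /eqP.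
- by rewrite e scaler0.
- by rewrite d mulr0.
Qed.

Lemma sflex_scale k c v : k != 0 -> sflex c (k *: v) <-> sflex c v.
Proof.
move=> k0.
have trZ : (k *: v)^T = k *: v^T by apply/matrixP=> i j; rewrite !mxE.
rewrite /sflex hess_scale detZ trZ -!scalemxAl -!scalemxAr.
rewrite -!scalemxAl !scaler_eq0 (negbTE k0) /=.
split=> -[e d n]; split=> //.
- by move/eqP: e; rewrite !scaler_eq0 (negbTE k0) => /eqP.
- by move/eqP: d; rewrite mulf_eq0 expf_eq0 (negbTE k0) => /eqP.
- by rewrite e !scaler0.
- by rewrite d mulr0.
Qed.

(** Representatives of the affine points, and of the only point at infinity of a
    Weierstrass cubic. *)
Definition wpt (o : option (F * F)) : 'cV[F]_3 :=
  if o is Some (x, y) then vec3 x y 1 else ey.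

Lemma scale_vec3 k x y z : k *: vec3 x y z = vec3 (k * x) (k * y) (k * z).
Proof. by apply/colP; elim/forall3; rewrite mxE !vec3_entry. Qed.

Lemma vec3_inj x y z x' y' z' :
  vec3 x y z = vec3 x' y' z' -> [/\ x = x', y = y' & z = z'].
Proof. by move=> /colP e; have := (e 0, e 1, e 2); rewrite !vec3_entry => -[[]]. Qed.

Lemma wpt_inj k l o o' : k != 0 -> l != 0 -> k *: wpt o = l *: wpt o' -> o = o'.
Proof.
move=> k0 l0; case: o o' => [[x y]|] [[x' y']|] //=; rewrite !scale_vec3 => /vec3_inj[].
- by rewrite !mulr1 => + + kl; rewrite kl => /(mulfI l0) -> /(mulfI l0) ->.
- by move=> _ _ /eqP; rewrite mulr1 mulr0 (negbTE k0).
- by move=> _ _ /esym/eqP; rewrite mulr1 mulr0 (negbTE l0).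
Qed.

Lemma hess_wcubic a b x y z : hess (wcubic a b) (vec3 x y z) =
  mx3 (- (6 * x)) 0 (- (2 * a * z)) 0 (2 * z) (2 * y)
      (- (2 * a * z)) (2 * y) (- (2 * a * x + 6 * b * z)).
Proof.
rewrite /hess !vec3_entry /dxx /dxy /dxz /dyy /dyz /dzz /=.
by congr mx3; ring.
Qed.

Lemma sflex_wcubicE a b x y z : sflex (wcubic a b) (vec3 x y z) <->
  [/\ y ^+ 2 * z = x ^+ 3 + a * x * z ^+ 2 + b * z ^+ 3,
      3 * a * x ^+ 2 * z + 9 * b * x * z ^+ 2 + 3 * x * y ^+ 2 - a ^+ 2 * z ^+ 3 = 0
    & ~ [/\ 3 * x ^+ 2 + a * z ^+ 2 = 0, y * z = 0 &
         y ^+ 2 = 2 * a * x * z + 3 * b * z ^+ 2]].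
Proof.
rewrite /sflex hess_wcubic det_mx3 -mulmxA mulmx3_vec3.
have e1 (m : 'M[F]_1) : m = 0 <-> m 0 0 = 0.
  split=> [->|m0]; first by rewrite mxE.
  by apply/matrixP=> i j; rewrite !ord1 m0 mxE.
have one := oner_neq0 F; have nz n : n.+1%:R != 0 :> F by rewrite pnatr_eq0.
split.
  case=> /e1; rewrite dot3 => e d n; split.
  - by apply: (lin_eq e (nz 5)); ring.
  - by apply: (lin_eq d (nz 7)); ring.
  case=> h1 h2 h3; case/eqP: n; apply/colP; elim/forall3; rewrite vec3_entry mxE.
  - by apply: (lin_eq (congr1 ( *%R (-2)) h1) one); ring.
  - by apply: (lin_eq (congr1 ( *%R 4) h2) one); ring.
  - by apply: (lin_eq (congr1 ( *%R 2) h3) one); ring.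
case=> e d n; split.
- by apply/e1; rewrite dot3; apply: (lin_eq (congr1 ( *%R 6) e) one); ring.
- by apply: (lin_eq (congr1 ( *%R 8) d) one); ring.
apply/eqP=> /colP h; apply: n; have := (h 0, h 1, h 2).
rewrite !vec3_entry !mxE => -[[h0 h1] h2]; split.
- by apply: (lin_eq (esym h0) (nz 1)); ring.
- by apply: (lin_eq h1 (nz 3)); ring.
- by apply: (lin_eq h2 (nz 1)); ring.
Qed.

Lemma sflex_wcubic_ey a b : sflex (wcubic a b) ey.
Proof.
apply/sflex_wcubicE; split; try by ring.
by case=> _ _ /eqP; rewrite !(mulr0, expr0n, addr0) expr1n oner_eq0.
Qed.

(** The Hessian condition becomes the vanishing of the 3-division polynomial. At a
    point with y = 0 the latter equals - (3 x^2 + a)^2, so that a flex with y = 0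
    would be singular. *)
Lemma sflex_wcubic_affine a b x y : sflex (wcubic a b) (vec3 x y 1) <->
  [/\ y ^+ 2 = x ^+ 3 + a * x + b,
      3 * x ^+ 4 + 6 * a * x ^+ 2 + 12 * b * x - a ^+ 2 = 0 & y != 0].
Proof.
have one := oner_neq0 F.
rewrite sflex_wcubicE !(expr1n, mulr1); split=> -[e d n]; split=> //.
- by rewrite -d e; ring.
- apply/eqP=> y0; apply: n; rewrite y0 in e d *.
  have h1 : 3 * x ^+ 2 + a = 0.
    suff /eqP : (3 * x ^+ 2 + a) ^+ 2 = 0 by rewrite expf_eq0 => /eqP.
    by apply: (lin_eq (congr2 (fun s t => 9 * x * s - t) (esym e) d) one); ring.
  by split=> //; apply: (lin_eq (congr2 (fun s t => 3 * s + x * t) e h1) one); ring.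
- by rewrite -d e; ring.
- by case=> _ /eqP y0; rewrite y0 in n.
Qed.

Lemma sflex_wcubic_wpt a b v : sflex (wcubic a b) v ->
  exists k o, [/\ k != 0, v = k *: wpt o & sflex (wcubic a b) (wpt o)].
Proof.
rewrite [v]vec3E; move: (v 0 0) (v 1 0) (v 2 0) => x y z.
have [->|z0] := eqVneq z 0; last first.
  move=> h; have e : vec3 x y z = z *: wpt (Some (x / z, y / z)).
    by rewrite scale_vec3 mulr1 ![z * _]mulrC !divfK.
  exists z, (Some (x / z, y / z)); split=> //.
  by rewrite e sflex_scale // in h.
case/sflex_wcubicE; rewrite !expr0n !mulr0 !addr0 => /esym/eqP.
rewrite expf_eq0 /= => /eqP -> _ n; exists y, None; split=> //=.
- by apply/eqP=> y0; apply: n; rewrite y0; split; ring.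
- by rewrite scale_vec3 mulr0 mulr1.
- exact: sflex_wcubic_ey.
Qed.

(** The abscissae of the affine flexes are roots of the 3-division polynomial, and
    y |-> - y pairs all the flexes except for the one at infinity. *)
Lemma wcubic_flexes a b : exists L : seq (option (F * F)),
  [/\ uniq L, odd (size L) & forall o, (o \in L) = `[<sflex (wcubic a b) (wpt o)>]].
Proof.
pose p : {poly F} := 3 *: 'X^4 + 6 * a *: 'X^2 + 12 * b *: 'X - (a ^+ 2)%:P.
have [|s sP] := @roots_seq p.
  apply/eqP=> /(congr1 (coefp 4)); rewrite /coefp /= /p.
  rewrite !(coefD, coefN, coefZ, coefC, coefX, coefXn) /= !mulr0 mulr1 !addr0 subr0.
  by move/eqP; rewrite pnatr_eq0.
have sqrts (m : F) : {t : seq F | forall y, y ^+ 2 = m -> y \in t}.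
  apply: cid; have [|t tP] := @roots_seq ('X^2 - m%:P).
    by rewrite -size_poly_gt0 size_XnsubC.
  by exists t => y ym; apply: tP; rewrite /root !hornerE ym subrr.
pose L0 := None :: [seq Some (x, y) | x <- s, y <- sval (sqrts (x ^+ 3 + a * x + b))].
pose L := undup [seq o <- L0 | `[<sflex (wcubic a b) (wpt o)>]].
have LP o : (o \in L) = `[<sflex (wcubic a b) (wpt o)>].
  rewrite mem_undup mem_filter andb_idr // => /asboolP.
  case: o => [[x y]|_]; last by rewrite mem_head.
  move=> /sflex_wcubic_affine[e d _]; rewrite inE; apply/orP; right.
  apply/allpairsPdep; exists x, y; split=> //.
  - apply: sP; rewrite /root /p !(hornerD, hornerN, hornerZ, hornerXn, hornerX, hornerC).
    by rewrite -d.
  - exact: (svalP (sqrts _)).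
exists L; split; [exact: undup_uniq| |exact: LP].
pose neg (o : option (F * F)) := if o is Some (x, y) then Some (x, - y) else None.
rewrite (odd_involution (f := neg)) ?undup_uniq //.
  rewrite (eq_in_count (a2 := pred1 None)) ?count_uniq_mem ?undup_uniq //.
    by rewrite LP; have -> : `[<sflex (wcubic a b) (wpt None)>] by apply/asboolP/sflex_wcubic_ey.
  case=> [[x y]|//]; rewrite LP => /asboolP/sflex_wcubic_affine[_ _ y0] /=.
  apply/eqP=> -[/eqP]; rewrite eq_sym -addr_eq0 -mulr2n -mulr_natl mulf_eq0 (negbTE y0) orbF.
  by rewrite pnatr_eq0.
case=> [[x y]|] /=; last by split=> //; rewrite LP; apply/asboolP/sflex_wcubic_ey.
rewrite !LP opprK => /asboolP/sflex_wcubic_affine[e d y0]; split=> //.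
by apply/asboolP/sflex_wcubic_affine; rewrite sqrrN oppr_eq0.
Qed.

(** Compare coefficients: those of x y^2, x y z, y z^2 and x^2 z force the matrix to
    be diagonal, the others relate its three entries. *)
Lemma wcubic_fix_ey a b h k l : h \in unitmx -> k != 0 -> h *m ey = l *: ey ->
  csub h (wcubic a b) = cscale k (wcubic a b) ->
  exists m t, [/\ m != 0, t != 0, t ^+ 4 * a = a, t ^+ 6 * b = b &
    h = m *: mx3 (t ^+ 2) 0 0 0 (t ^+ 3) 0 0 0 1].
Proof.
move=> hu k0 hey; rewrite [h]mx3E in hu hey *.
move: hu hey; move: (h 0 0) (h 0 1) (h 0 2) (h 1 0) (h 1 1) (h 1 2) (h 2 0) (h 2 1) (h 2 2).
move=> p p' q r s u v v' w hu hey.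
have [p'0 v'0] : p' = 0 /\ v' = 0.
  move: hey; rewrite /ey mulmx3_vec3 scale_vec3 => /vec3_inj[].
  by rewrite !(mulr0, mulr1, addr0, add0r).
subst p' v'; move: hu.
rewrite /csub !mx3_entry /dxx /dxy /dxz /dyy /dyz /dzz /cscale /= => hu [].
rewrite mx3_unit in hu => x3 x2y x2z xy2 xyz xz2 _ y2z yz2 z3.
have one := oner_neq0 F; have nz n : n.+1%:R != 0 :> F by rewrite pnatr_eq0.
have det0 : p * s * w - q * s * v != 0.
  by apply: contraNneq hu => e; apply/eqP; rewrite -[RHS]e; ring.
have s0 : s != 0 by apply: contraNneq det0 => ->; apply/eqP; ring.
have v0 : v = 0.
  apply/eqP; rewrite -(mulrI_eq0 _ (mulfI (expf_neq0 2 s0))); apply/eqP.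
  by apply: (lin_eq xy2 one); ring.
subst v; have psw0 : p * s * w != 0 by move: det0; rewrite mulr0 subr0.
have w0 : w != 0 by apply: contraNneq psw0 => ->; rewrite mulr0.
have p0 : p != 0 by apply: contraNneq psw0 => ->; rewrite !mul0r.
have cancel (m x : F) : m != 0 -> m * x = 0 -> x = 0.
  by move=> m0 /eqP; rewrite mulf_eq0 (negbTE m0) => /eqP.
have r0 : r = 0.
  by apply: (@cancel (s * w)); [rewrite mulf_neq0|apply: (lin_eq xyz (nz 1)); ring].
have u0 : u = 0.
  by apply: (@cancel (s * w)); [rewrite mulf_neq0|apply: (lin_eq yz2 (nz 1)); ring].
have q0 : q = 0.
  apply: (@cancel (p ^+ 2)); first by rewrite expf_neq0.
  by apply: (lin_eq (esym x2z) (nz 2)); rewrite r0; ring.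
subst r u q; have kp : k = p ^+ 3 by apply: (lin_eq x3 one); ring.
have ks : k = s ^+ 2 * w by apply: (lin_eq (esym y2z) one); ring.
have aw : a * w ^+ 2 * p = p ^+ 3 * a.
  by rewrite -kp; apply: (lin_eq (esym xz2) one); ring.
have bw : b * w ^+ 3 = p ^+ 3 * b.
  by rewrite -kp; apply: (lin_eq (esym z3) one); ring.
have sp : s ^+ 2 * w = p ^+ 3 by rewrite -ks.
have s2 : s ^+ 2 = p ^+ 3 / w by rewrite -sp mulfK.
exists w, (s / p); split=> //.
- by rewrite mulf_neq0 ?invr_eq0.
- rewrite expr_div_n (exprM s 2 2) s2.
  apply: (mulfI (mulf_neq0 (expf_neq0 2 w0) p0)).
  transitivity (p ^+ 3 * a); first by field; rewrite w0 p0.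
  by rewrite -aw; ring.
- rewrite expr_div_n (exprM s 2 3) s2.
  apply: (mulfI (expf_neq0 3 w0)).
  transitivity (p ^+ 3 * b); first by field; rewrite w0 p0.
  by rewrite -bw; ring.
- have E2 : w * (s / p) ^+ 2 = p by rewrite expr_div_n s2; field; rewrite w0 p0.
  have E3 : w * (s / p) ^+ 3 = s by rewrite exprSr mulrA E2 mulrC divfK.
  by rewrite scale_mx3 E2 E3 !mulr0 mulr1.
Qed.

(** The stabilizer permutes the finitely many flexes. Those of its elements that
    move the flex at infinity to a given one form a coset of the group found in
    [wcubic_fix_ey], whose parameter satisfies t^12 = 1. *)
Lemma wcubic_stabilizer a b : (a != 0) || (b != 0) -> exists G : seq 'M[F]_3,
  forall g k, g \in unitmx -> k != 0 ->
    csub g (wcubic a b) = cscale k (wcubic a b) ->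
  exists h m, [/\ h \in G, m != 0 & g = m *: h].
Proof.
move=> ab0; set W := wcubic a b; have [L [_ _ LP]] := wcubic_flexes a b.
have [|T TP] := @roots_seq ('X^12 - 1).
  by rewrite -size_poly_gt0 size_XnsubC.
pose stab g o := exists k l,
  [/\ g \in unitmx, k != 0, l != 0, g *m ey = l *: wpt o & csub g W = cscale k W].
have /boolp.choice[rep repP] o : exists g, (exists g', stab g' o) -> stab g o.
  by have [[g sg]|ns] := pselect (exists g, stab g o); [exists g|exists 0].
exists [seq rep o *m mx3 (t ^+ 2) 0 0 0 (t ^+ 3) 0 0 0 1 | o <- L, t <- T] => g k gu k0 gW.
have gfl : sflex W (g *m ey).
  by rewrite -sflex_csub // gW sflex_cscale //; exact: sflex_wcubic_ey.
have [l [ o [l0 gey ofl]]] := sflex_wcubic_wpt gfl.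
have [k1 [l1 [ru k10 l10 rey rW]]] : stab (rep o) o.
  by apply: repP; exists g, k, l.
pose h := invmx (rep o) *m g.
have hu : h \in unitmx by rewrite unitmx_mul unitmx_inv ru.
have hey : h *m ey = (l / l1) *: ey.
  have lwpt : l *: wpt o = (l / l1) *: (rep o *m ey) by rewrite rey scalerA divfK.
  by rewrite -mulmxA gey lwpt -scalemxAr mulKmx.
have rVW : csub (invmx (rep o)) W = cscale k1^-1 W by exact: csubV_eq.
have hW : csub h W = cscale (k1^-1 * k) W by rewrite csubM rVW csub_cscale gW cscaleM.
have kk0 : k1^-1 * k != 0 by rewrite mulf_neq0 ?invr_eq0.
have [m [t [m0 t0 t4 t6 hE]]] := wcubic_fix_ey hu kk0 hey hW.
exists (rep o *m mx3 (t ^+ 2) 0 0 0 (t ^+ 3) 0 0 0 1), m; split=> //.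
- apply/allpairsPdep; exists o, t; split=> //; first by rewrite LP; apply/asboolP.
  apply: TP; rewrite /root !hornerE subr_eq0; apply/eqP.
  case/orP: ab0 => [a0|b0].
    have t41 : t ^+ 4 = 1 by apply: (mulIf a0); rewrite t4 mul1r.
    by rewrite (exprM t 4 3) t41 expr1n.
  have t61 : t ^+ 6 = 1 by apply: (mulIf b0); rewrite t6 mul1r.
  by rewrite (exprM t 6 2) t61 expr1n.
- by rewrite scalemxAr -hE mulmxA mulmxV // mul1mx.
Qed.

End Weierstrass.

(** * Cubics with infinite stabilizer *)

Section LineInfinite.
Context {F : numFieldType}.
Implicit Types (c : cubic F) (A B g h : 'M[F]_3) (u v w : 'cV[F]_3) (k s r t : F).

(** An infinite stabilizer in the projective linear group, exhibited as a
    one-parameter family with finitely many exceptional parameters. *)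
Definition large_stabilizer c := exists (f : F -> 'M[F]_3) (s : seq F),
  [/\ forall r, r \notin s -> f r \in unitmx,
      forall r, r \notin s -> exists2 k, k != 0 & csub (f r) c = cscale k c &
      forall r t m, r \notin s -> t \notin s -> f r = m *: f t -> r = t].

(** An infinitesimal symmetry of the line n and of the conic Q. Let X be the matrix of
    the cross product with n. As X is skew and Q symmetric, Q (X Q) is the negative
    of its transpose, so X Q is a solution; if it vanishes, X is one. *)
Lemma skew_field (n : 'rV[F]_3) (Q : 'M[F]_3) : n != 0 -> Q^T = Q -> exists A,
  [/\ A != 0, n *m A = 0 & Q *m A + A^T *m Q = 0].
Proof.
move=> n0 Qs; pose X := mx3 0 (- n 0 2) (n 0 1) (n 0 2) 0 (- n 0 0) (- n 0 1) (n 0 0) 0.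
have XT : X^T = - X.
  by rewrite -[RHS]scaleN1r /X trmx3 scale_mx3; congr mx3; ring.
have nX : n *m X = 0.
  by apply/rowP; elim/forall3; rewrite !mxE sum3 /X !mx3_entry; ring.
have X0 : X != 0.
  apply: contraNneq n0 => /matrixP h; apply/eqP/rowP.
  have := (h 2 1, h 0 2, h 1 0); rewrite /X !mx3_entry !mxE => -[[h0 h1] h2].
  by elim/forall3; rewrite mxE.
have [XQ|XQ] := eqVneq (X *m Q) 0; last first.
  exists (X *m Q); rewrite XQ mulmxA nX mul0mx trmx_mul Qs XT mulmxN mulNmx mulmxA.
  by split=> //; rewrite -mulmxA addrN.
exists X; rewrite X0 nX XT mulNmx XQ oppr0 addr0; split=> //.
by apply: trmx_inj; rewrite trmx_mul Qs XT mulNmx XQ oppr0 trmx0.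
Qed.

(** The Cayley transforms (r + A) (r - A)^-1 of an infinitesimal symmetry A fix n and
    are orthogonal for Q, hence fix the product of the line and the conic. *)
Lemma line_large_stabilizer c : has_line c -> large_stabilizer c.
Proof.
case=> n [Q [n0 Qs nQ]]; have [A [A0 nA QA]] := skew_field n0 Qs.
have detB B : exists s : seq F, forall r, r \notin s -> r%:M - B \in unitmx.
  have [|s sP] := @roots_seq _ (char_poly B).
    exact: monic_neq0 (char_poly_monic B).
  exists s => r; apply: contraR => nu; apply: sP; rewrite -eigenvalue_root_char.
  rewrite /eigenvalue /eigenspace -mxrank_eq0 mxrank_ker subn_eq0 -ltnNge ltn_neqAle rank_leq_row andbT.
  apply: contra nu => /eqP rk.
  by rewrite -row_free_unit /row_free -opprB mxrank_opp rk.
have [[s1 s1P] [s2 s2P]] := (detB A, detB (- A)).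
exists (fun r => (r%:M + A) *m invmx (r%:M - A)), (s1 ++ s2).
have split1 r : r \notin s1 ++ s2 -> (r%:M - A \in unitmx) * (r%:M + A \in unitmx).
  by rewrite mem_cat negb_or => /andP[/s1P u1 /s2P]; rewrite opprK => u2.
split=> [r /split1[u1 u2]|r /split1[u1 u2]|r t m].
- by rewrite unitmx_mul u2 unitmx_inv.
- exists 1; first exact: oner_neq0.
  apply: ev_inj => v; rewrite ev_csub ev_cscale mul1r -mulmxA.
  have -> : ev c v = ev c ((r%:M - A) *m (invmx (r%:M - A) *m v)) by rewrite mulKVmx.
  move: (invmx _ *m v) => {}v; rewrite !nQ !mulmxA.
  have -> : n *m (r%:M + A) = n *m (r%:M - A) by rewrite !mulmxDr mulmxN nA oppr0.
  congr (_ * _); rewrite !trmx_mul.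
  have group B : v^T *m B^T *m Q *m B *m v = v^T *m (B^T *m Q *m B) *m v.
    by rewrite !mulmxA.
  rewrite !group.
  suff -> : (r%:M + A)^T *m Q *m (r%:M + A) = (r%:M - A)^T *m Q *m (r%:M - A).
    by [].
  have tr B : (r%:M + B)^T = r%:M + B^T by rewrite [LHS]raddfD /= tr_scalar_mx.
  have AQ : A^T *m Q = - (Q *m A) by apply/eqP; rewrite -addr_eq0 addrC QA.
  rewrite !tr raddfN /= !(mulmxDl, mulmxDr, mulNmx, mulmxN, mul_scalar_mx, mul_mx_scalar).
  rewrite AQ !(mulNmx, scalerN, opprK) !addrA.
  by rewrite -!scalemxAl scalerBr scalerDr subrK addrK.
move=> /split1[u1 u2] /split1[u3 u4] ft.
have nf s : s%:M - A \in unitmx -> n *m ((s%:M + A) *m invmx (s%:M - A)) = n.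
  move=> us; have -> : n *m ((s%:M + A) *m invmx (s%:M - A)) =
      (n *m (s%:M - A)) *m invmx (s%:M - A).
    by rewrite mulmxA !mulmxDr mulmxN nA oppr0 addr0.
  by rewrite mulmxK.
have m1 : m = 1.
  have := congr1 (mulmx n) ft; rewrite -scalemxAr !nf // => /eqP.
  rewrite -{1}[n]scale1r -subr_eq0 -scalerBl scaler_eq0 (negbTE n0) orbF subr_eq0.
  by move/eqP.
move: ft; rewrite m1 scale1r => /(congr1 (mulmx^~ ((r%:M - A) *m (t%:M - A)))).
have comm : (r%:M - A) *m (t%:M - A) = (t%:M - A) *m (r%:M - A).
  rewrite !(mulmxBl, mulmxBr, mul_scalar_mx, mul_mx_scalar) !scale_scalar_mx mulrC.
  by rewrite !opprB addrACA [- (_ *: A) + _]addrC addrACA.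
rewrite /= mulmxA mulmxKV // comm mulmxA mulmxKV //.
rewrite !(mulmxDl, mulmxBr, mul_scalar_mx, mul_mx_scalar) !scale_scalar_mx.
rewrite [t * r]mulrC -!addrA => /addrI; rewrite !addrA => /addIr.
rewrite ![- _ + _]addrC -!scalerBl => /eqP.
rewrite -subr_eq0 -scalerBl scaler_eq0 (negbTE A0) orbF.
rewrite (_ : _ - _ = 2 * (t - r)); last by ring.
by rewrite mulf_eq0 pnatr_eq0 /= subr_eq0 => /eqP.
Qed.

Lemma cusp_large_stabilizer : large_stabilizer (wcubic 0 0 : cubic F).
Proof.
exists (fun r => mx3 (r ^+ 2) 0 0 0 (r ^+ 3) 0 0 0 1), [:: 0].
split=> [r|r|r t m]; rewrite !inE => r0.
- by rewrite mx3_unit !(mul0r, mulr0, subr0, addr0, mulr1) mulf_neq0 ?expf_neq0.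
- exists (r ^+ 6); first by rewrite expf_neq0.
  rewrite /csub !mx3_entry /cscale /dxx /dxy /dxz /dyy /dyz /dzz /=.
  by congr Cubic; ring.
move=> t0; rewrite scale_mx3 => /matrixP e; have := (e 0 0, e 1 1, e 2 2).
rewrite !mx3_entry mulr1 => -[[e2 e3] m1].
rewrite -m1 !mul1r in e2 e3.
by move: e3; rewrite (exprS r 2) (exprS t 2) -e2 => /(mulIf (expf_neq0 2 r0)).
Qed.

End LineInfinite.

(** * Intersection of a cubic with its Hessian *)

(** The product of g2 y^2 + g1 y + g0 over the roots y of y^3 + f2 y^2 + f1 y + f0,
    expanded in the elementary symmetric functions of these roots. *)
Definition resultant3 (R : comNzRingType) (f0 f1 f2 g0 g1 g2 : R) : R :=
  g0 ^+ 3 - f2 * g0 ^+ 2 * g1 + (f2 ^+ 2 - 2 * f1) * g0 ^+ 2 * g2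
  + f1 * g0 * g1 ^+ 2 + (3 * f0 - f1 * f2) * g0 * g1 * g2
  + (f1 ^+ 2 - 2 * f0 * f2) * g0 * g2 ^+ 2 - f0 * g1 ^+ 3
  + f0 * f2 * g1 ^+ 2 * g2 - f0 * f1 * g1 * g2 ^+ 2 + f0 ^+ 2 * g2 ^+ 3.

Section Closed.
Context {F : numClosedFieldType}.
Implicit Types (c : cubic F) (A B : 'M[F]_3) (u v w : 'cV[F]_3) (k s : F).

Lemma resultant3_root (f0 f1 f2 g0 g1 g2 : F) :
  resultant3 f0 f1 f2 g0 g1 g2 = 0 ->
  exists y, y ^+ 3 + f2 * y ^+ 2 + f1 * y + f0 = 0 /\ g2 * y ^+ 2 + g1 * y + g0 = 0.
Proof.
pose p : {poly F} := 'X^3 + f2 *: 'X^2 + f1 *: 'X + f0%:P.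
have pE y : p.[y] = y ^+ 3 + f2 * y ^+ 2 + f1 * y + f0 by rewrite /p !hornerE.
have sp : size p = 4.
  rewrite /p -!addrA size_polyDl ?size_polyXn // ltnS.
  rewrite (leq_trans (size_polyD _ _)) // geq_max (leq_trans (size_scale_leq _ _)) ?size_polyXn //.
  rewrite (leq_trans (size_polyD _ _)) // geq_max (leq_trans (size_scale_leq _ _)) ?size_polyX //.
  by rewrite (leq_trans (size_polyC_leq1 _)).
have [rs] := closed_field_poly_normal p.
have lp : lead_coef p = 1.
  rewrite lead_coefE sp /p !(coefD, coefZ, coefC, coefX, coefXn) /=.
  by rewrite !mulr0 !addr0.
rewrite lp scale1r => prs.
have : size rs = 3 by have := sp; rewrite prs size_prod_XsubC => -[].
case: rs prs => [|r1 [|r2 [|r3 []]]] // prs _.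
have {prs} pr y : y ^+ 3 + f2 * y ^+ 2 + f1 * y + f0 = (y - r1) * (y - r2) * (y - r3).
  rewrite -pE prs !big_cons big_nil !hornerE. exact: mulr1.
have two : (2 : F) != 0 by rewrite pnatr_eq0.
have E0 : f0 = - (r1 * r2 * r3) by apply: (lin_eq (pr 0) (oner_neq0 F)); ring.
have E2 : f2 = - (r1 + r2 + r3).
  apply: (lin_eq (congr2 +%R (pr 1) (pr (-1))) two); rewrite E0; ring.
have E1 : f1 = r1 * r2 + r1 * r3 + r2 * r3.
  by apply: (lin_eq (pr 1) (oner_neq0 F)); rewrite E0 E2; ring.
have -> : resultant3 f0 f1 f2 g0 g1 g2 = (g2 * r1 ^+ 2 + g1 * r1 + g0) *
    (g2 * r2 ^+ 2 + g1 * r2 + g0) * (g2 * r3 ^+ 2 + g1 * r3 + g0).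
  by rewrite /resultant3 E0 E1 E2; ring.
move/eqP; rewrite !mulf_eq0 -!orbA => /or3P[] /eqP g0r; [exists r1|exists r2|exists r3];
  by rewrite pr subrr !(mul0r, mulr0).
Qed.

Lemma resultant3_homog (f0 f1 f2 g0 g1 g2 t : F) :
  resultant3 (t ^+ 3 * f0) (t ^+ 2 * f1) (t * f2) (t ^+ 3 * g0) (t ^+ 2 * g1) (t * g2) =
  t ^+ 9 * resultant3 f0 f1 f2 g0 g1 g2.
Proof. by rewrite /resultant3; ring. Qed.

Lemma horner_resultant3 (f0 f1 f2 g0 g1 g2 : {poly F}) t :
  (resultant3 f0 f1 f2 g0 g1 g2).[t] =
  resultant3 f0.[t] f1.[t] f2.[t] g0.[t] g1.[t] g2.[t].
Proof.
have natE n : (n%:R : {poly F}).[t] = n%:R by rewrite -polyC_natr hornerC.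
by rewrite /resultant3 !(natE, hornerN, hornerM, horner_exp, hornerD).
Qed.

(** A weak form of the theorem of Bezout. Reduce h modulo c to degree two in y. The
    resultant of both with respect to y is a form of degree nine in x and z; it has
    a nontrivial zero (x : z), above which c and h have a common root y. *)
Lemma common_zero c h : a030 c = 1 ->
  exists2 v, v != 0 & ev c v = 0 /\ ev h v = 0.
Proof.
case: c => c300 c210 c201 c120 c111 c102 c030 c021 c012 c003.
rewrite [a030 _]/= => ->.
case: h => d300 d210 d201 d120 d111 d102 d030 d021 d012 d003.
pose q2 (R : comNzRingType) (a b x z : R) := a * x + b * z.
pose q1 (R : comNzRingType) (a b l x z : R) := a * x ^+ 2 + b * x * z + l * z ^+ 2.
pose q0 (R : comNzRingType) (a b l d x z : R) :=
  a * x ^+ 3 + b * x ^+ 2 * z + l * x * z ^+ 2 + d * z ^+ 3.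
pose N (R : comNzRingType) (j : F -> R) (x z : R) := resultant3
  (q0 _ (j c300) (j c201) (j c102) (j c003) x z)
  (q1 _ (j c210) (j c111) (j c012) x z) (q2 _ (j c120) (j c021) x z)
  (q0 _ (j (d300 - d030 * c300)) (j (d201 - d030 * c201))
    (j (d102 - d030 * c102)) (j (d003 - d030 * c003)) x z)
  (q1 _ (j (d210 - d030 * c210)) (j (d111 - d030 * c111)) (j (d012 - d030 * c012)) x z)
  (q2 _ (j (d120 - d030 * c120)) (j (d021 - d030 * c021)) x z).
suff [x [z [xz0 Nxz]]] : exists x z : F, (x != 0) || (z != 0) /\ N _ id x z = 0.
  have [y yP] := resultant3_root Nxz.
  rewrite /q0 /q1 /q2 /= in yP; case: yP => cy hy.
  exists (vec3 x y z).
    apply: contraTneq xz0 => /colP e.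
    by have := (e 0, e 2); rewrite !vec3_entry !mxE => -[-> ->]; rewrite eqxx.
  rewrite !ev_vec3 /=; split; first by rewrite -[RHS]cy; ring.
  transitivity (d030 * 0 + 0 : F); last by rewrite mulr0 addr0.
  by rewrite -{1}cy -hy; ring.
have homog x z t : N _ id (t * x) (t * z) = t ^+ 9 * N _ id x z.
  have q2h a b : q2 F a b (t * x) (t * z) = t * q2 F a b x z by rewrite /q2; ring.
  have q1h a b l : q1 F a b l (t * x) (t * z) = t ^+ 2 * q1 F a b l x z.
    by rewrite /q1; ring.
  have q0h a b l d : q0 F a b l d (t * x) (t * z) = t ^+ 3 * q0 F a b l d x z.
    by rewrite /q0; ring.
  by rewrite /N !q2h !q1h !q0h resultant3_homog.
have evN (p q : {poly F}) t : (N _ polyC p q).[t] = N _ id p.[t] q.[t].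
  have q2E a b : (q2 _ a%:P b%:P p q).[t] = q2 _ a b p.[t] q.[t].
    by rewrite /q2 !(hornerC, hornerM, hornerD).
  have q1E a b l : (q1 _ a%:P b%:P l%:P p q).[t] = q1 _ a b l p.[t] q.[t].
    by rewrite /q1 !(hornerC, horner_exp, hornerM, hornerD).
  have q0E a b l d : (q0 _ a%:P b%:P l%:P d%:P p q).[t] = q0 _ a b l d p.[t] q.[t].
    by rewrite /q0 !(hornerC, horner_exp, hornerM, hornerD).
  by rewrite /N horner_resultant3 !q2E !q1E !q0E.
have h1 t : (1 : {poly F}).[t] = 1 := hornerC 1 t.
pose N1 := N _ polyC 'X 1.
have [/closed_rootP[t /rootP rt]|] := boolP (size N1 != 1).
  exists t, 1; rewrite oner_neq0 orbT; split=> //.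
  by move: rt; rewrite evN hornerX h1.
(* If N (x, 1) is a constant k, then N is k z^9, which vanishes at (1 : 0). *)
rewrite negbK => /size_poly1P[k k0 N1k].
exists 1, 0; rewrite oner_neq0; split=> //.
pose p := 'X * (N _ polyC 1 'X - k *: 'X^9) : {poly F}.
have : p = 0.
  apply/eqP/negPn/negP => /closed_nonrootP[t /negP]; apply.
  rewrite /root hornerM hornerX mulf_eq0; case: eqP => //= /eqP t0.
  have := evN 'X 1 t^-1; rewrite -/N1 N1k hornerC hornerX h1 => kE.
  rewrite hornerD hornerN hornerZ hornerXn evN h1 hornerX kE.
  by rewrite mulrC -homog mulfV // mulr1 subrr.
move/eqP; rewrite mulf_eq0 polyX_eq0 /= subr_eq0 => /eqP/(congr1 (horner^~ 0)).
by rewrite evN h1 hornerX hornerZ hornerXn expr0n mulr0.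
Qed.

(** The coefficients of a cubic form from its values, so that the Hessian need not be
    expanded. *)
Definition interpolate (D : F -> F -> F -> F) : cubic F :=
  let x3 := D 1 0 0 in let y3 := D 0 1 0 in let z3 := D 0 0 1 in
  let odd s t := (s - t) / 2 in let even s t := (s + t) / 2 in
  let x2y := odd (D 1 1 0) (D 1 (-1) 0) - y3 in
  let xy2 := even (D 1 1 0) (D 1 (-1) 0) - x3 in
  let x2z := odd (D 1 0 1) (D 1 0 (-1)) - z3 in
  let xz2 := even (D 1 0 1) (D 1 0 (-1)) - x3 in
  let y2z := odd (D 0 1 1) (D 0 1 (-1)) - z3 in
  let yz2 := even (D 0 1 1) (D 0 1 (-1)) - y3 in
  let xyz := D 1 1 1 - (x3 + y3 + z3 + x2y + xy2 + x2z + xz2 + y2z + yz2) in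
  Cubic x3 x2y x2z xy2 xyz xz2 y3 y2z yz2 z3.

Lemma det_hess_cubic c : exists h, forall v, ev h v = \det (hess c v).
Proof.
exists (interpolate (fun x y z => \det (hess c (vec3 x y z)))) => v.
rewrite [v]vec3E ev_vec3 /interpolate /ev3 /hess !vec3_entry !det_mx3.
rewrite /dxx /dxy /dxz /dyy /dyz /dzz.
move: (v 0 0) (v 1 0) (v 2 0) => x y z.
by field.
Qed.

End Closed.

(** * Flexes over an algebraically closed field *)

Section Closed2.
Context {F : numClosedFieldType}.
Implicit Types (c : cubic F) (A B : 'M[F]_3) (u v w : 'cV[F]_3) (k s : F).

Lemma quad_root (a b l : F) : a != 0 -> exists t, a * t ^+ 2 + b * t + l = 0.
Proof.
move=> a0; pose p : {poly F} := a *: 'X^2 + b *: 'X + l%:P.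
have [|t /rootP] := @closed_rootP F p _; last first.
  by rewrite /p !(hornerC, hornerX, hornerXn, hornerZ, hornerD); exists t.
have sp : (size (b *: 'X + l%:P : {poly F})%R <= 2)%N.
  rewrite (leq_trans (size_polyD _ _)) // geq_max (leq_trans (size_scale_leq _ _)) ?size_polyX //.
  by rewrite (leq_trans (size_polyC_leq1 _)).
by rewrite /p -addrA size_polyDl size_scale // size_polyXn.
Qed.

Lemma cubic_root (a b l d : F) : a != 0 ->
  exists t, a * t ^+ 3 + b * t ^+ 2 + l * t + d = 0.
Proof.
move=> a0; pose p : {poly F} := a *: 'X^3 + b *: 'X^2 + l *: 'X + d%:P.
have [|t /rootP] := @closed_rootP F p _; last first.
  by rewrite /p !(hornerC, hornerX, hornerXn, hornerZ, hornerD); exists t.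
have sp : (size (b *: 'X^2 + (l *: 'X + d%:P) : {poly F})%R <= 3)%N.
  rewrite (leq_trans (size_polyD _ _)) // geq_max.
  rewrite (leq_trans (size_scale_leq _ _)) ?size_polyXn //.
  rewrite (leq_trans (size_polyD _ _)) // geq_max (leq_trans (size_scale_leq _ _)) ?size_polyX //.
  by rewrite (leq_trans (size_polyC_leq1 _)).
by rewrite /p -!addrA size_polyDl size_scale // size_polyXn.
Qed.

(** A form in x and z alone is a product of linear forms. *)
Lemma has_line_binary (p r t w : F) : has_line (Cubic p 0 r 0 0 t 0 0 0 w : cubic F).
Proof.
have [->|p0] := eqVneq p 0; first exact: has_line_z.
have [s rs] := cubic_root r t w p0.
pose a := r + p * s; pose b := t + a * s.
exists (vec3 1 0 (- s))^T, (mx3 p 0 (a / 2) 0 0 0 (a / 2) 0 b); split.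
- rewrite trmx_eq0; apply/eqP=> /colP/(_ 0).
  by rewrite vec3_entry mxE => /eqP; rewrite oner_eq0.
- by rewrite trmx3.
move=> v; rewrite [v]vec3E; move: (v 0 0) (v 1 0) (v 2 0) => x y z.
rewrite dot3 ev_vec3 -mulmxA mulmx3_vec3 dot3 /=.
have -> : w = - (p * s ^+ 3 + r * s ^+ 2 + t * s).
  by apply: (lin_eq rs (oner_neq0 F)); ring.
by rewrite /b /a; field.
Qed.

Lemma sflexI c x y z (D := fun p : cubic F -> F -> F -> F -> F => p c x y z) :
  ev3 c x y z = 0 ->
  D dxx * (D dyy * D dzz - D dyz * D dyz) - D dxy * (D dxy * D dzz - D dyz * D dxz)
    + D dxz * (D dxy * D dyz - D dyy * D dxz) = 0 ->
  dy c x y z != 0 -> sflex c (vec3 x y z).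
Proof.
move=> c0 h0 d0; rewrite /sflex /hess !vec3_entry det_mx3 -mulmxA mulmx3_vec3.
split; [|exact: h0|].
- apply/matrixP=> i j; rewrite !ord1 dot3 mxE.
  transitivity (6 * ev3 c x y z); last by rewrite c0 mulr0.
  by case: (c) => *; rewrite /dxx /dxy /dxz /dyy /dyz /dzz /=; ring.
- apply: contraNneq d0 => /colP/(_ 1); rewrite vec3_entry mxE.
  have two : (2 : F) != 0 by rewrite pnatr_eq0.
  move=> e; apply/eqP; apply: (lin_eq e two).
  by case: (c) => *; rewrite /dxx /dxy /dxz /dyy /dyz /dzz /=; ring.
Qed.

(** Where z = 1, the curve is the graph of a polynomial of degree three in x, whose
    inflexion point is at x = - r / (3 p). *)
Lemma cuspidal_flex (p r t u w : F) : p != 0 -> u != 0 ->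
  exists v, sflex (Cubic p 0 r 0 0 t 0 0 u w : cubic F) v.
Proof.
move=> p0 u0; pose s := r / (3 * p).
exists (vec3 (- s) (((3 * p * s ^+ 2 - t) * - s + (p * s ^+ 3 - w)) / u) 1).
apply: sflexI; rewrite /dxx /dxy /dxz /dyy /dyz /dzz /= /s.
- by field; rewrite p0 u0.
- by field; rewrite p0 u0.
- by rewrite !(mul0r, mulr0, add0r, addr0) expr1n mulr1.
Qed.

(** With y' = y + r x + t z and with cube roots a of p and g of w, the equation reads
    (a x)^3 + (g z)^3 + x y' z = 0, and the flex is given by y' = a x + g z = 0. *)
Lemma nodal_flex (p r t w : F) : p != 0 -> w != 0 ->
  exists v, sflex (Cubic p 0 r 0 1 t 0 0 0 w : cubic F) v.
Proof.
move=> p0 w0; have [a pE] : exists a, a ^+ 3 = p.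
  by exists (3.-root p); rewrite rootCK.
have [g wE] : exists g, g ^+ 3 = w by exists (3.-root w); rewrite rootCK.
have a0 : a != 0 by apply: contraNneq p0 => a0; rewrite -pE a0 expr0n.
have g0 : g != 0 by apply: contraNneq w0 => g0; rewrite -wE g0 expr0n.
exists (vec3 g (- r * g + t * a) (- a)).
apply: sflexI; rewrite /dxx /dxy /dxz /dyy /dyz /dzz /= -?pE -?wE.
- by ring.
- by ring.
- by rewrite !(mul0r, mulr0, add0r, addr0) mul1r mulrN oppr_eq0 mulf_neq0.
Qed.

(** Once the singular point is (0 : 1 : 0), the variable y occurs only to the first
    power, multiplied by the quadratic form of the tangent cone. As the curve
    contains no line, it has a cusp if that form is a square, and otherwise a node. *)
Lemma singular_flex c v : v != 0 -> hess c v *m v = 0 -> ~ has_line c ->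
  exists u, sflex c u.
Proof.
have pull A d : A \in unitmx -> ~ has_line d ->
    (~ has_line (csub A d) -> exists u, sflex (csub A d) u) -> exists u, sflex d u.
  move=> Au nd h; have [|u hu] := h; first by move=> /(has_line_csub Au).
  by exists (A *m u); rewrite -sflex_csub.
move=> v0 hv nc; have [A Au AE] := unit_col v0.
apply: (pull A c Au nc) => {}nc.
have : hess (csub A c) ey *m ey = 0.
  by rewrite hess_csub AE -!mulmxA AE hv mulmx0.
move: (csub A c) nc => {hv AE v0 Au A v}c {}nc.
rewrite /hess /ey !vec3_entry mulmx3_vec3 => /colP h.
have := (h 0, h 1, h 2); rewrite !vec3_entry !mxE => {h}.
case: c nc => p q r a s t b g u w; rewrite /dxx /dxy /dxz /dyy /dyz /dzz /=.
rewrite !(mul0r, mulr0, add0r, addr0, mulr1) => nc [[]].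
have zero n x : n.+1%:R * x = 0 :> F -> x = 0.
  by move/eqP; rewrite mulf_eq0 pnatr_eq0 /= => /eqP.
move=> /zero a0 /zero b0 /zero g0; subst a b g.
(* A root of the quadratic form q x^2 + s x z + u z^2 that multiplies y makes z
   divide it after a substitution. *)
suff qz (p' r' s' t' u' w' : F) (d := Cubic p' 0 r' 0 s' t' 0 0 u' w') :
    ~ has_line d -> exists v, sflex d v.
  have [q0|q0] := eqVneq q 0; first by rewrite q0 in nc *; exact: qz nc.
  have [m mE] := quad_root s u q0.
  have Bu : mx3 m 0 1 0 1 0 1 0 0 \in unitmx.
    rewrite mx3_unit (_ : _ - _ + _ = - 1%R); last by ring.
    by rewrite oppr_eq0 oner_neq0.
  apply: (pull _ _ Bu nc).
  have -> : csub (mx3 m 0 1 0 1 0 1 0 0) (Cubic p q r 0 s t 0 0 u w) =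
     Cubic (p * m ^+ 3 + r * m ^+ 2 + t * m + w) 0
       (3 * p * m ^+ 2 + 2 * r * m + t) 0 (2 * q * m + s) (3 * p * m + r) 0 0 q p.
    rewrite /csub !mx3_entry /dxx /dxy /dxz /dyy /dyz /dzz /=.
    congr Cubic; try ring.
    by rewrite -[RHS]mE; ring.
  exact: qz.
move=> {nc p q r s t u w} nd; rewrite /d.
have p0 : p' != 0 by apply/eqP=> p0; apply: nd; rewrite /d p0; exact: has_line_z.
have [s0|s0] := eqVneq s' 0.
  rewrite s0; apply: cuspidal_flex => //; apply/eqP=> u0; apply: nd.
  by rewrite /d s0 u0; exact: has_line_binary.
have Bu : mx3 1 0 (- u' / s') 0 (s'^-1) 0 0 0 1 \in unitmx.
  rewrite mx3_unit (_ : _ - _ + _ = s'^-1); last by ring.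
  by rewrite invr_eq0.
apply: (pull _ _ Bu nd).
set m := - u' / s'.
have -> : csub (mx3 1 0 m 0 s'^-1 0 0 0 1) d =
   Cubic p' 0 (3 * p' * m + r') 0 1 (3 * p' * m ^+ 2 + 2 * r' * m + t') 0 0 0
     (p' * m ^+ 3 + r' * m ^+ 2 + t' * m + w').
  rewrite /csub !mx3_entry /dxx /dxy /dxz /dyy /dyz /dzz /= /m.
  by congr Cubic; field.
set w := (p' * m ^+ 3 + _ + _ + _); set r := _ + r'; set t := _ + _ + t'.
move=> nd'; apply: nodal_flex => //; apply/eqP=> w0; apply: nd'; rewrite w0.
apply: (@has_line_csub _ (mx3 0 0 1 0 1 0 1 0 0)).
  rewrite mx3_unit (_ : _ - _ + _ = - 1%R); last by ring.
  by rewrite oppr_eq0 oner_neq0.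
have -> : csub (mx3 0 0 1 0 1 0 1 0 0) (Cubic p' 0 r 0 1 t 0 0 0 0) =
    Cubic 0 0 t 0 1 r 0 0 0 p'.
  rewrite /csub !mx3_entry /dxx /dxy /dxz /dyy /dyz /dzz /=.
  by congr Cubic; ring.
exact: has_line_z.
Qed.

(** A common zero of the cubic and its Hessian is a smooth flex or a singular point.
    Moving a point off the curve to (0 : 1 : 0) makes the cubic monic in y. *)
Lemma closed_flex c : ~ has_line c -> exists v, sflex c v.
Proof.
move=> nc; have [u cu] : exists u, ev c u != 0.
  apply: contrapT => nu; apply: nc.
  have -> : c = Cubic 0 0 0 0 0 0 0 0 0 0; last exact: has_line_z.
  by apply: ev_eq0 => v; apply/eqP; apply: contra_notT nu => h; exists v.
have u0 : u != 0.
  apply: contra_neq cu => ->; have -> : 0 = vec3 0 0 0 :> 'cV[F]_3.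
    by apply/colP; elim/forall3; rewrite mxE vec3_entry.
  by rewrite ev_vec3; case: (c) => * /=; rewrite !expr0n !mulr0 !addr0.
have [A Au AE] := unit_col u0.
pose m := a030 (csub A c).
have m0 : m != 0.
  move: cu; rewrite -AE -ev_csub /ey ev_vec3 /m; case: (csub A c) => c0 c1 c2 c3 c4 c5 c6 c7 c8 c9 /=.
  by rewrite !(expr0n, expr1n, mul0r, mulr0, mulr1, addr0, add0r).
have [h hE] := det_hess_cubic (csub A c).
have [|v v0 [cv hv]] := @common_zero _ (cscale m^-1 (csub A c)) h.
  by move: m0; rewrite /m; case: (csub A c) => c0 c1 c2 c3 c4 c5 c6 c7 c8 c9 m0 /=; rewrite mulVf.
have {}cv : ev (csub A c) v = 0.
  by move/eqP: cv; rewrite ev_cscale mulf_eq0 invr_eq0 (negbTE m0) => /eqP.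
rewrite hE in hv.
have {}nc : ~ has_line (csub A c) by move=> /(has_line_csub Au).
suff [w] : exists w, sflex (csub A c) w by rewrite sflex_csub //; exists (A *m w).
have [hv0|hv0] := eqVneq (hess (csub A c) v *m v) 0; first exact: singular_flex hv0 nc.
exists v; split=> //.
apply/matrixP=> i j; rewrite !ord1 [RHS]mxE -mulmxA.
transitivity (6 * ev (csub A c) v); last by rewrite cv mulr0.
rewrite [v]vec3E ev_vec3 /hess !vec3_entry mulmx3_vec3 dot3.
by case: (csub A c) => *; rewrite /dxx /dxy /dxz /dyy /dyz /dzz /=; ring.
Qed.

End Closed2.

(** * Flexes and lines over a real closed field *)

Lemma sflex_map (F G : numFieldType) (f : {rmorphism F -> G}) (c : cubic F)
    (v : 'cV[F]_3) :
  sflex (map_cubic f c) (map_mx f v) <-> sflex c v.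
Proof.
have hE : hess (map_cubic f c) (map_mx f v) = map_mx f (hess c v).
  apply/matrixP=> i j; rewrite [RHS]mxE /hess; case: c => *.
  by elim/forall3: i; elim/forall3: j;
    rewrite !mx3_entry !mxE /dxx /dxy /dxz /dyy /dyz /dzz /=;
    rewrite !rmorphD !rmorphM !rmorph_nat.
rewrite /sflex hE map_trmx -!map_mxM det_map_mx map_mx_eq0.
split=> -[e d n]; split=> //.
- by apply/eqP; rewrite -(map_mx_eq0 f); apply/eqP.
- by apply/eqP; rewrite -(fmorph_eq0 f); apply/eqP.
- by rewrite e map_mx0.
- by rewrite d rmorph0.
Qed.

Section RealComplex.
Context {R : rcfType}.
Local Notation j := (real_complex R).
Implicit Types (c : cubic R) (v : 'cV[R]_3).

(** The complex flexes are odd in number and conjugation permutes them, hence it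
    fixes one of them as a point of the projective plane. Division by a nonzero
    coordinate makes this point real. *)
Lemma real_flex c (v : 'cV[R[i]]_3) : sflex (map_cubic j c) v ->
  ~ has_line (map_cubic j c) -> exists w, sflex c w.
Proof.
set D := map_cubic j c => Dv nD.
have [M [k [a [b [Mu k0 ME]]]]] := weierstrass_form Dv nD.
have DM w : sflex D (M *m w) <-> sflex (wcubic a b) w.
  by rewrite -(sflex_csub D w Mu) ME sflex_cscale.
have conjD w : sflex D w -> sflex D (map_mx conjc w).
  have {2}-> : D = map_cubic conjc D.
    by rewrite /D; case: (c) => *; rewrite /map_cubic !conjc_real.
  by rewrite sflex_map.
have [L [Lu Lodd LP]] := wcubic_flexes a b.
(* conjugation, read in the Weierstrass coordinates *)
have /boolp.choice[t tP] o : exists o', o \in L -> o' \in L /\ exists2 k, k != 0 &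
    map_mx conjc (M *m wpt o) = k *: (M *m wpt o').
  have [|oL] := boolP (o \in L); last by exists o.
  rewrite LP => /asboolP /DM /conjD; set Q := map_mx _ _ => DQ.
  have : sflex D (M *m (invmx M *m Q)) by rewrite mulKVmx.
  move=> /DM/sflex_wcubic_wpt[l [ o' [l0 QE o'P]]].
  exists o'; rewrite LP; split; first exact/asboolP.
  by exists l; rewrite // scalemxAr -QE mulKVmx.
have tt : {in L, forall o, t o \in L /\ t (t o) = o}.
  move=> o oL; have [toL [l l0 lE]] := tP o oL; split=> //.
  have [_ [m m0 mE]] := tP _ toL.
  have : map_mx conjc (map_mx conjc (M *m wpt o)) = (conjc l * m) *: (M *m wpt (t (t o))).
    by rewrite lE map_mxZ mE scalerA.
  have -> : map_mx conjc (map_mx conjc (M *m wpt o)) = 1 *: (M *m wpt o).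
    by rewrite scale1r -map_mx_comp map_mx_id // => x; exact: conjcK.
  rewrite !scalemxAr => /(congr1 (mulmx (invmx M))); rewrite !mulKmx //.
  move=> e; apply/esym; apply: wpt_inj e; first exact: oner_neq0.
  by rewrite mulf_neq0 // conjc_eq0.
have : has (fun o => t o == o) L.
  rewrite has_count; move: Lodd; rewrite (odd_involution Lu tt).
  by case: count.
case/hasP=> o oL /eqP to; have [_ [l l0]] := tP o oL; rewrite to.
have : sflex D (M *m wpt o) by apply/DM/asboolP; rewrite -LP.
move: (M *m wpt o) => Q DQ QE.
have Q0 : Q != 0 by case: DQ => _ _; apply: contra_neq => ->; rewrite mulmx0.
have [i Qi] : exists i, Q i 0 != 0.
  apply: contrapT => nQ; case/eqP: Q0; apply/colP=> i; rewrite mxE.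
  by apply/eqP; apply: contra_notT nQ => h; exists i.
have conjQ r : conjc (Q r 0) = l * Q r 0 by have /colP/(_ r) := QE; rewrite !mxE.
exists (\col_r complex.Re (Q r 0 / Q i 0)); rewrite -(sflex_map j).
have -> : map_mx j (\col_r complex.Re (Q r 0 / Q i 0)) = (Q i 0)^-1 *: Q.
  apply/colP=> r; rewrite !mxE [RHS]mulrC.
  have : conjc (Q r 0 / Q i 0) = Q r 0 / Q i 0.
    by rewrite rmorphM fmorphV /= !conjQ invfM mulrACA mulfV // mul1r.
  case: (Q r 0 / Q i 0) => x y /eqP; rewrite eq_complex /= eqxx /=.
  by rewrite eq_sym -subr_eq0 opprK -mulr2n mulrn_eq0 /= => /eqP ->.
by rewrite sflex_scale // invr_eq0.
Qed.

(** The equations say that the cross product of u and w is zero. *)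
Lemma dependent_rows (u w : 'rV[R]_3) : w != 0 ->
  u 0 1 * w 0 2 = u 0 2 * w 0 1 -> u 0 2 * w 0 0 = u 0 0 * w 0 2 ->
  u 0 0 * w 0 1 = u 0 1 * w 0 0 -> exists s, u = s *: w.
Proof.
move=> w0 e0 e1 e2; have [i wi] : exists i, w 0 i != 0.
  apply: contrapT => nw; case/eqP: w0; apply/rowP=> i; rewrite mxE.
  by apply/eqP; apply: contra_notT nw => h; exists i.
exists (u 0 i / w 0 i); apply/rowP=> k; rewrite mxE.
apply: (mulIf wi); rewrite mulrAC divfK //.
by move: wi e0 e1 e2; elim/forall3: i => _ e0 e1 e2; elim/forall3: k => //;
  rewrite 1?mulrC // -?e0 -?e1 -?e2 // mulrC.
Qed.

Lemma ev_map c v : ev (map_cubic j c) (map_mx j v) = j (ev c v).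
Proof.
rewrite /ev !mxE; case: c => * /=.
by rewrite -!(rmorphXn, rmorphM, rmorphD).
Qed.

Lemma qform_sum (m x y z : R) (Q : 'M[R]_3) : Q^T = Q ->
  ((vec3 x y z)^T *m Q *m vec3 x y z) 0 0 =
  Q 0 0 * x ^+ 2 + 2 * Q 0 1 * x * y + 2 * Q 0 2 * x * z + Q 1 1 * y ^+ 2
    + 2 * Q 1 2 * y * z + Q 2 2 * z ^+ 2.
Proof.
move=> Qs; have s r t : Q t r = Q r t by rewrite -[in LHS]Qs mxE.
rewrite [Q]mx3E -mulmxA mulmx3_vec3 dot3 !mx3_entry (s 0 1) (s 0 2) (s 1 2).
ring.
Qed.

(** Let u + i v be a complex line on the curve. If the real forms u and v are
    proportional, the line is real up to a factor. If not, they may serve as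
    coordinates x and y; then the real cubic, being divisible by x + i y, is the
    product of x^2 + y^2 and a real linear form. *)
Lemma real_line c : has_line (map_cubic j c) -> has_line c.
Proof.
case=> n [Q [n0 Qs nQ]].
pose rn := map_mx (@complex.Re R) n; pose im := map_mx (@complex.Im R) n.
pose P1 := map_mx (@complex.Re R) Q; pose P2 := map_mx (@complex.Im R) Q.
have P1s : P1^T = P1 by rewrite /P1 map_trmx Qs.
have P2s : P2^T = P2 by rewrite /P2 map_trmx Qs.
have nE : n = map_mx j rn + 'i%C *: map_mx j im.
  by apply/matrixP=> r t; rewrite !mxE; exact: complexE.
have QE : Q = map_mx j P1 + 'i%C *: map_mx j P2.
  by apply/matrixP=> r t; rewrite !mxE; exact: complexE.
clearbody rn im P1 P2.
pose l (m : 'rV_3) v := (m *m v) 0 0; pose q (P : 'M[_]_3) v := (v^T *m P *m v) 0 0.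
have mapE (X Y : 'M[R]_1) :
    (map_mx j X + 'i%C *: map_mx j Y) 0 0 = Complex (X 0 0) (Y 0 0).
  by rewrite !mxE [RHS]complexE.
have split_ev v : ev c v = l rn v * q P1 v - l im v * q P2 v /\
    l rn v * q P2 v + l im v * q P1 v = 0.
  have := nQ (map_mx j v); rewrite ev_map.
  have -> : (n *m map_mx j v) 0 0 = Complex (l rn v) (l im v).
    by rewrite nE mulmxDl -scalemxAl -!map_mxM mapE.
  have -> : ((map_mx j v)^T *m Q *m map_mx j v) 0 0 = Complex (q P1 v) (q P2 v).
    by rewrite QE mulmxDr mulmxDl -scalemxAr -scalemxAl map_trmx -!map_mxM mapE.
  by move=> -[-> /esym].
have line_im m : has_line c \/ rn != m *: im.
  have [rE|] := eqVneq rn (m *: im); [left|by right].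
  have [im0|im0] := eqVneq im 0.
    by case/eqP: n0; rewrite nE rE im0 !map_mx0 scaler0 map_mx0 scaler0 addr0.
  exists im, (m *: P1 - P2); split=> //.
    by rewrite linearB linearZ /= P1s P2s.
  move=> v; have [-> _] := split_ev v; rewrite rE /l /q.
  rewrite mulmxBr mulmxBl -scalemxAr -!scalemxAl !mxE.
  ring.
have [im0|im0] := eqVneq im 0.
  exists rn, P1; split=> // [|v].
    by apply: contraNneq n0 => rn0; rewrite nE rn0 im0 !map_mx0 scaler0 addr0.
  have l0 : l im v = 0 by rewrite /l im0 mul0mx mxE.
  by have [-> _] := split_ev v; rewrite l0 mul0r subr0.
pose k0 := rn 0 1 * im 0 2 - rn 0 2 * im 0 1.
pose k1 := rn 0 2 * im 0 0 - rn 0 0 * im 0 2.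
pose k2 := rn 0 0 * im 0 1 - rn 0 1 * im 0 0.
pose N := mx3 (rn 0 0) (rn 0 1) (rn 0 2) (im 0 0) (im 0 1) (im 0 2) k0 k1 k2.
have [Nu|] := boolP (N \in unitmx); last first.
  rewrite mx3_unit (_ : _ - _ + _ = k0 ^+ 2 + k1 ^+ 2 + k2 ^+ 2); last first.
    by rewrite /k0 /k1 /k2; ring.
  rewrite negbK !paddr_eq0 ?addr_ge0 ?sqr_ge0 // !expf_eq0 /= !subr_eq0.
  case/andP=> [/andP[/eqP e0 /eqP e1] /eqP e2].
  have [m rE] := dependent_rows im0 e0 e1 e2.
  by have [//|] := line_im m; rewrite rE eqxx.
apply: (@has_line_csub _ (invmx N)); first by rewrite unitmx_inv.
set d := csub _ c.
pose T (P : 'M[_]_3) := (invmx N)^T *m P *m invmx N.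
have Ts P : P^T = P -> (T P)^T = T P by move=> Ps; rewrite /T !trmx_mul trmxK Ps mulmxA.
have dE x y z : ev d (vec3 x y z) = x * q (T P1) (vec3 x y z) - y * q (T P2) (vec3 x y z) /\
    x * q (T P2) (vec3 x y z) + y * q (T P1) (vec3 x y z) = 0.
  have qT P : q (T P) (vec3 x y z) = q P (invmx N *m vec3 x y z).
    by rewrite /q /T trmx_mul !mulmxA.
  have NK : N *m (invmx N *m vec3 x y z) = vec3 x y z by rewrite mulKVmx.
  have lx : l rn (invmx N *m vec3 x y z) = x.
    move: (invmx N *m _) NK => w /colP/(_ 0).
    by rewrite vec3_entry mxE sum3 /N !mx3_entry /l mxE sum3.
  have ly : l im (invmx N *m vec3 x y z) = y.
    move: (invmx N *m _) NK => w /colP/(_ 1).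
    by rewrite vec3_entry mxE sum3 /N !mx3_entry /l mxE sum3.
  by rewrite ev_csub !qT; have := split_ev (invmx N *m vec3 x y z); rewrite lx ly.
move: (T P1) (T P2) (Ts _ P1s) (Ts _ P2s) dE => S1 S2 S1s S2s dE.
have : Cubic (S2 0 0) (2 * S2 0 1 + S1 0 0) (2 * S2 0 2) (S2 1 1 + 2 * S1 0 1)
   (2 * S2 1 2 + 2 * S1 0 2) (S2 2 2) (S1 1 1) (2 * S1 1 2) (S1 2 2) 0 =
   Cubic 0 0 0 0 0 0 0 0 0 0.
  apply: ev_eq0 => v; rewrite [v]vec3E; move: (v 0 0) (v 1 0) (v 2 0) => x y z.
  rewrite -[RHS](dE x y z).2 ev_vec3 /q !qform_sum //=; ring.
case=> h1 h2 h3 h4 h5 h6 h7 h8 h9.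
have {}dE x y z : ev d (vec3 x y z) =
    (x ^+ 2 + y ^+ 2) * (S1 0 0 * x + 2 * S1 0 1 * y + 2 * S1 0 2 * z).
  have two : (2 : R) != 0 by rewrite pnatr_eq0.
  have [-> _] := dE x y z; rewrite /q !qform_sum // h1 h6 h7 h9.
  have -> : S1 0 0 = - (2 * S2 0 1) by apply: (lin_eq h2 (oner_neq0 R)); ring.
  have -> : S1 0 2 = - S2 1 2 by apply: (lin_eq h5 two); ring.
  have -> : S2 1 1 = - (2 * S1 0 1) by apply: (lin_eq h4 (oner_neq0 R)); ring.
  have -> : S1 1 2 = 0 by apply: (lin_eq h8 two); ring.
  have -> : S2 0 2 = 0 by apply: (lin_eq h3 two); ring.
  ring.
pose m := (vec3 (S1 0 0) (2 * S1 0 1) (2 * S1 0 2))^T.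
have [m0|m0] := eqVneq m 0.
  have -> : d = Cubic 0 0 0 0 0 0 0 0 0 0; last exact: has_line_z.
  apply: ev_eq0 => v; rewrite [v]vec3E dE.
  have := congr1 trmx m0; rewrite trmxK trmx0 => /colP e.
  have := (e 0, e 1, e 2); rewrite !vec3_entry !mxE => -[[-> ->] ->].
  ring.
exists m, (mx3 1 0 0 0 1 0 0 0 0); split; rewrite ?trmx3 // => v.
rewrite [v]vec3E dE dot3 -mulmxA mulmx3_vec3 dot3.
ring.
Qed.

End RealComplex.

(** * Forms of degree three *)

Definition mon (i j k : nat) : multinom 3 := Multinom [tuple i; j; k].

Definition monomials d : seq (multinom 3) :=
  [seq mon i j (d - i - j) | i <- iota 0 d.+1, j <- iota 0 (d - i).+1].

Lemma mon_entry i j k :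
  (mon i j k 0 = i) * (mon i j k 1 = j) * (mon i j k 2 = k).
Proof. by rewrite !multinomE. Qed.

Lemma sum3n (f : 'I_3 -> nat) : (\sum_i f i)%N = (f 0%R + f 1%R + f 2%R)%N.
Proof. exact: sum3. Qed.

Lemma prod3 (F : comNzRingType) (f : 'I_3 -> F) : \prod_i f i = f 0 * f 1 * f 2.
Proof.
rewrite !big_ord_recr big_ord0 /= mul1r.
by congr (f _ * f _ * f _); apply: val_inj.
Qed.

Lemma mem_monomials d m : mdeg m = d -> m \in monomials d.
Proof.
move=> md; rewrite mdegE sum3n in md; apply/allpairsPdep.
exists (m 0), (m 1); rewrite !mem_iota !add0n !ltnS /=; split.
- by rewrite -md -addnA leq_addr.
- by rewrite -md -addnA addKn leq_addr.
apply/mnmP; elim/forall3; rewrite !mon_entry //.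
by rewrite -md -addnA addKn addKn.
Qed.

Lemma monomials_uniq d : uniq (monomials d).
Proof.
apply: allpairs_uniq_dep; first exact: iota_uniq.
  by move=> i _; exact: iota_uniq.
move=> [i j] [i' j'] _ _ /= e.
have := congr1 (fun m : multinom 3 => (m 0, m 1)) e.
by rewrite !mon_entry => -[-> ->].
Qed.

Section Mpoly.
Context {F : numFieldType}.
Implicit Types (p q : mpoly 3 F) (v : 'I_3 -> F).

Lemma meval_homog d p v : p \is ishomog1 d mdeg ->
  meval v p = \sum_(m <- monomials d) mcoeff m p * (v 0 ^+ m 0 * v 1 ^+ m 1 * v 2 ^+ m 2).
Proof.
move=> /dhomogP hp; rewrite mevalE.
under eq_bigr do rewrite prod3.
rewrite [RHS](bigID (mem (msupp p))) /= [X in _ = _ + X]big1 ?addr0; last first.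
  by move=> m mp; rewrite memN_msupp_eq0 // mul0r.
rewrite -[RHS]big_filter; apply: perm_big; apply: uniq_perm.
- exact: msupp_uniq.
- by rewrite filter_uniq // monomials_uniq.
move=> m; rewrite mem_filter andb_idr // => mp.
by apply: mem_monomials; exact: hp.
Qed.

Definition coeffs p : cubic F := Cubic
  (mcoeff (mon 3 0 0) p) (mcoeff (mon 2 1 0) p) (mcoeff (mon 2 0 1) p)
  (mcoeff (mon 1 2 0) p) (mcoeff (mon 1 1 1) p) (mcoeff (mon 1 0 2) p)
  (mcoeff (mon 0 3 0) p) (mcoeff (mon 0 2 1) p) (mcoeff (mon 0 1 2) p)
  (mcoeff (mon 0 0 3) p).

Lemma meval_coeffs p (v : 'cV[F]_3) : p \is ishomog1 3 mdeg ->
  meval (v^~ 0) p = ev (coeffs p) v.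
Proof.
move=> hp; rewrite (meval_homog _ hp) /monomials /= !big_cons big_nil !mon_entry.
rewrite /ev /coeffs /=.
move: (mcoeff (mon 3 0 0) p) (mcoeff (mon 2 1 0) p) (mcoeff (mon 2 0 1) p).
move: (mcoeff (mon 1 2 0) p) (mcoeff (mon 1 1 1) p) (mcoeff (mon 1 0 2) p).
move: (mcoeff (mon 0 3 0) p) (mcoeff (mon 0 2 1) p) (mcoeff (mon 0 1 2) p).
by move: (mcoeff (mon 0 0 3) p) (v 0 0) (v 1 0) (v 2 0) => *; ring.
Qed.

Lemma coeffs_inj p q : p \is ishomog1 3 mdeg -> q \is ishomog1 3 mdeg ->
  coeffs p = coeffs q -> p = q.
Proof.
move=> hp hq [e0 e1 e2 e3 e4 e5 e6 e7 e8 e9]; apply/mpolyP=> m.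
have [md|md] := eqVneq (mdeg m) 3; last first.
  by rewrite (dhomog_nemf_coeff hp md) (dhomog_nemf_coeff hq md).
by have := mem_monomials md; rewrite /monomials /= !inE;
  do ![case/orP => [/eqP -> //|]]; move/eqP => ->.
Qed.

Lemma coeffs_mlin (A : 'M[F]_3) p : p \is ishomog1 3 mdeg ->
  coeffs (mlin A p) = csub A (coeffs p).
Proof.
move=> hp; apply: ev_inj => v.
rewrite ev_csub -!meval_coeffs ?mlin_homog // /mlin comp_mpoly_meval.
apply: meval_eq => i; rewrite tnth_mktuple mxE raddf_sum; apply: eq_bigr => j _.
by rewrite /= mevalZ /mvar mevalXU.
Qed.

Lemma coeffsZ k p : coeffs (k *: p) = cscale k (coeffs p).
Proof. by rewrite /coeffs !mcoeffZ. Qed.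

Lemma coeffs_weierstrass a b : coeffs (weierstrass_poly a b) = wcubic a b.
Proof.
apply: ev_inj => v; rewrite -meval_coeffs ?weierstrass_homog //.
rewrite /weierstrass_poly !(mevalB, mevalD, mevalZ, mevalM, rmorphXn, mevalXU) /=.
rewrite /ev /=; ring.
Qed.

(** As p is homogeneous, it is the product of the components of highest degree of its
    factors. *)
Lemma factor_line p q r : p \is ishomog1 3 mdeg -> p = q * r ->
  msize q = 2 -> msize r = 3 -> p != 0 -> has_line (coeffs p).
Proof.
move=> hp pE sq sr p0.
pose H d (u : mpoly 3 F) := pihomog mdeg d u.
have hH d u : H d u \is ishomog1 d mdeg by exact: pihomogP.
have top : p = H 1%N q * H 2%N r.
  have pos d e u w (n := (d + e)%N) : H 3 (H d u * H e w) = if n == 3 then H d u * H e w else 0.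
    have huw : H d u * H e w \is ishomog1 n mdeg by apply: dhomogM; exact: hH.
    case: eqVneq => n3; first by rewrite /H pihomog_dE // -n3.
    by apply: pihomog_ne0 huw.
  have qE : q = H 0 q + H 1%N q.
    rewrite {1}(@pihomog_partitionE _ _ mdeg 2 q) ?sq //.
    by rewrite !big_ord_recr big_ord0 /= add0r.
  have rE : r = H 0 r + H 1%N r + H 2%N r.
    rewrite {1}(@pihomog_partitionE _ _ mdeg 3 r) ?sr //.
    by rewrite !big_ord_recr big_ord0 /= add0r.
  rewrite -[LHS](pihomog_dE hp) {1}pE {1}qE {1}rE !(mulrDl, mulrDr) !pihomogD.
  by rewrite -!/(H _ _) !pos /= !(addr0, add0r).
have := (hH 1%N q, hH 2%N r); move: (H _ q) (H _ r) top => l s top [hl hs].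
pose n : 'rV[F]_3 :=
  (vec3 (mcoeff (mon 1 0 0) l) (mcoeff (mon 0 1 0) l) (mcoeff (mon 0 0 1) l))^T.
pose e i j k := mcoeff (mon i j k) s.
pose h i j k := e i j k / 2.
pose Q := mx3 (e 2 0 0)%N (h 1 1 0)%N (h 1 0 1)%N (h 1 1 0)%N (e 0 2 0)%N (h 0 1 1)%N
   (h 1 0 1)%N (h 0 1 1)%N (e 0 0 2)%N.
have lE (v : 'cV[F]_3) : meval (v^~ 0) l = (n *m v) 0 0.
  rewrite (meval_homog _ hl) /monomials /= !big_cons big_nil !mon_entry.
  by rewrite [v in RHS]vec3E /n dot3; ring.
have sE (v : 'cV[F]_3) : meval (v^~ 0) s = (v^T *m Q *m v) 0 0.
  rewrite (meval_homog _ hs) /monomials /= !big_cons big_nil !mon_entry.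
  rewrite [v in RHS]vec3E -mulmxA /Q mulmx3_vec3 dot3 /h /e.
  move: (v 0 0) (v 1 0) (v 2 0) (mcoeff (mon 2 0 0) s) (mcoeff (mon 1 1 0) s) (mcoeff (mon 1 0 1) s).
  move: (mcoeff (mon 0 2 0) s) (mcoeff (mon 0 1 1) s) (mcoeff (mon 0 0 2) s).
  by move=> *; field.
exists n, Q; split.
- apply: contra_neq p0 => n0; have {}n0 : n^T = 0 by rewrite n0 trmx0.
  rewrite trmxK in n0; have := (congr1 (fun u : 'cV[F]_3 => (u 0 0, u 1 0, u 2 0)) n0).
  rewrite !vec3_entry !mxE => -[l0 l1 l2].
  apply: (coeffs_inj hp); first exact: rpred0.
  apply: ev_inj => v; rewrite -!meval_coeffs ?rpred0 // top mevalM meval0 lE.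
  by rewrite /n l0 l1 l2 [v]vec3E dot3; ring.
- by rewrite /Q trmx3.
by move=> v; rewrite -meval_coeffs // top mevalM lE sE.
Qed.

(** A proper factorisation has factors of degrees one and two. *)
Lemma irreducible_noline p : p \is ishomog1 3 mdeg -> p != 0 ->
  ~ has_line (coeffs p) -> irreducible_form p.
Proof.
move=> hp p0 np; split=> //; first by exists 3%N.
- apply/negP; rewrite unfold_in => /andP[/eqP pE _].
  have p00 : p \is ishomog1 0 mdeg.
    apply/dhomogP=> m; rewrite pE msuppC; case: ifP => // _.
    by rewrite inE => /eqP ->; exact: mdeg0.
  by have := dhomog_uniq p0 hp p00.
move=> q r pE.
have [q0 r0] : q != 0 /\ r != 0.
  by apply/andP; move: p0; rewrite pE mulf_eq0 negb_or.
have unit1 (u : mpoly 3 F) : u != 0 -> msize u = 1%N -> u \is a GRing.unit.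
  move=> u0 su; have uE := msize1_polyC (eq_leq su).
  pose k : F := mcoeff mnm0 u.
  have k0 : k != 0 by apply: contra_neq u0 => e; rewrite uE -/k e mpolyC0.
  have ku : k \is a GRing.unit by rewrite unitfE.
  by rewrite unfold_in; apply/andP; split; first rewrite {1}uE.
have sp : (msize q + msize r)%N = 5.
  have := msizeM q0 r0; rewrite -pE -(mlead_deg p0).
  rewrite (dhomog_mf hp (mlead_supp p0)).
  by case: (msize q + msize r)%N => // n /= <-.
have [q1|qn1] := eqVneq (msize q) 1%N; first by left; exact: unit1.
have [r1|rn1] := eqVneq (msize r) 1%N; first by right; exact: unit1.
case: np; have qpos : (0 < msize q)%N by rewrite lt0n msize_poly_eq0.
have rpos : (0 < msize r)%N by rewrite lt0n msize_poly_eq0.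
have [[sq sr]|[sq sr]] : (msize q = 2 /\ msize r = 3) \/ (msize q = 3 /\ msize r = 2).
  move: (msize q) (msize r) sp qn1 rn1 qpos rpos.
  by move=> *; lia.
- exact: factor_line hp pE sq sr p0.
- by apply: factor_line hp _ sr sq p0; rewrite mulrC.
Qed.

End Mpoly.

Local Open Scope classical_set_scope.
Local Open Scope ring_scope.
Local Open Scope quotient_scope.

(** * Stabilizers in the projective linear group *)

Section Orbits.
Context {F : numFieldType}.
Implicit Types (c : cubic F) (A B : 'M[F]_3) (k : F).
Local Notation form := (nonzero (form_space (F := F) 3)).
Implicit Types (p q : form).

Definition form_cubic p : cubic F := coeffs (form_poly p).

Lemma form_cubic_inj p q k : form_cubic q = cscale k (form_cubic p) ->
  form_poly q = k *: form_poly p.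
Proof.
move=> e; apply: coeffs_inj; rewrite ?rpredZ ?form_homog //.
by rewrite coeffsZ.
Qed.

Lemma cycle_eqP p q : \pi_(one_cycle F 3) p = \pi_(one_cycle F 3) q <->
  exists2 k, k != 0 & form_cubic q = cscale k (form_cubic p).
Proof.
rewrite one_cycleP; split=> -[k k0 e]; exists k => //.
  by rewrite /form_cubic e coeffsZ.
exact: form_cubic_inj.
Qed.

Lemma form_cubic_act (g : GL3) p :
  form_cubic (form_act g p) = csub (invmx (\val g)) (form_cubic p).
Proof. by rewrite /form_cubic coeffs_mlin // form_homog. Qed.

(** The identity stands in for singular matrices. *)
Definition mkGL A : GL3 :=
  if pselect (A \in unitmx) is left Au then exist _ A (mem_set Au) else GL3_one.

Lemma mkGLE A : A \in unitmx -> \val (mkGL A) = A.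
Proof. by rewrite /mkGL => Au; case: pselect. Qed.

Lemma act_pi (g : GL3) p q : pgl_act (\pi_PGL3 g) (\pi_(one_cycle F 3) p) =
    \pi_(one_cycle F 3) q <->
  exists2 k, k != 0 & form_cubic q = cscale k (csub (invmx (\val g)) (form_cubic p)).
Proof. by rewrite pgl_act_pi cycle_eqP form_cubic_act. Qed.

Lemma stabilizerP (g : GL3) p : stabilizer (\pi_(one_cycle F 3) p) (\pi_PGL3 g) <->
  exists2 k, k != 0 & csub (\val g) (form_cubic p) = cscale k (form_cubic p).
Proof.
have gu := GL3_unit g; rewrite /stabilizer /= act_pi; split=> -[k k0 e].
  exists k => //; transitivity (csub (\val g)
      (cscale k (csub (invmx (\val g)) (form_cubic p)))); first by rewrite -e.
  by rewrite csub_cscale csubVK.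
exists k => //; rewrite (csubV_eq gu k0 e) cscaleM mulfV //.
by rewrite cscale1.
Qed.

Lemma PGL_eqP (g h : GL3) : \pi_PGL3 g = \pi_PGL3 h :> @PGL3 F <->
  exists2 k, k != 0 & \val h = k *: \val g.
Proof. exact: mod_scalarsP. Qed.

(** Natural numbers outside of the finite exceptional list yield pairwise distinct
    elements of the stabilizer. *)
Lemma large_infinite p : large_stabilizer (form_cubic p) ->
  ~ finite_set (stabilizer (\pi_(one_cycle F 3) p)).
Proof.
case=> f [s [fu fs finj]] fin.
have nat_inj : injective (fun n : nat => n%:R : F).
  by move=> m n /eqP; rewrite eqr_nat => /eqP.
pose h (n : nat) : @PGL3 F := \pi_PGL3 (mkGL (f n%:R)).
apply: infinite_nat.
apply: (@sub_finite_set _ _ ([set n : nat | n%:R \in s] `|`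
    [set n : nat | n%:R \notin s /\ stabilizer (\pi_(one_cycle F 3) p) (h n)])).
  move=> n _ /=; have [ns|ns] := boolP (n%:R \in s); [by left|right; split=> //].
  apply/stabilizerP; rewrite mkGLE ?fu //; exact: fs.
rewrite finite_setU; split.
  by apply: (finite_preimage _ (finite_seq s)) => m n _ _; exact: nat_inj.
pose h' (n : nat) := if n%:R \in s then None else Some (h n).
apply: (@sub_finite_set _ _ (h' @^-1` (Some @` stabilizer (\pi_(one_cycle F 3) p)))).
  by move=> n [ns hn]; exists (h n) => //; rewrite /h' (negbTE ns).
apply: finite_preimage; last exact: finite_image.
move=> m n; rewrite !inE /h' => -[hm _ mE] -[hn _ nE]; move: mE nE.
case: ifPn => // ms _; case: ifPn => // ns _ [] /PGL_eqP[k k0].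
by rewrite !mkGLE ?fu // => /(finj _ _ _ ns ms)/nat_inj.
Qed.

Lemma wcubic_finite p a b : (a != 0) || (b != 0) -> form_cubic p = wcubic a b ->
  finite_set (stabilizer (\pi_(one_cycle F 3) p)).
Proof.
move=> ab0 pE; have [G GP] := wcubic_stabilizer ab0.
apply: (@sub_finite_set _ _ ((fun A => \pi_PGL3 (mkGL A)) @` [set` G])); last first.
  by apply: finite_image; exact: finite_seq.
move=> g; rewrite -[g]reprK => /stabilizerP; rewrite pE => -[k k0 e].
have [A [m [AG m0 gE]]] := GP _ _ (GL3_unit _) k0 e.
exists A => //; apply/PGL_eqP; exists m => //.
rewrite mkGLE //; have := GL3_unit (generic_quotient.repr g); rewrite gE unitmxZ //.
by rewrite unitfE.
Qed.

End Orbits.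

(** * The classification of cubics with finite stabilizer *)

(** The one property of the ground field that the classification rests on. *)
Definition flexible (F : numFieldType) :=
  forall c : cubic F, ~ has_line c -> exists v, sflex c v.

Section Moduli.
Context {F : numFieldType}.
Context (flexF : flexible F).
Implicit Types (c : cubic F) (A B : 'M[F]_3) (k a b : F).
Local Notation form := (nonzero (form_space (F := F) 3)).
Implicit Types (p q : form).

Lemma large_csub A k c d : A \in unitmx -> k != 0 -> csub A c = cscale k d ->
  large_stabilizer d -> large_stabilizer c.
Proof.
move=> Au k0 AE [f [s [fu fs finj]]].
exists (fun r => A *m f r *m invmx A), s; split=> [r rs|r rs|r t m rs ts e].
- by rewrite !unitmx_mul Au fu //= unitmx_inv.
- have [l l0 fE] := fs r rs; exists l => //.
  rewrite !csubM AE csub_cscale fE cscaleM mulrC -cscaleM -AE csub_cscale csubK //.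
apply: (finj r t m rs ts).
have := congr1 (fun B => invmx A *m B *m A) e.
by rewrite -scalemxAr -scalemxAl -!mulmxA !mulVmx // !mulmx1 !mulKmx.
Qed.

Lemma fs_noline p : fs_cycles F 3 (\pi_(one_cycle F 3) p) -> ~ has_line (form_cubic p).
Proof. by move=> fs /line_large_stabilizer/large_infinite. Qed.

(** A linear factor, as well as the cusp a = b = 0, would make the stabilizer infinite. *)
Lemma fs_normal_form p : fs_cycles F 3 (\pi_(one_cycle F 3) p) -> exists A k a b,
  [/\ A \in unitmx, k != 0, (a != 0) || (b != 0) &
      csub A (form_cubic p) = cscale k (wcubic a b)].
Proof.
move=> fs; have nl := fs_noline fs; have [v pv] := flexF nl.
have [A [k [a [b [Au k0 AE]]]]] := weierstrass_form pv nl.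
exists A, k, a, b; split=> //; rewrite -negb_and.
apply/negP=> /andP[/eqP a0 /eqP b0]; rewrite a0 b0 in AE.
have := large_csub Au k0 AE (@cusp_large_stabilizer F).
by move/large_infinite; exact.
Qed.

Lemma fs_cycles_curves : fs_cycles F 3 = fs_curves F 3.
Proof.
apply/seteqP; split=> C; last by case.
move=> fs; split=> //; exists [:: form_poly (generic_quotient.repr C)]; split.
- move=> q; rewrite inE => /eqP ->; apply: irreducible_noline.
  + exact: form_homog.
  + exact: form_neq0.
  + by apply: fs_noline; rewrite reprK.
- by case=> [|i] [|j].
- by rewrite big_seq1; exact: proportional_refl.
Qed.

Lemma orbitI A k p q : A \in unitmx -> k != 0 ->
  csub A (form_cubic q) = cscale k (form_cubic p) ->
  exists g, pgl_act g (\pi_(one_cycle F 3) q) = \pi_(one_cycle F 3) p.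
Proof.
move=> Au k0 e; exists (\pi_PGL3 (mkGL (invmx A))).
apply/act_pi; exists k^-1; first by rewrite invr_eq0.
by rewrite mkGLE ?unitmx_inv // invmxK e cscaleM mulVf // cscale1.
Qed.

Definition invariants p : F * F := (inv4 (form_cubic p), inv6 (form_cubic p)).

(** The invariants recover the Weierstrass coefficients up to the weighted action. *)
Lemma invariants_csub p k a b A : csub A (form_cubic p) = cscale k (wcubic a b) ->
  A \in unitmx -> k != 0 ->
  exists2 t, t != 0 & invariants p = weighted_scale t (a, b).
Proof.
move=> e Au k0; have dA0 : \det A != 0 by rewrite -unitfE -unitmxE.
exists (k / \det A); first by rewrite mulf_neq0 ?invr_eq0.
have [e4 e6] := covariant_unit Au (form_cubic p).
rewrite e !(inv_cscale _ _).1 !(inv_cscale _ _).2 inv4_wcubic inv6_wcubic in e4 e6.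
rewrite /invariants /weighted_scale /=; congr pair.
- apply: (mulfI (expf_neq0 4 dA0)); rewrite -e4 expr_div_n mulrA.
  by rewrite [_ * (_ / _)]mulrC divfK // expf_neq0.
- apply: (mulfI (expf_neq0 6 dA0)); rewrite -e6 expr_div_n mulrA.
  by rewrite [_ * (_ / _)]mulrC divfK // expf_neq0.
Qed.

Lemma invariants_act (g : PGL3) p q :
  pgl_act g (\pi_(one_cycle F 3) p) = \pi_(one_cycle F 3) q ->
  exists2 t, t != 0 & invariants q = weighted_scale t (invariants p).
Proof.
rewrite -[g]reprK => /act_pi[k k0 e]; set h := \val _ in e.
have hu : invmx h \in unitmx by rewrite unitmx_inv GL3_unit.
have dh : \det (invmx h) != 0 by rewrite -unitfE -unitmxE.
exists (k * \det (invmx h)); first by rewrite mulf_neq0.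
have [c4 c6] := covariant_unit hu (form_cubic p).
have e4 : inv4 (form_cubic q) = (k * \det (invmx h)) ^+ 4 * inv4 (form_cubic p).
  by rewrite e (inv_cscale _ _).1 c4 exprMn mulrA.
have e6 : inv6 (form_cubic q) = (k * \det (invmx h)) ^+ 6 * inv6 (form_cubic p).
  by rewrite e (inv_cscale _ _).2 c6 exprMn mulrA.
by rewrite /invariants e4 e6.
Qed.

Lemma fs_invariants p : fs_cycles F 3 (\pi_(one_cycle F 3) p) ->
  punctured_plane F (invariants p).
Proof.
move=> /fs_normal_form[A [k [a [b [Au k0 ab0 e]]]]].
have [t t0 ->] := invariants_csub e Au k0.
have cancel n x : t ^+ n * x = 0 -> x = 0.
  by move/eqP; rewrite mulf_eq0 expf_eq0 (negbTE t0) andbF => /eqP.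
by apply/negP=> /eqP -[/cancel a0 /cancel b0]; rewrite a0 b0 eqxx in ab0.
Qed.

Definition weierstrass_form_of a b : form := mkform (weierstrass_homog a b) (weierstrass_neq0 a b).

Lemma form_cubic_weierstrass a b : form_cubic (weierstrass_form_of a b) = wcubic a b.
Proof. exact: coeffs_weierstrass. Qed.

Lemma punctured_neq0 (x : punctured_plane F) : ((\val x).1 != 0) || ((\val x).2 != 0).
Proof.
have := set_valP x; rewrite -negb_and; apply: contra => /andP[/eqP e1 /eqP e2].
by apply/eqP; rewrite [LHS]surjective_pairing e1 e2.
Qed.

Lemma weierstrass_fs_subproof (x : punctured_plane F) :
  fs_cycles F 3 (weierstrass_cycle (\val x).1 (\val x).2).
Proof. exact: wcubic_finite (punctured_neq0 x) (form_cubic_weierstrass _ _). Qed.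

Definition weierstrass_fs (x : punctured_plane F) : fs_cycles F 3 :=
  exist _ (weierstrass_cycle (\val x).1 (\val x).2) (mem_set (weierstrass_fs_subproof x)).

Definition weierstrass_class (x : punctured_plane F) : moduli F 3 := \pi_(moduli F 3) (weierstrass_fs x).

Lemma repr_fs (C : fs_cycles F 3) :
  fs_cycles F 3 (\pi_(one_cycle F 3) (generic_quotient.repr (\val C))).
Proof. by rewrite reprK; exact: (set_valP C). Qed.

Definition inv_point (C : fs_cycles F 3) : punctured_plane F :=
  exist _ (invariants (generic_quotient.repr (\val C))) (mem_set (fs_invariants (repr_fs C))).

Definition weierstrass_map (w : weighted_quotient F) : moduli F 3 :=
  weierstrass_class (generic_quotient.repr w).

(** Independent of the chosen cycle and form by [inv_point_act]. *)
Definition invariant_map (M : moduli F 3) : weighted_quotient F :=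
  \pi_(weighted_quotient F) (inv_point (generic_quotient.repr M)).

Lemma wq_eqP (x y : punctured_plane F) :
  \pi_(weighted_quotient F) x = \pi_(weighted_quotient F) y <->
  exists2 t, t != 0 & \val y = weighted_scale t (\val x).
Proof.
pose Q := {eq_quot weighted_equiv F}.
suff : \pi_Q x = \pi_Q y <-> exists2 t, t != 0 & \val y = weighted_scale t (\val x) by [].
split=> [/eqP|h]; first by rewrite eqmodE => /asboolP.
by apply/eqP; rewrite eqmodE; apply/asboolP.
Qed.

Lemma moduli_eqP (C D : fs_cycles F 3) :
  \pi_(moduli F 3) C = \pi_(moduli F 3) D <-> exists g, pgl_act g (\val C) = \val D.
Proof.
pose Q := {eq_quot @orbit_equiv F 3}.
suff : \pi_Q C = \pi_Q D <-> exists g, pgl_act g (\val C) = \val D by [].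
split=> [/eqP|h]; first by rewrite eqmodE => /asboolP.
by apply/eqP; rewrite eqmodE; apply/asboolP.
Qed.

Lemma weierstrass_class_eq x y : \pi_(weighted_quotient F) x = \pi_(weighted_quotient F) y ->
  weierstrass_class x = weierstrass_class y.
Proof.
move=> /wq_eqP[t t0 e]; apply/esym/moduli_eqP; rewrite /= e /=.
apply: (@orbitI (mx3 (t ^+ 2) 0 0 0 (t ^+ 3) 0 0 0 1) (t ^+ 6)).
- by rewrite mx3_unit !(mul0r, mulr0, subr0, addr0, mulr1) mulf_neq0 ?expf_neq0.
- by rewrite expf_neq0.
rewrite !form_cubic_weierstrass /csub !mx3_entry /cscale /dxx /dxy /dxz /dyy /dyz /dzz /=.
by congr Cubic; ring.
Qed.

Lemma weierstrass_map_pi x : weierstrass_map (\pi_(weighted_quotient F) x) = weierstrass_class x.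
Proof. by apply: weierstrass_class_eq; rewrite reprK. Qed.

Lemma weierstrass_map_class x : is_weierstrass_class (\val x).1 (\val x).2
  (weierstrass_map (\pi_(weighted_quotient F) x)).
Proof. by rewrite weierstrass_map_pi; exists (weierstrass_fs x). Qed.

Lemma inv_point_act (C : fs_cycles F 3) (p : form) g :
  pgl_act g (\val C) = \pi_(one_cycle F 3) p ->
  exists2 t, t != 0 & invariants p = weighted_scale t (\val (inv_point C)).
Proof. by move=> e; apply: (@invariants_act g); rewrite reprK. Qed.

Lemma weierstrass_mapK : cancel weierstrass_map invariant_map.
Proof.
move=> w; rewrite -[w]reprK weierstrass_map_pi; set x := generic_quotient.repr w.
have /moduli_eqP[g gE] := reprK (weierstrass_class x).
apply/wq_eqP; have [t t0 e] := inv_point_act gE.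
exists t => //; rewrite -/(weierstrass_class x) -e /invariants form_cubic_weierstrass.
by rewrite inv4_wcubic inv6_wcubic -surjective_pairing.
Qed.

Lemma invariant_mapK : cancel invariant_map weierstrass_map.
Proof.
move=> M; rewrite weierstrass_map_pi -[in RHS](reprK M); set C := generic_quotient.repr M.
have [A [k [a [b [Au k0 ab0 e]]]]] := fs_normal_form (repr_fs C).
have [t t0 iE] := invariants_csub e Au k0.
have ab : punctured_plane F (a, b).
  by apply: contraTneq ab0 => -[-> ->]; rewrite eqxx.
pose x : punctured_plane F := exist _ (a, b) (mem_set ab).
have -> : weierstrass_class (inv_point C) = weierstrass_class x.
  by apply/esym/weierstrass_class_eq/wq_eqP; exists t.
apply/esym/moduli_eqP; rewrite /= -[\val C]reprK.
by apply: orbitI Au k0 _; rewrite e form_cubic_weierstrass.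
Qed.

End Moduli.

(** * Continuity of the classification *)

(** A head constant over which [cts_tac] recurses along the shape of the function. *)
Definition cts {F : numFieldType} {X : topologicalType} (f : X -> F) : Prop :=
  continuous f.

Section ContinuousOperations.
Context {F : numFieldType} {X : topologicalType}.
Implicit Types f g : X -> F.

Lemma ctsD f g : cts f -> cts g -> cts (fun x => f x + g x).
Proof. by move=> cf cg x; apply: (@continuousD _ _ _ f g x (cf x) (cg x)). Qed.

Lemma ctsN f : cts f -> cts (fun x => - f x).
Proof. by move=> cf x; apply: (@continuousN _ _ _ f x (cf x)). Qed.

Lemma ctsM f g : cts f -> cts g -> cts (fun x => f x * g x).
Proof. by move=> cf cg x; apply: (@continuousM _ _ f g x (cf x) (cg x)). Qed.

Lemma cts_cst (k : F) : cts (fun _ : X => k).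
Proof. exact: cst_continuous. Qed.

Lemma ctsX f n : cts f -> cts (fun x => f x ^+ n).
Proof.
move=> cf; elim: n => [|n IH]; first exact: cts_cst.
have -> : (fun x => f x ^+ n.+1) = (fun x => f x * f x ^+ n).
  by apply/funext => x; rewrite exprS.
exact: ctsM.
Qed.

End ContinuousOperations.

Ltac cts_tac := lazymatch goal with
| |- cts (fun x => @GRing.add _ (@?f x) (@?g x)) => refine (@ctsD _ _ f g _ _); cts_tac
| |- cts (fun x => @GRing.opp _ (@?f x)) => refine (@ctsN _ _ f _); cts_tac
| |- cts (fun x => @GRing.mul _ (@?f x) (@?g x)) => refine (@ctsM _ _ f g _ _); cts_tac
| |- cts (fun x => @GRing.exp _ (@?f x) ?n) => refine (@ctsX _ _ f n _); cts_tac
| |- _ => first [assumption | exact: cts_cst | idtac]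
end.

Section Invariants.
Context {F : numFieldType} {X : topologicalType}.

Lemma inv_continuous (f0 f1 f2 f3 f4 f5 f6 f7 f8 f9 : X -> F) :
  cts f0 -> cts f1 -> cts f2 -> cts f3 -> cts f4 -> cts f5 -> cts f6 -> cts f7 ->
  cts f8 -> cts f9 -> let c := fun x => Cubic
    (f0 x) (f1 x) (f2 x) (f3 x) (f4 x) (f5 x) (f6 x) (f7 x) (f8 x) (f9 x) in
  cts (fun x => inv4 (c x)) /\ cts (fun x => inv6 (c x)).
Proof. by move=> *; rewrite /inv4 /inv6 /=; split; cts_tac. Qed.

End Invariants.

Section Moduli.
Context {F : numFieldType}.
Context (flexF : flexible F).
Local Notation form := (nonzero (form_space (F := F) 3)).

Lemma coefficient_continuous (m : multinom 3) :
  continuous (fun p : form => mcoeff m (form_poly p) : F).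
Proof.
have c1 : continuous (fun p : form => \val p) by exact: initial_continuous.
have c2 : continuous (@dhomog_coeffs 3 F 3) by exact: initial_continuous.
have c3 := @proj_continuous (multinom 3) (fun=> F) m.
move=> p; have c12 := continuous_comp (c1 p) (c2 _).
exact: (continuous_comp c12 (c3 _)).
Qed.

Lemma to_form_continuous (X : topologicalType) (f : X -> form) :
  (forall m : multinom 3, continuous (fun x => mcoeff m (form_poly (f x)) : F)) ->
  continuous f.
Proof.
move=> cf; apply: continuous_comp_initial; apply: continuous_comp_initial => x.
apply/cvg_sup => m.
pose w (g : multinom 3 -> F) := g m.
exact: (@continuous_comp_initial _ X F w (@dhomog_coeffs 3 F 3 \o (\val \o f)) (cf m) x).
Qed.

Lemma pair_continuous (X : topologicalType) (f : X -> F * F) :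
  continuous (fun x => (f x).1 : F) -> continuous (fun x => (f x).2 : F) ->
  continuous (f : X -> plane F).
Proof.
move=> c1 c2 x.
have -> : f = (fun x => ((f x).1, (f x).2)) by apply/funext => y; case: (f y).
exact: (cvg_pair (c1 x) (c2 x)).
Qed.

Lemma invariants_continuous :
  continuous (fun p : form => invariants p : plane F).
Proof.
pose cc := @coefficient_continuous.
have [c4 c6] := inv_continuous
  (cc (mon 3 0 0)) (cc (mon 2 1 0))
  (cc (mon 2 0 1)) (cc (mon 1 2 0))
  (cc (mon 1 1 1)) (cc (mon 1 0 2))
  (cc (mon 0 3 0)) (cc (mon 0 2 1))
  (cc (mon 0 1 2)) (cc (mon 0 0 3)).
by apply: pair_continuous; [exact: c4|exact: c6].
Qed.

Lemma punctured_continuous :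
  continuous (fun x : punctured_plane F => (\val x).1 : F) /\
  continuous (fun x : punctured_plane F => (\val x).2 : F).
Proof.
have cv : continuous (\val : punctured_plane F -> plane F) by exact: initial_continuous.
have c1 : continuous (fst : plane F -> F) by move=> y; exact: cvg_fst.
have c2 : continuous (snd : plane F -> F) by move=> y; exact: cvg_snd.
split=> x; first exact: (continuous_comp (cv x) (c1 _)).
exact: (continuous_comp (cv x) (c2 _)).
Qed.

Lemma weierstrass_map_continuous : continuous (weierstrass_map : weighted_quotient F -> moduli F 3).
Proof.
apply/quotient_continuous.
have -> : weierstrass_map \o \pi_(weighted_quotient F) = \pi_(moduli F 3) \o (@weierstrass_fs F).
  by apply/funext => x /=; rewrite weierstrass_map_pi.
move=> x; apply: continuous_comp; last exact: pi_continuous.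
move: x; apply: continuous_comp_initial.
have -> : \val \o (@weierstrass_fs F) = \pi_(one_cycle F 3) \o
    (fun x : punctured_plane F => weierstrass_form_of (\val x).1 (\val x).2) by [].
move=> x; apply: continuous_comp; last exact: pi_continuous.
move: x; apply: to_form_continuous => m.
have [c1 c2] := punctured_continuous.
rewrite /form_poly /= /weierstrass_poly.
under eq_fun do rewrite mcoeffB !mcoeffD !mcoeffZ.
suff : cts (fun x : punctured_plane F => mcoeff m (mvar 1 ^+ 2 * mvar 2) - (mcoeff m (mvar 0 ^+ 3) +
  (\val x).1 * mcoeff m (mvar 0 * mvar 2 ^+ 2) + (\val x).2 * mcoeff m (mvar 2 ^+ 3)) : F).
  by [].
have {}c1 : cts (fun x : punctured_plane F => (\val x).1) by exact: c1.
have {}c2 : cts (fun x : punctured_plane F => (\val x).2) by exact: c2.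
cts_tac.
Qed.

Lemma open_punctured : open (punctured_plane F : set (plane F)).
Proof.
have -> : punctured_plane F = (fst @^-1` [set~ (0 : F)]) `|` (snd @^-1` [set~ (0 : F)]).
  apply/seteqP; split=> -[a b].
    move=> ab0 /=; have [a0|/eqP] := eqVneq a 0; [right|by left].
    by move=> /= b0; move: ab0; rewrite a0 b0 /punctured_plane /nonzero /= eqxx.
  by case=> /= h; apply/eqP => -[a0 b0]; apply: h.
have o0 : open [set~ (0 : F)].
  by rewrite openC; apply: accessible_closed_set1; apply: hausdorff_accessible; exact: norm_hausdorff.
by apply: openU; apply: open_comp => // x _; [exact: cvg_fst|exact: cvg_snd].
Qed.

(** The invariants are continuous on the space of all forms, whereas the moduli space
    is a quotient of a subspace of a quotient of it. An open set of the weighted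
    quotient comes from a set W of the plane that is stable under weighted scaling
    and open, as it is open in the punctured plane. The forms with invariants in W
    then make up an open set that is saturated for scalars. *)
Lemma invariant_map_continuous : continuous (invariant_map flexF).
Proof.
apply/quotient_continuous.
have -> : invariant_map flexF \o \pi_(moduli F 3) = \pi_(weighted_quotient F) \o (inv_point flexF).
  apply/funext => C; apply/wq_eqP.
  have /moduli_eqP[g gE] := reprK (\pi_(moduli F 3) C).
  by apply: (@inv_point_act _ _ _ _ g); rewrite reprK.
apply/continuousP => U oU.
have [N oN NE] : open (\pi_(weighted_quotient F) @^-1` U) by exact: oU.
have NU (x : punctured_plane F) : N (\val x) <-> U (\pi_(weighted_quotient F) x).
  have e : (set_val @^-1` N) x = (\pi_(weighted_quotient F) @^-1` U) x by rewrite NE.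
  by have -> : N (\val x) = U (\pi_(weighted_quotient F) x) by exact: e.
pose W : set (plane F) := N `&` punctured_plane F.
have oW : open W by apply: openI => //; exact: open_punctured.
have Wscale t y : t != 0 -> W y -> W (weighted_scale t y).
  move=> t0 [Ny y0]; pose x : punctured_plane F := exist _ y (mem_set y0).
  have ty0 : punctured_plane F (weighted_scale t y).
    apply: contraNneq (y0) => e; have := weighted_scaleM t^-1 t y.
    by rewrite e mulVf // weighted_scale1 /weighted_scale !mulr0 => <-.
  split=> //; pose x' : punctured_plane F := exist _ (weighted_scale t y) (mem_set ty0).
  rewrite -[weighted_scale t y]/(\val x'); apply/NU.
  suff <- : \pi_(weighted_quotient F) x = \pi_(weighted_quotient F) x' by apply/NU.
  by apply/wq_eqP; exists t.
pose V : set (one_cycle F 3) := [set C | W (invariants (generic_quotient.repr C))].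
exists V.
  rewrite /open /= /quotient_open.
  have -> : \pi_(one_cycle F 3) @^-1` V = (fun p : form => invariants p : plane F) @^-1` W.
    apply/seteqP; split=> p; rewrite /V /=.
    - have e : pgl_act PGL3_one (\pi_(one_cycle F 3) (generic_quotient.repr (\pi_(one_cycle F 3) p))) =
          \pi_(one_cycle F 3) p by rewrite pgl_act1 reprK.
      by have [t t0 ->] := invariants_act e; exact: Wscale.
    - have e : pgl_act PGL3_one (\pi_(one_cycle F 3) p) =
          \pi_(one_cycle F 3) (generic_quotient.repr (\pi_(one_cycle F 3) p)).
        by rewrite pgl_act1 reprK.
      by have [t t0 ->] := invariants_act e; exact: Wscale.
  by move/continuousP: invariants_continuous; exact.
apply/seteqP; split=> C; rewrite /V /=.
  by move=> [NC _]; apply/NU.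
by move=> UC; split; [exact/(NU (inv_point flexF C))|exact: fs_invariants (repr_fs C)].
Qed.

End Moduli.

(** * The real moduli space is a circle *)

Lemma homeomorphism_comp (X Y Z : topologicalType) (f : X -> Y) (g : Y -> Z) :
  homeomorphism f -> homeomorphism g -> homeomorphism (g \o f).
Proof.
move=> [cf [f' [cf' fK f'K]]] [cg [g' [cg' gK g'K]]]; split.
  by move=> x; apply: continuous_comp; [exact: cf|exact: cg].
exists (f' \o g'); split.
- by move=> x; apply: continuous_comp; [exact: cg'|exact: cf'].
- by move=> x /=; rewrite gK fK.
- by move=> x /=; rewrite f'K g'K.
Qed.

Lemma ctsV (F : numFieldType) (X : topologicalType) (f : X -> F) :
  cts f -> (forall x, f x != 0) -> cts (fun x => (f x)^-1).
Proof. by move=> cf f0 x; exact: (@continuousV _ _ f x (f0 x) (cf x)). Qed.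

Section Circle.
Context {R : realType}.
Implicit Types (x y : punctured_plane R) (a b t u v : R).

Lemma cube_inj : injective (fun u : R => u ^+ 3).
Proof.
move=> u v /= e; have : (u - v) * (u ^+ 2 + u * v + v ^+ 2) = 0.
  by apply: (lin_eq e (oner_neq0 R)); ring.
move/eqP; rewrite mulf_eq0 subr_eq0 => /orP[/eqP//|/eqP q0].
have v0 : v = 0.
  apply/eqP; rewrite -sqrf_eq0 eq_le sqr_ge0 andbT.
  by have := sqr_ge0 (2 * u + v); nra.
move: q0; rewrite v0 mulr0 expr0n !addr0 => /eqP.
by rewrite expf_eq0 => /andP[_ /eqP].
Qed.

Lemma signed_square_inj : injective (fun u : R => u * `|u|).
Proof.
move=> u v /= e; have [u0|u0] := eqVneq u 0.
  move: e; rewrite u0 mul0r => /esym/eqP.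
  by rewrite mulf_eq0 normr_eq0 orbb => /eqP.
have en : `|u| = `|v|.
  apply/eqP; rewrite -(@eqrXn2 _ 2) // !expr2 -{1}[`|u|]normr_id -{1}[`|v|]normr_id.
  by rewrite -!normrM ![`| _ | * _]mulrC e.
by move: e; rewrite -en => /(mulIf _); apply; rewrite normr_eq0.
Qed.

(** Cubing is onto by the intermediate value theorem, and the inverse of a continuous
    injection of the line is continuous. *)
Lemma cube_root : exists r : R -> R, [/\ cancel (fun u => u ^+ 3) r,
  cancel r (fun u => u ^+ 3) & continuous r].
Proof.
have /boolp.choice[r rK] u : exists w, w ^+ 3 = u.
  pose p : {poly R} := 'X^3 - u%:P.
  have le : - (`|u| + 1) <= `|u| + 1 by have := normr_ge0 u; lra.
  have pE w : p.[w] = w ^+ 3 - u by rewrite /p !(hornerD, hornerN, hornerXn, hornerC).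
  have [|w _ /rootP] := @poly_ivt R p _ _ le.
    rewrite !pE; have [h0 [h1 h2]] := (normr_ge0 u, (ler_norm u, ler_norm (- u))).
    rewrite normrN in h2; move: `|u| h0 h1 h2 => m h0 h1 h2.
    by apply/andP; split; nra.
  by rewrite pE => /eqP; rewrite subr_eq0 => /eqP; exists w.
have rK' : cancel (fun u : R => u ^+ 3) r by move=> u; apply: cube_inj; rewrite /= rK.
exists r; split=> // u; rewrite -(rK u).
have h : {near r u, continuous (fun w : R => w ^+ 3)}.
  by near=> w; exact: exprn_continuous.
have k : {near r u, cancel (fun w : R => w ^+ 3) r} by near=> w; exact: rK'.
exact: (nbhs_singleton (near_can_continuous k h)).
Unshelve. all: by end_near.
Qed.

(** Multiplied by t^12 under the weighted action, as are a^3 and b |b|: division of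
    (a^3, b |b|) by it gives a point of the circle that depends on the class of
    (a, b) only. *)
Definition radius a b : R := Num.sqrt (a ^+ 6 + b ^+ 4).

Lemma radius_sq a b : radius a b ^+ 2 = a ^+ 6 + b ^+ 4.
Proof. by rewrite sqr_sqrtr // addr_ge0 // exprn_even_ge0. Qed.

Lemma radius_gt0 x : 0 < radius (\val x).1 (\val x).2.
Proof.
rewrite sqrtr_gt0; have := punctured_neq0 x; move: (\val x) => -[a b] /= ab0.
have a6 : 0 <= a ^+ 6 by rewrite exprn_even_ge0.
have b4 : 0 <= b ^+ 4 by rewrite exprn_even_ge0.
rewrite lt0r addr_ge0 // paddr_eq0 // !expf_eq0 /= andbT.
by rewrite negb_and.
Qed.

Lemma radius_scale t a b : t != 0 ->
  radius (t ^+ 4 * a) (t ^+ 6 * b) = t ^+ 12 * radius a b.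
Proof.
move=> t0; rewrite /radius (_ : _ + _ = (t ^+ 12) ^+ 2 * (a ^+ 6 + b ^+ 4)); last by ring.
by rewrite sqrtrM ?sqr_ge0 // sqrtr_sqr ger0_norm // exprn_even_ge0.
Qed.

Definition circle_coords x : R * R :=
  ((\val x).1 ^+ 3 / radius (\val x).1 (\val x).2,
   (\val x).2 * `|(\val x).2| / radius (\val x).1 (\val x).2).

Lemma circle_coordsP x : unit_circle R (circle_coords x).
Proof.
rewrite /unit_circle /circle_coords; have := radius_gt0 x.
have := radius_sq (\val x).1 (\val x).2.
move: (\val x) => -[a b] /= re r0; rewrite !expr_div_n -mulrDl re [(b * _) ^+ 2]exprMn.
rewrite real_normK ?num_real // -exprM -exprD divff // -re expf_neq0 //.
by rewrite gt_eqF.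
Qed.

Definition to_circle x : unit_circle R := exist _ (circle_coords x) (mem_set (circle_coordsP x)).

Lemma to_circle_eq x y : \pi_(weighted_quotient R) x = \pi_(weighted_quotient R) y ->
  to_circle x = to_circle y.
Proof.
move=> /wq_eqP[t t0 e]; apply: val_inj.
rewrite -[LHS]/(circle_coords x) -[RHS]/(circle_coords y) /circle_coords e.
move: (\val x) (radius_gt0 x) => -[a b] /= r0; rewrite radius_scale //.
have t6 : 0 <= t ^+ 6 by rewrite exprn_even_ge0.
rewrite normrM (ger0_norm t6).
by congr pair; field; rewrite t0 gt_eqF.
Qed.

Lemma to_circle_continuous : continuous to_circle.
Proof.
have [c1 c2] := @punctured_continuous R.
have {}c1 : cts (fun x : punctured_plane R => (\val x).1) by exact: c1.
have {}c2 : cts (fun x : punctured_plane R => (\val x).2) by exact: c2.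
have cr : cts (fun x : punctured_plane R => (radius (\val x).1 (\val x).2)^-1).
  have c : cts (fun x : punctured_plane R => (\val x).1 ^+ 6 + (\val x).2 ^+ 4) by cts_tac.
  apply: ctsV => [x|x]; last by rewrite gt_eqF // radius_gt0.
  exact: (continuous_comp (c x) (@sqrt_continuous R _)).
have cn : cts (fun x : punctured_plane R => `|(\val x).2|).
  by move=> x; exact: (continuous_comp (c2 x) (@norm_continuous _ _ _)).
apply: continuous_comp_initial => x.
have d1 : cts (fun x : punctured_plane R => (circle_coords x).1) by rewrite /circle_coords /=; cts_tac.
have d2 : cts (fun x : punctured_plane R => (circle_coords x).2) by rewrite /circle_coords /=; cts_tac.
exact: (cvg_pair (d1 x) (d2 x)).
Qed.

(** The inverse takes (u, v) to the class of the cube root of u and of the root of v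
    with sign. A class is recovered because t^12 takes all positive values. *)
Lemma quotient_circle : homeomorphic (weighted_quotient R) (unit_circle R).
Proof.
pose f (w : weighted_quotient R) := to_circle (generic_quotient.repr w).
have fpi x : f (\pi_(weighted_quotient R) x) = to_circle x.
  by apply: to_circle_eq; rewrite reprK.
have [r [rK rK' cr]] := cube_root.
have r0 u : (r u == 0) = (u == 0).
  by rewrite -[in RHS](rK' u) expf_eq0.
pose s (v : R) := Num.sqrt v - Num.sqrt (- v).
have sE v : s v * `|s v| = v.
  rewrite /s; case: (lerP 0 v) => v0.
    rewrite (ler0_sqrtr (_ : - v <= 0)) ?oppr_le0 // subr0 ger0_norm ?sqrtr_ge0 //.
    by rewrite -expr2 sqr_sqrtr.
  rewrite (ltr0_sqrtr v0) sub0r normrN ger0_norm ?sqrtr_ge0 // mulNr.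
  by rewrite -expr2 sqr_sqrtr ?opprK // oppr_ge0 ltW.
pose h (p : unit_circle R) : R * R := (r (\val p).1, s (\val p).2).
have h0 p : punctured_plane R (h p).
  apply/negP=> /eqP -[a0 b0]; have := set_valP p; rewrite /unit_circle /=.
  have u0 : (\val p).1 = 0 by apply/eqP; rewrite -r0 a0.
  have v0 : (\val p).2 = 0 by rewrite -[LHS]sE b0 mul0r.
  by rewrite u0 v0 expr0n addr0 => /eqP; rewrite eq_sym oner_eq0.
pose H p : punctured_plane R := exist _ (h p) (mem_set (h0 p)).
have circ p : to_circle (H p) = p.
  apply: val_inj; rewrite -[LHS]/(circle_coords (H p)) /circle_coords.
  have -> : radius (\val (H p)).1 (\val (H p)).2 = 1.
    apply/eqP; rewrite -(@eqrXn2 _ 2) ?sqrtr_ge0 // radius_sq expr1n; apply/eqP.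
    transitivity ((\val p).1 ^+ 2 + (\val p).2 ^+ 2); last exact: (set_valP p).
    rewrite -[in RHS](rK' (\val p).1) -[in RHS](sE (\val p).2).
    by rewrite [(s _ * _) ^+ 2]exprMn real_normK ?num_real // -exprM -exprD.
  by rewrite !divr1 sE rK' -surjective_pairing.
exists f; split.
  apply/quotient_continuous.
  have -> : f \o \pi_(weighted_quotient R) = to_circle by apply/funext.
  exact: to_circle_continuous.
exists (\pi_(weighted_quotient R) \o H); split.
- move=> p; apply: continuous_comp; last exact: pi_continuous.
  move: p; apply: continuous_comp_initial.
  have cv : continuous (\val : unit_circle R -> R * R) by exact: initial_continuous.
  have c1 : cts (fun p : unit_circle R => (\val p).1).
    by move=> p; exact: (continuous_comp (cv p) cvg_fst).
  have c2 : cts (fun p : unit_circle R => (\val p).2).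
    by move=> p; exact: (continuous_comp (cv p) cvg_snd).
  have c3 : cts (fun p : unit_circle R => r (\val p).1).
    by move=> p; exact: (continuous_comp (c1 p) (cr _)).
  have csqrt (k : unit_circle R -> R) : cts k -> cts (fun p => Num.sqrt (k p)).
    by move=> ck p; exact: (continuous_comp (ck p) (@sqrt_continuous R _)).
  have c4 : cts (fun p : unit_circle R => s (\val p).2).
    by apply: ctsD; [|apply: ctsN]; apply: csqrt => //; exact: ctsN.
  exact: pair_continuous.
- move=> w; rewrite /= -[w]reprK fpi; apply/wq_eqP.
  set x := generic_quotient.repr w; set N := radius (\val x).1 (\val x).2.
  have N0 : 0 < N := radius_gt0 x.
  have Nn0 : N != 0 by rewrite gt_eqF.
  have rN0 : 0 < r N.
    by rewrite ltNge; apply: contraL N0 => rN; rewrite -leNgt -[N]rK'; nra.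
  (* The radius N is t^12 for the fourth root t of its cube root. *)
  pose t := Num.sqrt (Num.sqrt (r N)).
  have t4 : t ^+ 4 = r N by rewrite (exprM _ 2 2) !sqr_sqrtr ?sqrtr_ge0 // ltW.
  have t12 : t ^+ 12 = N by rewrite (exprM _ 4 3) t4 rK'.
  have t0 : t != 0 by apply: contraTneq N0 => t0; rewrite -t12 t0 expr0n ltxx.
  have t6 : 0 <= t ^+ 6 by rewrite exprn_even_ge0.
  exists t => //; rewrite /weighted_scale /=.
  rewrite -[sval x]/(\val x) [LHS]surjective_pairing /circle_coords -/N; congr pair.
    by apply: cube_inj; rewrite /= exprMn -exprM t12 rK' mulrC divfK.
  apply: signed_square_inj; rewrite normrM (ger0_norm t6) mulrACA sE -exprD t12.
  by rewrite [RHS]mulrC; exact: (esym (divfK Nn0 _)).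
- by move=> p /=; rewrite fpi circ.
Qed.

End Circle.

(** * The complex moduli space is a projective line *)

(** If all the roots of X^(n+1) - u were at distance at least e from a0, then
    |a0^(n+1) - u|, which is the product of these distances, would be at least
    e^(n+1). *)
Lemma open_power (K : numClosedFieldType) n (a0 : K) (A : set K) : nbhs a0 A ->
  \forall u \near a0 ^+ n.+1, exists2 a, A a & a ^+ n.+1 = u.
Proof.
move=> /nbhs_ballP[e /= e0 eA]; apply/nbhs_ballP; exists (e ^+ n.+1) => /=.
  by rewrite exprn_gt0.
move=> u; rewrite /ball /= => ue.
pose p : {poly K} := 'X^(n.+1) - u%:P.
have [rs] := closed_field_poly_normal p.
have -> : lead_coef p = 1 by apply/monicP/monicXnsubC.
rewrite scale1r => prs.
have srs : size rs = n.+1.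
  by have := size_XnsubC u (ltn0Sn n); rewrite -/p prs size_prod_XsubC => -[].
have pE y : p.[y] = y ^+ n.+1 - u by rewrite /p !(hornerD, hornerN, hornerXn, hornerC).
have [/hasP[r rrs re]|] := boolP (has (fun r => `|a0 - r| < e) rs).
  exists r; first exact: eA.
  apply/eqP; rewrite -subr_eq0 -pE -/(root p r) prs root_prod_XsubC //.
rewrite -all_predC => /allP far; exfalso.
suff : e ^+ n.+1 <= `|a0 ^+ n.+1 - u|.
  by move=> le; have := le_lt_trans le ue; rewrite ltxx.
rewrite -pE prs -srs => {prs srs}; elim: rs far => [|r rs IH] far.
  by rewrite big_nil hornerE normr1.
rewrite big_cons hornerM normrM [size _]/= exprS.
apply: ler_pM; [exact: ltW|by rewrite exprn_ge0 // ltW| |].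
  rewrite !(hornerD, hornerN, hornerX, hornerC).
  have := far r (mem_head _ _); rewrite /= -real_leNgt ?normr_real //.
  exact: gtr0_real e0.
by apply: IH => z zrs; apply: far; rewrite inE zrs orbT.
Qed.

Section Quotient.
Context {K : numClosedFieldType}.
Implicit Types (x y : punctured_plane K).

(** The scaling is the product of a cube root of unity, which takes care of a, and of
    1 or i, which takes care of the sign of b. *)
Lemma wq_powers x y : (\val x).1 ^+ 3 = (\val y).1 ^+ 3 ->
  (\val x).2 ^+ 2 = (\val y).2 ^+ 2 ->
  \pi_(weighted_quotient K) x = \pi_(weighted_quotient K) y.
Proof.
case: x y => -[a b] /= ab [[a' b'] /= ab'] e3 e2; apply/wq_eqP => /=.
have [s [s0 s4 s6]] : exists s, [/\ s != 0, s ^+ 4 * a = a' & s ^+ 6 = 1].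
  have [a0|a0] := eqVneq a 0.
    exists 1; rewrite oner_neq0 !expr1n mul1r; split=> //.
    by apply/esym/eqP; move: e3; rewrite a0 expr0n => /esym/eqP; rewrite expf_eq0.
  have s3 : (a' / a) ^+ 3 = 1 by rewrite expr_div_n -e3 divff // expf_neq0.
  have s0 : a' / a != 0 by apply: contra_eq_neq s3 => ->; rewrite expr0n eq_sym oner_eq0.
  exists (a' / a); split=> //; first by rewrite exprS s3 mulr1 divfK.
  by rewrite (exprM _ 3 2) s3 expr1n.
have [t [t0 t4 t6]] : exists t : K, [/\ t != 0, t ^+ 4 = 1 & t ^+ 6 * b = b'].
  move/eqP: e2; rewrite eqf_sqr => /orP[] /eqP ->.
    by exists 1; rewrite oner_neq0 !expr1n mul1r.
  exists 'i; rewrite neq0Ci (exprM _ 2 2) (exprM _ 2 3) sqrCi sqrrN expr1n.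
  by split=> //; rewrite -signr_odd /= expr1 mulrNN mul1r.
exists (s * t); first by rewrite mulf_neq0.
by rewrite /weighted_scale /= !exprMn t4 s6 mulr1 mul1r s4 t6.
Qed.

(** A twelfth root of the scalar between the ratios is a weighted scaling that reduces
    the claim to [wq_powers]. *)
Lemma cube_square_inj x y : cube_square_ratio x = cube_square_ratio y ->
  \pi_(weighted_quotient K) x = \pi_(weighted_quotient K) y.
Proof.
move=> /proj_spaceP[c c0 e].
have [t tE] : exists t : K, t ^+ 12 = c by exists (12.-root c); rewrite rootCK.
have t0 : t != 0 by apply: contraNneq c0 => t0; rewrite -tE t0 expr0n.
have h0 : punctured_plane K (weighted_scale t (\val x)).
  have := set_valP x; apply: contraNneq => h; have := weighted_scaleM t^-1 t (\val x).
  by rewrite h mulVf // weighted_scale1 /weighted_scale !mulr0 => <-.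
pose z : punctured_plane K := exist _ (weighted_scale t (\val x)) (mem_set h0).
transitivity (\pi_(weighted_quotient K) z); first by apply/wq_eqP; exists t.
have [e1 e2] := (congr1 fst e, congr1 snd e); rewrite /= in e1 e2.
apply: wq_powers.
- rewrite [RHS]e1 /= exprMn -exprM tE //.
- rewrite [RHS]e2 /= exprMn -exprM tE //.
Qed.

Lemma roots_subproof (q : punctured_plane K) :
  punctured_plane K (3.-root (\val q).1, sqrtC (\val q).2).
Proof.
apply/eqP=> -[/eqP + /eqP]; rewrite rootC_eq0 // rootC_eq0 // => a0 b0.
by have := punctured_neq0 q; rewrite a0 b0.
Qed.

Definition roots (q : punctured_plane K) : punctured_plane K :=
  exist _ (3.-root (\val q).1, sqrtC (\val q).2) (mem_set (roots_subproof q)).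

Lemma roots_ratio q : cube_square_ratio (roots q) = \pi_(proj_line K) q.
Proof.
apply/proj_spaceP; exists 1; first exact: oner_neq0.
by rewrite scale1r /= rootCK // sqrtCK -surjective_pairing.
Qed.

Definition ratio (w : weighted_quotient K) : proj_line K :=
  cube_square_ratio (generic_quotient.repr w).

Lemma ratio_pi x : ratio (\pi_(weighted_quotient K) x) = cube_square_ratio x.
Proof.
rewrite /ratio; set y := generic_quotient.repr _.
have /wq_eqP[t t0 e] : \pi_(weighted_quotient K) y = \pi_(weighted_quotient K) x by exact: reprK.
apply/proj_spaceP; exists (t ^+ 12); first by rewrite expf_neq0.
rewrite -[LHS]/((\val x).1 ^+ 3, (\val x).2 ^+ 2) e.
rewrite -[LHS]/((t ^+ 4 * (\val y).1) ^+ 3, (t ^+ 6 * (\val y).2) ^+ 2).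
by rewrite [(t ^+ 4 * _) ^+ 3]exprMn [(t ^+ 6 * _) ^+ 2]exprMn -(exprM t 4 3) -(exprM t 6 2).
Qed.

Lemma ratio_continuous : continuous ratio.
Proof.
apply/quotient_continuous.
have -> : ratio \o \pi_(weighted_quotient K) = \pi_(proj_line K) \o (@cube_square K).
  by apply/funext => x /=; rewrite ratio_pi.
move=> x; apply: continuous_comp; last exact: pi_continuous.
move: x; apply: continuous_comp_initial.
have [c1 c2] := @punctured_continuous K.
by apply: pair_continuous; apply: ctsX.
Qed.

Definition of_ratio (P : proj_line K) : weighted_quotient K :=
  \pi_(weighted_quotient K) (roots (generic_quotient.repr P)).

Lemma of_ratio_pi q : of_ratio (\pi_(proj_line K) q) = \pi_(weighted_quotient K) (roots q).
Proof. by apply: cube_square_inj; rewrite !roots_ratio reprK. Qed.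

(** The roots may jump, but by [open_power] any nearby pair has some cube root and
    some square root near the given ones, and their class is the same. *)
Lemma of_ratio_continuous : continuous of_ratio.
Proof.
apply/quotient_continuous => q U; rewrite /= of_ratio_pi => UU.
have : nbhs (roots q) (\pi_(weighted_quotient K) @^-1` U) := pi_continuous UU.
rewrite nbhsE => -[_ [[N oN <-] Nq] NU].
have [[A1 A2] /= [nA1 nA2] AN] : nbhs (\val (roots q) : plane K) N.
  by apply: open_nbhs_nbhs; split.
have [c1 c2] := @punctured_continuous K.
have near1 : \forall q' \near q, exists2 a, A1 a & a ^+ 3 = (\val q').1.
  by have := open_power 2 nA1; rewrite rootCK //; exact: (c1 q).
have near2 : \forall q' \near q, exists2 b, A2 b & b ^+ 2 = (\val q').2.
  by have := open_power 1 nA2; rewrite sqrtCK; exact: (c2 q).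
apply: filterS2 near1 near2 => q' /= [a A1a a3] [b A2b b2].
have ab : punctured_plane K (a, b).
  apply: contraTneq (punctured_neq0 q') => -[a0 b0].
  by rewrite -a3 -b2 a0 b0 !expr0n eqxx.
pose x : punctured_plane K := exist _ (a, b) (mem_set ab).
have -> : of_ratio (\pi_(proj_line K) q') = \pi_(weighted_quotient K) x.
  rewrite of_ratio_pi; apply: cube_square_inj; rewrite roots_ratio.
  apply/proj_spaceP; exists 1; first exact: oner_neq0.
  by rewrite scale1r /= a3 b2 -surjective_pairing.
by apply: (NU x); apply: (AN (a, b)).
Qed.

Lemma ratio_homeomorphism : homeomorphism ratio.
Proof.
split; first exact: ratio_continuous.
exists of_ratio; split; first exact: of_ratio_continuous.
- move=> w; rewrite -[w]reprK ratio_pi; set x := generic_quotient.repr w.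
  by apply: cube_square_inj; rewrite roots_ratio reprK.
- by move=> P; rewrite ratio_pi roots_ratio reprK.
Qed.

End Quotient.

(** * The complex projective line is a sphere *)

(** Continuity at a point may be tested on a local lift to the plane. *)
Lemma proj_continuous_at (K : numFieldType) (X : topologicalType) (G : X -> proj_line K)
    (h : X -> plane K) s : h s' @[s' --> s] --> h s ->
  (\forall s' \near s, exists2 x : punctured_plane K,
     \val x = h s' & \pi_(proj_line K) x = G s') ->
  G s' @[s' --> s] --> G s.
Proof.
move=> ch near_s; have [x xE xG] := nbhs_singleton near_s.
move=> U; rewrite /= -xG => UU.
have [_ [[N oN <-] Nx] NU] :
    exists2 B, open_nbhs x B & B `<=` \pi_(proj_line K) @^-1` U.
  by have : nbhs x (\pi_(proj_line K) @^-1` U) := pi_continuous UU; rewrite nbhsE.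
have nN : nbhs (h s) N by rewrite -xE; apply: open_nbhs_nbhs; split.
have near_N : \forall s' \near s, N (h s') by exact: ch.
suff : \forall s' \near s, U (G s') by [].
apply: filterS2 near_s near_N => s' [y yE <-] Ny.
by apply: (NU y); move: Ny; rewrite -yE.
Qed.

Section Sphere.
Context {R : realType}.
Local Notation K := (R[i] : numFieldType).
Implicit Types (x y : punctured_plane K) (s : unit_sphere R) (w : K * K) (m : R * R * R).

Lemma Re_continuous : continuous (fun z : K => complex.Re z).
Proof.
move=> z U /nbhs_ballP[e /= e0 eU]; apply/nbhs_ballP; exists e%:C%C => /=.
  by rewrite ltcR.
move=> z' zz'; apply: eU; rewrite /ball /= in zz' *.
rewrite -ltcR -raddfB; apply: le_lt_trans zz'; exact: normc_ge_Re.
Qed.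

Lemma Im_continuous : continuous (fun z : K => complex.Im z).
Proof.
have -> : (fun z : K => complex.Im z) = (fun z : K => complex.Re (- 'i%C * z)).
  by apply/funext => -[a b] /=; ring.
have c : cts (fun z : K => - 'i%C * z).
  by apply: (@ctsM _ _ (fun=> - 'i%C) id); [exact: cts_cst|move=> z; exact: cvg_id].
by move=> z; exact: (continuous_comp (c z) (@Re_continuous _)).
Qed.

Lemma real_complex_continuous : continuous (fun a : R => a%:C%C : K).
Proof.
move=> a U /nbhs_ballP[e /= e0 eU].
have [e1 e2] : complex.Im e = 0 /\ 0 < complex.Re e.
  by move: e0; rewrite ltcE /= => /andP[/eqP].
apply/nbhs_ballP; exists (complex.Re e) => //= b; rewrite /ball /= => ab.
apply: eU; rewrite /ball /= -raddfB /= normc_def /= expr0n addr0 sqrtr_sqr.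
by case: e e1 e2 ab {e0} => p q /= -> _ ab; rewrite ltcR.
Qed.

Lemma Complex_continuous (X : topologicalType) (f g : X -> R) : cts f -> cts g ->
  cts (fun z => Complex (f z) (g z) : K).
Proof.
move=> cf cg.
have realC (k : X -> R) : cts k -> cts (fun z => (k z)%:C%C : K).
  by move=> ck z; exact: (continuous_comp (ck z) (@real_complex_continuous _)).
have -> : (fun z => Complex (f z) (g z) : K) = (fun z => (f z)%:C%C + 'i%C * (g z)%:C%C).
  by apply/funext => z; rewrite [LHS]complexE.
by apply: ctsD; [|apply: ctsM]; [exact: realC|exact: cts_cst|exact: realC].
Qed.

Definition sqnorm w : R := complex.Re w.1 ^+ 2 + complex.Im w.1 ^+ 2 +
  (complex.Re w.2 ^+ 2 + complex.Im w.2 ^+ 2).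

(** The point (2 u conj(v), |u|^2 - |v|^2) / (|u|^2 + |v|^2) for w = (u, v): the
    inverse of the stereographic projection, at u / v. *)
Definition stereo w : R * R * R :=
  (2 * (complex.Re w.1 * complex.Re w.2 + complex.Im w.1 * complex.Im w.2) / sqnorm w,
   2 * (complex.Im w.1 * complex.Re w.2 - complex.Re w.1 * complex.Im w.2) / sqnorm w,
   (complex.Re w.1 ^+ 2 + complex.Im w.1 ^+ 2 -
     (complex.Re w.2 ^+ 2 + complex.Im w.2 ^+ 2)) / sqnorm w).

Lemma sqnorm_gt0 x : 0 < sqnorm (\val x).
Proof.
have := punctured_neq0 x; case: (\val x) => -[p q] [r t]; rewrite /sqnorm /=.
rewrite !eq_complex /= -!negb_and => h; rewrite lt0r !addr_ge0 ?sqr_ge0 // andbT.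
by rewrite !paddr_eq0 ?addr_ge0 ?sqr_ge0 // !sqrf_eq0.
Qed.

Lemma stereoP x : unit_sphere R (stereo (\val x)).
Proof.
have := sqnorm_gt0 x; case: (\val x) => -[p q] [r t]; rewrite /unit_sphere /stereo /sqnorm /=.
by move=> /lt0r_neq0 n0; field.
Qed.

Definition to_sphere x : unit_sphere R := exist _ (stereo (\val x)) (mem_set (stereoP x)).

Lemma to_sphere_eq x y : \pi_(proj_line K) x = \pi_(proj_line K) y -> to_sphere x = to_sphere y.
Proof.
move=> /proj_spaceP[c c0 e]; apply: val_inj.
rewrite -[LHS]/(stereo (\val x)) -[RHS]/(stereo (\val y)).
have := sqnorm_gt0 y; have := sqnorm_gt0 x.
have -> : \val y = (c * (\val x).1, c * (\val x).2) by exact: e.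
case: c c0 {e} => e f; case: (\val x) => -[p q] [r t]; rewrite /stereo /sqnorm /=.
move=> _ /lt0r_neq0 n0 /lt0r_neq0 n1.
by congr (_, _, _); field; apply/andP; split.
Qed.

Lemma to_sphere_continuous : continuous to_sphere.
Proof.
have [c1 c2] := @punctured_continuous K.
have re1 : cts (fun x => complex.Re (\val x).1).
  by move=> x; exact: (continuous_comp (c1 x) (@Re_continuous _)).
have im1 : cts (fun x => complex.Im (\val x).1).
  by move=> x; exact: (continuous_comp (c1 x) (@Im_continuous _)).
have re2 : cts (fun x => complex.Re (\val x).2).
  by move=> x; exact: (continuous_comp (c2 x) (@Re_continuous _)).
have im2 : cts (fun x => complex.Im (\val x).2).
  by move=> x; exact: (continuous_comp (c2 x) (@Im_continuous _)).
have cn : cts (fun x => (sqnorm (\val x))^-1).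
  apply: ctsV => [|x]; last by rewrite gt_eqF // sqnorm_gt0.
  by rewrite /sqnorm; cts_tac.
apply: continuous_comp_initial => x.
have d1 : cts (fun x => (stereo (\val x)).1.1) by rewrite /stereo /=; cts_tac.
have d2 : cts (fun x => (stereo (\val x)).1.2) by rewrite /stereo /=; cts_tac.
have d3 : cts (fun x => (stereo (\val x)).2) by rewrite /stereo /=; cts_tac.
exact: (cvg_pair (cvg_pair (d1 x) (d2 x)) (d3 x)).
Qed.

(** The stereographic projections from the two poles, in homogeneous coordinates. *)
Definition north m : K * K := (Complex m.1.1 m.1.2, Complex (1 - m.2) 0).
Definition south m : K * K := (Complex (1 + m.2) 0, Complex m.1.1 (- m.1.2)).

Lemma stereo_north m : unit_sphere R m -> m.2 != 1 -> stereo (north m) = m.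
Proof.
case: m => -[a b] z; rewrite /unit_sphere /stereo /sqnorm /north /= => e z1.
have n0 : 1 - z != 0 by rewrite subr_eq0 eq_sym.
have -> : a ^+ 2 + b ^+ 2 = (1 - z) * (1 + z) by apply: (lin_eq e (oner_neq0 R)); ring.
have -> : (1 - z) * (1 + z) + ((1 - z) ^+ 2 + 0 ^+ 2) = 2 * (1 - z) by ring.
by congr (_, _, _); field.
Qed.

Lemma stereo_south m : unit_sphere R m -> m.2 != -1 -> stereo (south m) = m.
Proof.
case: m => -[a b] z; rewrite /unit_sphere /stereo /sqnorm /south /= => e z1.
have n0 : 1 + z != 0 by rewrite addrC -[1]opprK subr_eq0.
have -> : a ^+ 2 + (- b) ^+ 2 = (1 - z) * (1 + z) by apply: (lin_eq e (oner_neq0 R)); ring.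
have -> : (1 + z) ^+ 2 + 0 ^+ 2 + (1 - z) * (1 + z) = 2 * (1 + z) by ring.
by congr (_, _, _); field.
Qed.

Definition of_stereo m : K * K := if m.2 < 0 then north m else south m.

Lemma north_neq0 m : m.2 != 1 -> punctured_plane K (north m).
Proof.
by apply: contraNneq => -[_ _ /eqP]; rewrite subr_eq0 eq_sym.
Qed.

Lemma south_neq0 m : m.2 != -1 -> punctured_plane K (south m).
Proof.
by apply: contraNneq => -[/eqP]; rewrite addrC addr_eq0.
Qed.

Lemma lt0_neq1 (z : R) : z < 0 -> z != 1.
Proof. by move=> z0; rewrite lt_eqF // (lt_trans z0). Qed.

Lemma ge0_neqN1 (z : R) : ~~ (z < 0) -> z != -1.
Proof. by apply: contraNneq => ->; rewrite oppr_lt0. Qed.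

Lemma of_stereo_neq0 m : punctured_plane K (of_stereo m).
Proof.
rewrite /of_stereo; have [/lt0_neq1|] := boolP (m.2 < 0); first exact: north_neq0.
by move/ge0_neqN1; exact: south_neq0.
Qed.

Definition of_sphere s : proj_line K :=
  \pi_(proj_line K) (exist _ (of_stereo (\val s))
    (mem_set (of_stereo_neq0 (\val s))) : punctured_plane K).

(** The lifts at the image of (u, v) are its multiples by conj(v) and conj(u), up to
    the factor 2 / (|u|^2 + |v|^2). *)
Lemma to_sphereK x : of_sphere (to_sphere x) = \pi_(proj_line K) x.
Proof.
apply/esym/proj_spaceP; rewrite -[\val (exist _ _ _)]/(of_stereo (stereo (\val x))).
have := sqnorm_gt0 x; case: (\val x) => -[p q] [r t] n0.
have nn0 : sqnorm (Complex p q, Complex r t) != 0 by rewrite gt_eqF.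
have scaleE (c : K) (w : K * K) (w' : plane K) : w' = (c * w.1, c * w.2) -> w' = c *: (w : plane K).
  by move=> ->.
rewrite /of_stereo; case: ifP => z0.
- exists (Complex (2 * r / sqnorm (Complex p q, Complex r t))
                  (- (2 * t) / sqnorm (Complex p q, Complex r t))).
    apply: contraTneq z0 => -[/eqP + /eqP].
    rewrite !mulf_eq0 invr_eq0 (negbTE nn0) oppr_eq0 mulf_eq0 pnatr_eq0 !orbF /= => /eqP r0 /eqP t0.
    rewrite r0 t0 in n0 *.
    rewrite -leNgt /stereo /=; apply: divr_ge0; last exact: ltW.
    by rewrite expr0n addr0 subr0 addr_ge0 ?sqr_ge0.
  apply: scaleE; rewrite /north /stereo /sqnorm /= in nn0 *.
  by congr (Complex _ _, Complex _ _); field.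
- exists (Complex (2 * p / sqnorm (Complex p q, Complex r t))
                  (- (2 * q) / sqnorm (Complex p q, Complex r t))).
    apply: contraFneq z0 => -[/eqP + /eqP].
    rewrite !mulf_eq0 invr_eq0 (negbTE nn0) oppr_eq0 mulf_eq0 pnatr_eq0 !orbF /= => /eqP p0 /eqP q0.
    rewrite p0 q0 in nn0 n0 *; rewrite /stereo /= pmulr_llt0 ?invr_gt0 //.
    by move: n0; rewrite /sqnorm /=; lra.
  apply: scaleE; rewrite /south /stereo /sqnorm /= in nn0 *.
  by congr (Complex _ _, Complex _ _); field.
Qed.

Lemma of_sphere_stereo x s : stereo (\val x) = \val s -> of_sphere s = \pi_(proj_line K) x.
Proof. by move=> e; rewrite -to_sphereK; congr of_sphere; apply: val_inj; rewrite /= e. Qed.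

Lemma of_sphere_continuous : continuous of_sphere.
Proof.
have cv : continuous (\val : unit_sphere R -> R * R * R) by exact: initial_continuous.
have c12 s : (\val s').1 @[s' --> s] --> (\val s).1.
  exact: (continuous_comp (cv s) cvg_fst).
have cX : cts (fun s => (\val s).1.1) by move=> s; exact: (continuous_comp (c12 s) cvg_fst).
have cY : cts (fun s => (\val s).1.2) by move=> s; exact: (continuous_comp (c12 s) cvg_snd).
have cZ : cts (fun s => (\val s).2) by move=> s; exact: (continuous_comp (cv s) cvg_snd).
move=> s; have [z0|] := boolP ((\val s).2 < 0).
- apply: (@proj_continuous_at _ _ of_sphere (fun s' => north (\val s'))).
    move: s {z0}; apply: pair_continuous; apply: Complex_continuous => //.
      by apply: (@ctsD _ _ (fun=> 1)); [exact: cts_cst|exact: ctsN].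
    exact: cts_cst.
  have : \forall s' \near s, (\val s').2 < 0.
    exact: (cZ s _ (lt_nbhsl z0)).
  apply: (@filterS _ _ (nbhs_filter s)) => s' /lt0_neq1 z1.
  exists (exist _ (north (\val s')) (mem_set (north_neq0 z1)) : punctured_plane K) => //.
  by apply/esym/of_sphere_stereo; apply: stereo_north => //; exact: set_valP.
- rewrite -leNgt => z0; apply: (@proj_continuous_at _ _ of_sphere (fun s' => south (\val s'))).
    move: s {z0}; apply: pair_continuous; apply: Complex_continuous => //.
    + by apply: (@ctsD _ _ (fun=> 1)); [exact: cts_cst|].
    + exact: cts_cst.
    + exact: ctsN.
  have : \forall s' \near s, -1 < (\val s').2.
    by apply: (cZ s _ (lt_nbhsr _)); rewrite (lt_le_trans _ z0) // oppr_lt0.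
  apply: (@filterS _ _ (nbhs_filter s)) => s' z1; have {}z1 : (\val s').2 != -1 by rewrite gt_eqF.
  exists (exist _ (south (\val s')) (mem_set (south_neq0 z1)) : punctured_plane K) => //.
  by apply/esym/of_sphere_stereo; apply: stereo_south => //; exact: set_valP.
Qed.

Lemma proj_line_sphere : homeomorphic (proj_line K) (unit_sphere R).
Proof.
pose f (P : proj_line K) := to_sphere (generic_quotient.repr P).
have fpi x : f (\pi_(proj_line K) x) = to_sphere x by apply: to_sphere_eq; rewrite reprK.
exists f; split.
  apply/quotient_continuous.
  have -> : f \o \pi_(proj_line K) = to_sphere by apply/funext.
  exact: to_sphere_continuous.
exists of_sphere; split; first exact: of_sphere_continuous.
- by move=> P; rewrite -[P]reprK fpi to_sphereK.
- move=> s; rewrite fpi; apply: val_inj.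
  rewrite -[LHS]/(stereo (of_stereo (\val s))) /of_stereo.
  have sP : unit_sphere R (\val s) := set_valP s.
  case: ifP => [/lt0_neq1|/negbT/ge0_neqN1]; first exact: stereo_north.
  exact: stereo_south.
Qed.

End Sphere.

(** * Real and complex cubics *)

(** A real cubic without real lines contains no complex line either, so it has a
    complex flex, and then also a real one. *)
Lemma real_flexible (R : realType) : flexible R.
Proof.
move=> c nl.
have nlC : ~ has_line (map_cubic (real_complex R) c) by move/real_line.
have [v vE] := closed_flex nlC.
exact: real_flex vE nlC.
Qed.

Lemma weierstrass_map_homeomorphism (F : numFieldType) : flexible F ->
  homeomorphism (weierstrass_map : weighted_quotient F -> moduli F 3).
Proof.
move=> flexF; split; first exact: weierstrass_map_continuous.
exists (invariant_map flexF); split; first exact: invariant_map_continuous.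
- exact: weierstrass_mapK.
- exact: invariant_mapK.
Qed.

Lemma invariant_map_homeomorphism (F : numFieldType) (flexF : flexible F) :
  homeomorphism (invariant_map flexF).
Proof.
split; first exact: invariant_map_continuous.
exists weierstrass_map; split; first exact: weierstrass_map_continuous.
- exact: invariant_mapK.
- exact: weierstrass_mapK.
Qed.

Theorem theorem5p3 (R : realType) :
  [/\ fs_cycles R 3 = fs_curves R 3,
      exists phi : weighted_quotient R -> moduli R 3,
        homeomorphism phi /\
        forall p : punctured_plane R,
          is_weierstrass_class (\val p).1 (\val p).2
            (phi (\pi_(weighted_quotient R) p))
    & homeomorphic (moduli R 3) (unit_circle R)]
  /\
  [/\ fs_cycles R[i] 3 = fs_curves R[i] 3,
      exists phi : weighted_quotient R[i] -> moduli R[i] 3,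
        [/\ homeomorphism phi,
            forall p : punctured_plane R[i],
              is_weierstrass_class (\val p).1 (\val p).2
                (phi (\pi_(weighted_quotient R[i]) p))
          & exists2 psi : moduli R[i] 3 -> proj_line R[i],
              homeomorphism psi &
              forall p : punctured_plane R[i],
                psi (phi (\pi_(weighted_quotient R[i]) p)) =
                cube_square_ratio p]
    & homeomorphic (proj_line R[i]) (unit_sphere R)].
Proof.
have flexR : flexible R by exact: real_flexible.
have flexC : flexible R[i] by move=> c; exact: closed_flex.
split; split.
- exact: fs_cycles_curves.
- by exists weierstrass_map; split; [exact: weierstrass_map_homeomorphism|exact: weierstrass_map_class].
- have [f fH] := @quotient_circle R; exists (f \o invariant_map flexR).
  exact: homeomorphism_comp (invariant_map_homeomorphism flexR) fH.
- exact: fs_cycles_curves.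
- exists weierstrass_map; split; [exact: weierstrass_map_homeomorphism|exact: weierstrass_map_class|].
  exists (ratio \o invariant_map flexC).
    exact: homeomorphism_comp (invariant_map_homeomorphism flexC) ratio_homeomorphism.
  by move=> p /=; rewrite weierstrass_mapK ratio_pi.
- exact: proj_line_sphere.
Qed.
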